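(* Let $m>0$ and let $V$ be any (not necessarily self-adjoint) $2\times2$ complex matrix-valued potential with continuous entries satisfying $|V(x)|\lesssim\langle x\rangle^{-1-}$, and let $H=D_m+V$. Let $\sigma>\frac12$. Then there exist $m<\lambda_1<\infty$ and $\delta>0$, depending on $V$, $m$ and $\sigma$, so that $$\sup_{\substack{|\lambda|>\lambda_1\\0<|\gamma|<\delta|\lambda|}}\big\|\langle x\rangle^{-\sigma}(H-(\lambda+i\gamma))^{-1}\langle x\rangle^{-\sigma}\big\|_{L^2\to L^2}\lesssim1 .$$ As a result, there is a compact subset of the complex plane outside of which the spectrum of $H$ is confined to the real axis.
   Context: $D_m=i\alpha\partial_x+m\beta$ with $\alpha=\begin{pmatrix}-1&0\\0&1\end{pmatrix}$, $\beta=\begin{pmatrix}0&1\\1&0\end{pmatrix}$, acting on $\mathbb C^2$-valued functions on $\mathbb R$; $H$ has the same domain as $D_m$. $\langle x\rangle=(1+|x|^2)^{1/2}$; $|V(x)|\lesssim\langle x\rangle^{-1-}$ means that for some $\epsilon>0$ each entry is bounded by a constant times $\langle x\rangle^{-1-\epsilon}$. In the supremum, $\lambda$ and $\gamma$ are real. *)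

(* Defs.v *)
From HB Require Import structures.
From mathcomp Require Export all_boot all_order all_algebra.
From mathcomp Require Export complex.
From mathcomp Require Export all_classical all_reals all_analysis.
Export numFieldNormedType.Exports.

Set Implicit Arguments.
Unset Strict Implicit.
Unset Printing Implicit Defensive.
Import Order.TTheory GRing.Theory Num.Theory.

Local Open Scope classical_set_scope.
Local Open Scope ring_scope.

Section OneDimensionalDirac.
Context {R : realType}.

Local Notation mu := (@lebesgue_measure R).
Local Notation Re := complex.Re.
Local Notation Im := complex.Im.
Local Notation cmod := (@ComplexField.Normc.normc R).

Definition japanese (x : R) : R := Num.sqrt (1 + `|x| ^+ 2).

(** Elements of L^2(R; C^2) are represented by functions, equality being
    equality almost everywhere. *)

Definition spinor := R -> 'cV[R[i]]_2.

(* the Euclidean norm on C^2 *)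
Definition vnorm (v : 'cV[R[i]]_2) : R :=
  Num.sqrt (\sum_(j < 2) cmod (v j 0) ^+ 2).

Definition measurable_spinor (u : spinor) : Prop :=
  forall j : 'I_2, measurable_fun setT (fun x => Re (u x j 0)) /\
                   measurable_fun setT (fun x => Im (u x j 0)).

Definition L2norm (u : spinor) : \bar R :=
  Lnorm mu 2%:E (fun x => (vnorm (u x))%:E).

Definition L2 : set spinor :=
  [set u | measurable_spinor u /\ (L2norm u < +oo)%E].

Definition cintegral (D : set R) (f : R -> R[i]) : R[i] :=
  Complex (Rintegral mu D (fun x => Re (f x)))
          (Rintegral mu D (fun x => Im (f x))).

(* u is the (locally absolutely) continuous representative of an element of
   the Sobolev space H^1(R; C^2), and u' is its weak derivative. *)
Definition H1_deriv (u u' : spinor) : Prop :=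
  [/\ L2 u, L2 u' &
      forall a b : R, a <= b -> forall j : 'I_2,
        u b j 0 - u a j 0 = cintegral `[a, b] (fun x => u' x j 0)].

(** An unbounded operator on L^2 is given by its graph: T u f means that u is
    in the domain of T and T u = f. *)

Definition operator := spinor -> spinor -> Prop.

Definition alpha : 'M[R[i]]_2 :=
  \matrix_(i, j) (if i == j then (if i == 0 then -1 else 1) else 0).

Definition beta : 'M[R[i]]_2 := \matrix_(i, j) (if i == j then 0 else 1).

Definition dirac (m : R) : operator := fun u f =>
  [/\ L2 u, L2 f &
      exists w w' : spinor,
        [/\ H1_deriv w w', {ae mu, forall x, u x = w x} &
            {ae mu, forall x, f x = 'i%C *: (alpha *m w' x)
                                    + m%:C%C *: (beta *m w x)}]].

(* T + W, with the domain of T when W is bounded *)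
Definition add_potential (T : operator) (W : R -> 'M[R[i]]_2) : operator :=
  fun u f => L2 f /\
    exists2 g, T u g & {ae mu, forall x, f x = g x + W x *m u x}.

Definition subz (T : operator) (z : R[i]) : operator :=
  add_potential T (fun=> (- z)%:M).

Definition resolvent_set (T : operator) : set R[i] :=
  [set z | [/\ forall f, L2 f -> exists u, subz T z u f,
               forall u v f, subz T z u f -> subz T z v f ->
                 {ae mu, forall x, u x = v x} &
               exists C : R, forall u f, subz T z u f ->
                 (L2norm u <= C%:E * L2norm f)%E]].

Definition spectrum (T : operator) : set R[i] := ~` resolvent_set T.

(* (T - z)^-1, meaningful for z in the resolvent set; a representative of the
   (a.e. unique) solution u of (T - z) u = f is chosen. *)
Definition resolvent (T : operator) (z : R[i]) (f : spinor) : spinor :=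
  xget (fun=> 0) [set u | subz T z u f].

Definition opnorm (B : spinor -> spinor) : \bar R :=
  ereal_sup [set L2norm (B g) | g in [set g | L2 g /\ (L2norm g <= 1)%E]].

(* multiplication by <x>^s *)
Definition weight (s : R) (u : spinor) : spinor :=
  fun x => (japanese x `^ s)%:C%C *: u x.

(* |V(x)| <~ <x>^(-1-) *)
Definition short_range (V : R -> 'M[R[i]]_2) : Prop :=
  exists2 eps : R, 0 < eps &
    exists C : R, forall x i j,
      cmod (V x i j) <= C * japanese x `^ (- 1 - eps).

End OneDimensionalDirac.

(* Main.v *)
Require Import Defs.
From mathcomp Require Import ring lra measurable_realfun.
Set Implicit Arguments.
Unset Strict Implicit.
Unset Printing Implicit Defensive.
Import Order.TTheory GRing.Theory Num.Theory.
Import numFieldNormedType.Exports.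
Local Open Scope classical_set_scope.
Local Open Scope ring_scope.

(** Solved for the derivatives, (H - z) u = f is the first order system
      u1' =   i (f1 + z u1 - m u2 - V11 u1 - V12 u2),
      u2' = - i (f2 + z u2 - m u1 - V21 u1 - V22 u2).
    The theorem follows from one estimate ([high_energy]): there are R and C
    such that, for all non-real z with |z| >= R and all integrable f, there is
    exactly one bounded solution, and it satisfies sup |u| <= C |f|_1.  As
    sigma > 1/2, the weight <x>^-sigma is square integrable, so between two
    such weights a map from L^1 to L^infinity is bounded on L^2.  The ratio of
    Im z to Re z does not enter: delta = 1 will do, and outside a square only
    real points of the spectrum remain.

    The difficulty is that V is not small; its entries are removed by different
    means, after which Duhamel's formula is a contraction for the sup norm
    ([system_solution], [system_apriori]).
    - The diagonal entries are integrable, hence they only multiply the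
      propagators exp (+- i k x) by bounded factors ([propagator]).
    - The mass is constant, hence not integrable, and is removed exactly by the
      constant matrix with rows (1, tau) and (tau, 1), where
      z = m (tau + 1/tau) / 2; the wave number k satisfies z^2 = k^2 + m^2 and
      tau = O(1/|z|) ([joukowski]).
    - The upper entry - i V12 couples two solutions whose phases differ by
      exp (2 i k x).  It is approximated in L^1 by a C^1 function p
      ([mollify]); the shear with rows (1, n) and (0, 1), n = - p / (2 i k),
      cancels p and leaves terms of size O(1/|k|).
    - The lower entry i V21 is made small by the change of unknown
      y2 -> eta y2 with a small constant eta; this multiplies the upper entry
      by 1/eta, and that entry is as small as desired since eta is chosen before
      p and p before the lower bound on |z|.

    That z belongs to the resolvent set also requires u in L^2 for f in L^2.
    For such f, Duhamel's formula still gives bounded solutions, because the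
    propagators decay exponentially at the rate |Im k|.  The identity
      (|u1|^2 - |u2|^2)' = - 2 Im z |u|^2 + (terms in f and V)
    then bounds |u|_2 by |f|_2 and sup |u| ([energy_estimate]). *)

(** * Primitives of locally integrable functions *)

Section RealPrimitives.
Context {R : realType}.
Implicit Types (F G f g : R -> R) (a b c x y : R).
Local Notation mu := (@lebesgue_measure R).

Local Notation integ D f := (mu.-integrable D (EFin \o f)).

Lemma integD (D : set R) f g : measurable D -> integ D f -> integ D g ->
  integ D (fun x => f x + g x).
Proof. by move=> mD hf hg; rewrite (_ : _ \o _ = (EFin \o f) \+ (EFin \o g))%E//; exact: integrableD. Qed.

Lemma integZ (D : set R) (k : R) f : measurable D -> integ D f ->
  integ D (fun x => k * f x).
Proof.
move=> mD hf; rewrite (_ : _ \o _ = (fun x => k%:E * (EFin \o f) x)%E)//.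
exact: integrableZl.
Qed.

Lemma integ_norm (D : set R) f : measurable D -> integ D f ->
  integ D (fun x => `|f x|).
Proof. by move=> mD hf; apply: integrable_norm. Qed.

Lemma le_integ (D : set R) f g : measurable D -> measurable_fun setT f ->
  (forall x, D x -> `|f x| <= g x) -> integ D g -> integ D f.
Proof.
move=> mD mf fg ig; apply: le_integrable ig => //.
  by apply/measurable_EFinP; exact: measurable_funS mf.
by move=> x Dx /=; rewrite lee_fin (le_trans (fg x Dx)) ?ler_norm.
Qed.

Lemma integ_ge0 (g : R -> R) (G : R) : measurable_fun setT g ->
  (forall x, 0 <= g x) -> (\int[mu]_x (g x)%:E <= G%:E)%E -> integ setT g.
Proof.
move=> mg g0 gG; apply/integrableP; split; first exact/measurable_EFinP.
apply: le_lt_trans (ltry G); apply: le_trans gG.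
rewrite le_eqVlt; apply/orP; left; apply/eqP.
by apply: eq_integral => x _ /=; rewrite ger0_norm.
Qed.

Definition locint f := measurable_fun setT f /\ forall a b, integ `[a, b] f.

(** [F] is locally absolutely continuous.  The density [f] is only determined
    almost everywhere: it may be the weak derivative of an element of H^1. *)
Definition prim F f := locint f /\
  forall a b, a <= b -> F b - F a = Rintegral mu `[a, b] f.

Lemma cont_locint f : continuous f -> locint f.
Proof.
move=> cf; split; first exact: continuous_measurable_fun.
move=> a b; apply: continuous_compact_integrable; first exact: segment_compact.
exact: continuous_subspaceT.
Qed.

Lemma locint_norm f : locint f -> locint (fun x => `|f x|).
Proof.
move=> [mf lf]; split; first exact: measurableT_comp.
by move=> a b; apply: integ_norm.
Qed.

Lemma locintD f g : locint f -> locint g -> locint (fun x => f x + g x).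
Proof.
move=> [mf lf] [mg lg]; split; first exact: measurable_funD.
by move=> a b; apply: integD.
Qed.

Lemma locintZ (k : R) f : locint f -> locint (fun x => k * f x).
Proof.
move=> [mf lf]; split; first exact: measurable_funM.
by move=> a b; apply: integZ.
Qed.

Lemma locintM f g : locint f -> continuous g -> locint (fun x => f x * g x).
Proof.
move=> [mf lf] cg; have mg := continuous_measurable_fun cg.
split; first exact: measurable_funM.
move=> a b.
have [M [_ Mg]] := compact_bounded (continuous_compact (continuous_subspaceT cg (A := `[a, b]%classic)) (@segment_compact _ a b)).
have m := measurable_itv `[a, b].
have : integ `[a, b] (fun x => (M + 1) * `|f x|) by apply/integZ => //; exact/integ_norm.
apply: le_integ => //; first exact: measurable_funM.
move=> x abx /=; rewrite mulrC normrM ler_wpM2r//.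
by apply: Mg; [rewrite ltrDl | exists x].
Qed.

Lemma Rintegral_chasles f a b c : locint f -> a <= b -> b <= c ->
  Rintegral mu `[a, b] f + Rintegral mu `[b, c] f = Rintegral mu `[a, c] f.
Proof.
move=> [_ lf] ab bc.
have := @Rintegral_itvB _ f (BLeft a) (BRight c) b (lf a c).
rewrite !bnd_simp => /(_ ab bc).
rewrite (Rintegral_itv_obnd_cbnd (r := b)) => [h|]; first by rewrite -h addrC subrK.
by apply: integrableS (lf b c) => //; apply: subset_itvr; rewrite bnd_simp.
Qed.

Lemma le_locRintegral f g a b : locint f -> locint g ->
  (forall x, a <= x <= b -> f x <= g x) ->
  Rintegral mu `[a, b] f <= Rintegral mu `[a, b] g.
Proof.
move=> [_ lf] [_ lg] fg; apply: le_Rintegral => // x; rewrite /= in_itv/=; exact: fg.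
Qed.

Lemma locRintegralD f g a b : locint f -> locint g ->
  Rintegral mu `[a, b] (fun x => f x + g x) =
  Rintegral mu `[a, b] f + Rintegral mu `[a, b] g.
Proof. by move=> [_ lf] [_ lg]; rewrite RintegralD. Qed.

Lemma locRintegralZ k f a b : locint f ->
  Rintegral mu `[a, b] (fun x => k * f x) = k * Rintegral mu `[a, b] f.
Proof. by move=> [_ lf]; rewrite RintegralZl. Qed.

Lemma prim_le F f a b : prim F f -> a <= b ->
  `|F b - F a| <= Rintegral mu `[a, b] (fun x => `|f x|).
Proof. by move=> [[mf lf] hF] ab; rewrite (hF _ _ ab); exact: le_normr_Rintegral. Qed.

Lemma primD F G f g : prim F f -> prim G g ->
  prim (fun x => F x + G x) (fun x => f x + g x).
Proof.
move=> [lf hF] [lg hG]; split; first exact: locintD.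
move=> a b ab; transitivity ((F b - F a) + (G b - G a)); first by ring.
by rewrite (hF _ _ ab) (hG _ _ ab) locRintegralD.
Qed.

Lemma primZ (k : R) F f : prim F f -> prim (fun x => k * F x) (fun x => k * f x).
Proof.
move=> [lf hF]; split; first exact: locintZ.
by move=> a b ab; rewrite -mulrBr (hF _ _ ab) locRintegralZ.
Qed.

Lemma primN F f : prim F f -> prim (fun x => - F x) (fun x => - f x).
Proof.
move=> /(primZ (-1)); congr prim; by apply/funext => x; rewrite mulN1r.
Qed.

Lemma primB F G f g : prim F f -> prim G g ->
  prim (fun x => F x - G x) (fun x => f x - g x).
Proof. by move=> hF /primN; exact: primD. Qed.

Lemma prim_C1 F f : (forall x, is_derive x 1 F (f x)) -> continuous f -> prim F f.
Proof.
move=> dF cf; split; first exact: cont_locint.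
have cF x : {for x, continuous F}.
  by apply: differentiable_continuous; apply/derivable1_diffP; exact: (@ex_derive _ _ _ _ _ _ _ (dF x)).
move=> a b; rewrite le_eqVlt => /predU1P[->|ab].
  by rewrite subrr set_itv1 Rintegral_set1.
rewrite /Rintegral (@continuous_FTC2 _ _ F)//.
- exact: continuous_subspaceT.
- split => [x _||]; first exact: (@ex_derive _ _ _ _ _ _ _ (dF x)).
    exact/cvg_at_right_filter/cF.
  exact/cvg_at_left_filter/cF.
- by move=> x _; rewrite derive1E (@derive_val _ _ _ _ _ _ _ (dF x)).
Qed.

Lemma prim_continuous F f : prim F f -> continuous F.
Proof.
move=> [[mf lf] hF] x.
have h : {within `[x - 1, x + 1], continuous (fun y => parameterized_integral mu (x - 1) y f)}.
  by apply: parameterized_integral_continuous => //; lra.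
have h2 : {within `[x - 1, x + 1], continuous F}.
  have := continuous_subspaceT (A := `[x - 1, x + 1]%classic) (@cst_continuous R R (F (x - 1))).
  move=> hc; have h3 : {within `[x - 1, x + 1], continuous
     ((fun=> F (x - 1)) \+ (fun y => parameterized_integral mu (x - 1) y f))}.
    by move=> y; apply: cvgD; [exact: hc | exact: h].
  move: h3; apply: subspace_eq_continuous => y; rewrite inE /= in_itv /= => /andP[ay _].
  rewrite /from_subspace; transitivity (F (x - 1) + (F y - F (x - 1))); last by rewrite addrC subrK.
  by congr (_ + _); symmetry; exact: hF.
have x1 : x - 1 < x + 1 by lra.
have [hc _ _] := (continuous_within_itvP F x1).1 h2; apply: hc; rewrite in_itv/=; lra.
Qed.

Lemma le0_geometric (d B : R) : (forall n, d <= B / 2 ^+ n) -> d <= 0.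
Proof.
move=> h; apply/ler_addgt0Pl => e e0; rewrite addr0.
have [n Bn] : exists n : nat, B / e < n%:R.
  by exists (Num.truncn (B / e)).+1; rewrite truncnS_gt.
apply: le_trans (h n) _; rewrite ler_pdivrMr ?exprn_gt0//.
apply: (@le_trans _ _ (e * n%:R)); first by rewrite [leRHS]mulrC -ler_pdivrMr// ltW.
by rewrite ler_pM2l// -natrX ler_nat ltnW// ltn_expl.
Qed.

(** Cutting [a, b] where Phi takes its mean value replaces the square of an
    increment of Phi by two squares of its half: the bound on the increment of H
    is halved, and this can be repeated. *)
Lemma quadratic_increment_eq (H Phi : R -> R) (C a b : R) : 0 <= C -> a <= b ->
  {within `[a, b], continuous Phi} ->
  (forall x y, a <= x -> x <= y -> y <= b -> Phi x <= Phi y) ->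
  (forall x y, a <= x -> x <= y -> y <= b ->
     `|H y - H x| <= C * (Phi y - Phi x) ^+ 2) ->
  H b = H a.
Proof.
move=> C0 ab cP mP hH.
have key n : forall x y, a <= x -> x <= y -> y <= b ->
    `|H y - H x| <= C * (Phi y - Phi x) ^+ 2 / 2 ^+ n.
  elim: n => [x y ax xy yb|n IH x y ax xy yb]; first by rewrite expr0 divr1; exact: hH.
  have mid : Num.min (Phi x) (Phi y) <= (Phi x + Phi y) / 2 <= Num.max (Phi x) (Phi y).
    by have := mP _ _ ax xy yb => h; rewrite min_l// max_r//; lra.
  have cPxy : {within `[x, y], continuous Phi}.
    apply: continuous_subspaceW cP => z /=; rewrite !in_itv /= => /andP[xz zy].
    by rewrite (le_trans ax xz) (le_trans zy yb).
  have [w] := IVT xy cPxy mid.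
  rewrite in_itv /= => /andP[xw wy] hw.
  have h1 := IH x w ax xw (le_trans wy yb).
  have h2 := IH w y (le_trans ax xw) wy yb.
  have -> : H y - H x = (H y - H w) + (H w - H x) by ring.
  apply: le_trans (ler_normD _ _) _; apply: le_trans (lerD h2 h1) _.
  rewrite hw (exprS 2); have : (2 : R) ^+ n != 0 by rewrite expf_neq0// pnatr_eq0.
  move: (2 ^+ n) => e e0.
  by rewrite le_eqVlt; apply/orP; left; apply/eqP; field.
have {}key n := key n a b (lexx a) ab (lexx b).
by apply/eqP; rewrite -subr_eq0 -normr_le0; exact: le0_geometric key.
Qed.

(** On any segment, the increment of F G differs from the integral of
    f G + F g by at most twice the square of the integral of |f| + |g|, so
    [quadratic_increment_eq] applies.  Neither density has to be continuous. *)
Lemma primM F G f g : prim F f -> prim G g ->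
  prim (fun x => F x * G x) (fun x => f x * G x + F x * g x).
Proof.
move=> pF pG; have cF := prim_continuous pF; have cG := prim_continuous pG.
case: (pF) => lf hF; case: (pG) => lg hG.
have lfG : locint (fun x => f x * G x) by exact: locintM.
have lgF : locint (fun x => F x * g x).
  by rewrite (_ : (fun _ => _) = (fun x => g x * F x)); [exact: locintM|apply/funext => x; rewrite mulrC].
have lh := locintD lfG lgF.
split => // a b ab.
pose h x := f x * G x + F x * g x.
pose k x := `|f x| + `|g x|.
have lk : locint k by apply: locintD; exact: locint_norm.
have pc u : locint u -> {within `[a, b], continuous (fun y => parameterized_integral mu a y u)}.
  by move=> [_ lu]; exact: parameterized_integral_continuous.
have pB u x y : locint u -> a <= x -> x <= y ->
    parameterized_integral mu a y u - parameterized_integral mu a x u = Rintegral mu `[x, y] u.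
  by move=> lu ax xy; rewrite /parameterized_integral -(Rintegral_chasles lu ax xy) addrC addKr.
pose Phi y := parameterized_integral mu a y k.
have k0 t : 0 <= k t by rewrite addr_ge0.
have H x y : a <= x -> x <= y -> y <= b ->
    `|(F y * G y - parameterized_integral mu a y h) -
      (F x * G x - parameterized_integral mu a x h)| <= 2 * (Phi y - Phi x) ^+ 2.
  move=> ax xy yb.
  have dF t : x <= t <= y -> `|F x - F t| <= Phi y - Phi x.
    move=> /andP[xt ty]; rewrite distrC; apply: le_trans (prim_le pF xt) _.
    rewrite pB// -(Rintegral_chasles lk xt ty) -[leLHS]addr0 lerD//.
      by apply: le_locRintegral => // [|z _]; [exact: locint_norm|rewrite lerDl].
    by apply: Rintegral_ge0.
  have dG t : x <= t <= y -> `|G y - G t| <= Phi y - Phi x.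
    move=> /andP[xt ty]; apply: le_trans (prim_le pG ty) _.
    rewrite pB// -(Rintegral_chasles lk xt ty) -[leLHS]add0r lerD//.
      by apply: Rintegral_ge0.
    by apply: le_locRintegral => // [|z _]; [exact: locint_norm|rewrite lerDr].
  pose r t := f t * (G y - G t) + (F x - F t) * g t.
  have lr : locint r.
    rewrite (_ : r = fun t => (G y * f t + F x * g t) + -1 * h t).
      by apply: locintD; [apply: locintD; exact: locintZ|exact: locintZ].
    by apply/funext => t; rewrite /r /h; ring.
  have -> : F y * G y - parameterized_integral mu a y h -
      (F x * G x - parameterized_integral mu a x h) = Rintegral mu `[x, y] r.
    transitivity (G y * (F y - F x) + F x * (G y - G x) + -1 *
      (parameterized_integral mu a y h - parameterized_integral mu a x h)); first by ring.
    rewrite pB// (hF _ _ xy) (hG _ _ xy).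
    transitivity (Rintegral mu `[x, y] (fun t => (G y * f t + F x * g t) + -1 * h t)).
      rewrite (locRintegralD _ _ (locintD (locintZ (G y) lf) (locintZ (F x) lg)) (locintZ (-1) lh)).
      rewrite (locRintegralD _ _ (locintZ (G y) lf) (locintZ (F x) lg)).
      rewrite (locRintegralZ (G y) _ _ lf) (locRintegralZ (F x) _ _ lg).
      by rewrite (locRintegralZ (-1) _ _ lh).
    by congr (Rintegral _ _ _); apply/funext => t; rewrite /r /h; ring.
  apply: le_trans (le_normr_Rintegral _ (lr.2 _ _)) _ => //.
  set D := Phi y - Phi x in dF dG *.
  have D0 : 0 <= D by rewrite /D pB//; exact: Rintegral_ge0.
  have -> : 2 * D ^+ 2 = Rintegral mu `[x, y] (fun t => 2 * D * k t).
    by rewrite locRintegralZ// -pB// -/(Phi y) -/(Phi x) -/D; ring.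
  apply: le_locRintegral; [exact: locint_norm|exact: locintZ|move=> t xty].
  apply: le_trans (ler_normD _ _) _; rewrite !normrM /k.
  have u1 := ler_wpM2l (normr_ge0 (f t)) (dG t xty).
  have u2 := ler_wpM2r (normr_ge0 (g t)) (dF t xty).
  have u3 := mulr_ge0 D0 (normr_ge0 (f t)).
  have u4 := mulr_ge0 D0 (normr_ge0 (g t)).
  nra.
have E := quadratic_increment_eq (ler0n R 2) ab (pc _ lk) _ H.
have {}E : F b * G b - F a * G a = parameterized_integral mu a b h - parameterized_integral mu a a h.
  suff : F b * G b - parameterized_integral mu a b h = F a * G a - parameterized_integral mu a a h by lra.
  apply: E => x y ax xy yb; rewrite -subr_ge0 pB//; exact: Rintegral_ge0.
by rewrite E pB.
Qed.
End RealPrimitives.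

(** * Complex-valued functions *)

Section ComplexPrimitives.
Context {R : realType}.
Implicit Types (z w : R[i]) (F G f g : R -> R[i]) (a b c x y : R).
Local Notation mu := (@lebesgue_measure R).
Local Notation Re := (@complex.Re R).
Local Notation Im := (@complex.Im R).
Local Notation cmod := (@ComplexField.Normc.normc R).
Local Notation integ D f := (mu.-integrable D (EFin \o f)).

Lemma cReD z w : Re (z + w) = Re z + Re w. Proof. by case: z; case: w. Qed.
Lemma cImD z w : Im (z + w) = Im z + Im w. Proof. by case: z; case: w. Qed.
Lemma cReN z : Re (- z) = - Re z. Proof. by case: z. Qed.
Lemma cImN z : Im (- z) = - Im z. Proof. by case: z. Qed.
Lemma cReM z w : Re (z * w) = Re z * Re w - Im z * Im w.
Proof. by case: z; case: w. Qed.
Lemma cImM z w : Im (z * w) = Re z * Im w + Im z * Re w.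
Proof. by case: z => a b; case: w. Qed.

Lemma cReC x : Re x%:C%C = x. Proof. by []. Qed.
Lemma cImC x : Im x%:C%C = 0. Proof. by []. Qed.

Lemma eq_ReIm z w : Re z = Re w -> Im z = Im w -> z = w.
Proof. by case: z => a b; case: w => c d /= -> ->. Qed.

Lemma cmodE z : cmod z = Num.sqrt (Re z ^+ 2 + Im z ^+ 2).
Proof. by case: z. Qed.
Lemma cmod_ge0 z : 0 <= cmod z. Proof. by rewrite cmodE sqrtr_ge0. Qed.
Lemma cmod_sqr z : cmod z ^+ 2 = Re z ^+ 2 + Im z ^+ 2.
Proof. by rewrite cmodE sqr_sqrtr// addr_ge0// sqr_ge0. Qed.
Lemma cmodM z w : cmod (z * w) = cmod z * cmod w.
Proof. exact: ComplexField.Normc.normcM. Qed.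
Lemma cmodV z : cmod z^-1 = (cmod z)^-1.
Proof. exact: ComplexField.Normc.normcV. Qed.
Lemma cmodD z w : cmod (z + w) <= cmod z + cmod w.
Proof. exact: (le_normcD z w). Qed.
Lemma cmodN z : cmod (- z) = cmod z. Proof. exact: (normcN z). Qed.
Lemma cmodB z w : cmod (z - w) <= cmod z + cmod w.
Proof. by rewrite -(cmodN w) cmodD. Qed.
Lemma cmod0 : cmod 0 = 0. Proof. exact: ComplexField.Normc.normc0. Qed.
Lemma cmod1 : cmod 1 = 1. Proof. exact: ComplexField.Normc.normc1. Qed.
Lemma cmod_eq0 z : cmod z = 0 -> z = 0.
Proof. exact: ComplexField.Normc.eq0_normc. Qed.
Lemma cmod_gt0 z : z != 0 -> 0 < cmod z.
Proof. by move=> z0; rewrite lt0r cmod_ge0 andbT; apply: contra z0 => /eqP/cmod_eq0 ->. Qed.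
Lemma cmod_real x : cmod x%:C%C = `|x|.
Proof. by rewrite cmodE /= expr0n /= addr0 sqrtr_sqr. Qed.
Lemma cmod_i : cmod 'i%C = 1.
Proof. by rewrite cmodE /= expr0n expr1n /= add0r sqrtr1. Qed.
Lemma Re_le_cmod z : `|Re z| <= cmod z.
Proof. by rewrite cmodE -sqrtr_sqr; apply: ler_wsqrtr; rewrite lerDl sqr_ge0. Qed.
Lemma Im_le_cmod z : `|Im z| <= cmod z.
Proof. by rewrite cmodE -sqrtr_sqr; apply: ler_wsqrtr; rewrite lerDr sqr_ge0. Qed.
Lemma cmod_le z : cmod z <= `|Re z| + `|Im z|.
Proof.
rewrite cmodE -[leRHS]ger0_norm ?addr_ge0// -sqrtr_sqr.
have h1 := real_normK (num_real (Re z)); have h2 := real_normK (num_real (Im z)).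
have p1 := normr_ge0 (Re z); have p2 := normr_ge0 (Im z).
have p3 := mulr_ge0 p1 p2.
by apply: ler_wsqrtr; rewrite -h1 -h2; nra.
Qed.

(** Through real and imaginary parts, as [cintegral] integrates them. *)
Definition cmeas f := measurable_fun setT (Re \o f) /\ measurable_fun setT (Im \o f).
Definition ccont f := continuous (Re \o f) /\ continuous (Im \o f).
Definition cprim F f := prim (Re \o F) (Re \o f) /\ prim (Im \o F) (Im \o f).

Lemma ccont_cmeas f : ccont f -> cmeas f.
Proof. by case=> ? ?; split; exact: continuous_measurable_fun. Qed.

Lemma cmeas_cst z : cmeas (fun=> z). Proof. by split; exact: measurable_cst. Qed.

Lemma cmeasD f g : cmeas f -> cmeas g -> cmeas (fun x => f x + g x).
Proof.
move=> [? ?] [? ?]; split; rewrite /comp.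
  by under eq_fun do rewrite cReD; exact: measurable_funD.
by under eq_fun do rewrite cImD; exact: measurable_funD.
Qed.

Lemma cmeasM f g : cmeas f -> cmeas g -> cmeas (fun x => f x * g x).
Proof.
move=> [? ?] [? ?]; split; rewrite /comp.
  by under eq_fun do rewrite cReM; apply: measurable_funB; exact: measurable_funM.
by under eq_fun do rewrite cImM; apply: measurable_funD; exact: measurable_funM.
Qed.

Lemma cmeasZ z f : cmeas f -> cmeas (fun x => z * f x).
Proof. by move=> mf; apply: cmeasM => //; exact: cmeas_cst. Qed.

Lemma cmeasN f : cmeas f -> cmeas (fun x => - f x).
Proof.
move=> mf; rewrite (_ : (fun _ => _) = fun x => (-1) * f x).
  exact: cmeasZ.
by apply/funext => x; rewrite mulN1r.
Qed.

Lemma cmeasB f g : cmeas f -> cmeas g -> cmeas (fun x => f x - g x).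
Proof. by move=> mf mg; apply: cmeasD => //; exact: cmeasN. Qed.

Lemma measurable_cmod f : cmeas f -> measurable_fun setT (fun x => cmod (f x)).
Proof.
move=> [m1 m2]; under eq_fun do rewrite cmodE.
apply: measurableT_comp.
  exact: continuous_measurable_fun (@sqrt_continuous R).
by apply: measurable_funD; apply: measurable_funX.
Qed.

Lemma ccont_cst z : ccont (fun=> z). Proof. by split=> x; exact: cvg_cst. Qed.

Lemma ccontD f g : ccont f -> ccont g -> ccont (fun x => f x + g x).
Proof.
move=> [c1 c2] [d1 d2]; split; rewrite /comp.
  under eq_fun do rewrite cReD.
  by move=> x; apply: cvgD; [exact: c1|exact: d1].
under eq_fun do rewrite cImD.
by move=> x; apply: cvgD; [exact: c2|exact: d2].
Qed.

Lemma ccontM f g : ccont f -> ccont g -> ccont (fun x => f x * g x).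
Proof.
move=> [c1 c2] [d1 d2]; split; rewrite /comp.
  under eq_fun do rewrite cReM.
  move=> x; apply: cvgB; apply: cvgM; by [exact: c1|exact: d1|exact: c2|exact: d2].
under eq_fun do rewrite cImM.
move=> x; apply: cvgD; apply: cvgM; by [exact: c1|exact: d1|exact: c2|exact: d2].
Qed.

Lemma ccontZ z f : ccont f -> ccont (fun x => z * f x).
Proof. by move=> cf; apply: ccontM => //; exact: ccont_cst. Qed.

Lemma cprim_ccont F f : cprim F f -> ccont F.
Proof. by case=> ? ?; split; apply: prim_continuous; eassumption. Qed.

Lemma cprim_cmeas F f : cprim F f -> cmeas f.
Proof. by case=> -[[? _] _] [[? _] _]. Qed.

Lemma cprimD F G f g : cprim F f -> cprim G g ->
  cprim (fun x => F x + G x) (fun x => f x + g x).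
Proof.
move=> [p1 p2] [q1 q2]; split; rewrite /comp.
  under eq_fun do rewrite cReD; under [X in prim _ X]eq_fun do rewrite cReD.
  exact: primD.
under eq_fun do rewrite cImD; under [X in prim _ X]eq_fun do rewrite cImD.
exact: primD.
Qed.

Lemma cprimM F G f g : cprim F f -> cprim G g ->
  cprim (fun x => F x * G x) (fun x => f x * G x + F x * g x).
Proof.
move=> [p1 p2] [q1 q2]; split; rewrite /comp.
  under eq_fun do rewrite cReM; under [X in prim _ X]eq_fun do rewrite cReD !cReM.
  have := primB (primM p1 q1) (primM p2 q2); congr prim.
  by apply/funext => x /=; ring.
under eq_fun do rewrite cImM; under [X in prim _ X]eq_fun do rewrite cImD !cImM.
have := primD (primM p1 q2) (primM p2 q1); congr prim.
by apply/funext => x /=; ring.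
Qed.

Lemma cprim_cst z : cprim (fun=> z) (fun=> 0).
Proof.
have h r : prim (fun=> r : R) (fun=> 0).
  split; first by apply: cont_locint => x; exact: cvg_cst.
  by move=> a b _; rewrite subrr Rintegral_cst// mul0r.
by split; exact: h.
Qed.

Lemma cprimZ z F f : cprim F f -> cprim (fun x => z * F x) (fun x => z * f x).
Proof.
move=> /(cprimM (cprim_cst z)); congr cprim; by apply/funext => x; rewrite mul0r add0r.
Qed.

Lemma cprimB F G f g : cprim F f -> cprim G g ->
  cprim (fun x => F x - G x) (fun x => f x - g x).
Proof.
move=> pF /(cprimZ (-1)) /(cprimD pF).
by congr cprim; apply/funext => x; rewrite mulN1r.
Qed.

Lemma cprim0_cst F : cprim F (fun=> 0) -> forall x, F x = F 0.
Proof.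
have h H : prim H (fun=> 0 : R) -> forall x, H x = H 0.
  move=> [_ hH] x; apply/eqP; rewrite -subr_eq0; apply/eqP.
  have [x0|x0] := leP 0 x; first by rewrite (hH _ _ x0) Rintegral_cst// mul0r.
  by rewrite -opprB (hH _ _ (ltW x0)) Rintegral_cst// mul0r oppr0.
by move=> [p1 p2] x; apply: eq_ReIm; [exact: (h _ p1)|exact: (h _ p2)].
Qed.

(** The form in which [H1_deriv] expresses weak derivatives. *)
Lemma cprimP F f : cmeas f -> (forall a b, integ `[a, b] (fun x => cmod (f x))) ->
  cprim F f <-> forall a b, a <= b -> F b - F a = cintegral `[a, b] f.
Proof.
move=> mf hf; split=> [[[l1 h1] [l2 h2]] a b ab|hF].
  by apply: eq_ReIm; rewrite /cintegral /= ?cReD ?cReN ?cImD ?cImN; [exact: h1|exact: h2].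
split; split.
- split=> [|a b]; first exact: mf.1.
  by apply: le_integ (hf a b) => // [|x _]; [exact: mf.1|exact: Re_le_cmod].
- by move=> a b /hF /(congr1 Re); rewrite cReD cReN.
- split=> [|a b]; first exact: mf.2.
  by apply: le_integ (hf a b) => // [|x _]; [exact: mf.2|exact: Im_le_cmod].
- by move=> a b /hF /(congr1 Im); rewrite cImD cImN.
Qed.

End ComplexPrimitives.

(** * The scalar equation y' = a y + g *)

Section ScalarEquation.
Context {R : realType}.
Implicit Types (z w : R[i]) (F G f g h : R -> R[i]) (x t : R) (s : bool).
Local Notation mu := (@lebesgue_measure R).
Local Notation Re := complex.Re.
Local Notation Im := complex.Im.
Local Notation cmod := (@ComplexField.Normc.normc R).
Local Notation integ D f := (mu.-integrable D (EFin \o f)).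

(** [half s x] is the side of [x] from which Duhamel's formula integrates; with
    the sign [sgn s], the integral of f over it is a primitive of f. *)
Definition half s x : set R := if s then `]-oo, x]%classic else `[x, +oo[%classic.
Definition sgn s : R := if s then 1 else -1.

Lemma measurable_half s x : measurable (half s x).
Proof. by case: s; exact: measurable_itv. Qed.

Lemma half_prim s (f : R -> R) : measurable_fun setT f ->
  (forall x, integ (half s x) f) ->
  prim (fun x => sgn s * Rintegral mu (half s x) f) f.
Proof.
move=> mf hf; split; first split=> // a b.
  case: s hf => hf.
    apply: integrableS (hf b) => //; first exact: (measurable_half true).
    by move=> z; rewrite /= !in_itv/= => /andP[].
  apply: integrableS (hf a) => //; first exact: (measurable_half false).
  by move=> z; rewrite /= !in_itv/= => /andP[->].
move=> a b ab; rewrite /sgn; case: s hf => /= hf.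
  have := @Rintegral_itvB _ f -oo%O (BRight b) a; rewrite !bnd_simp => /(_ (hf b) isT ab) e.
  rewrite (Rintegral_itv_obnd_cbnd (r := a)) in e; first by rewrite !mul1r -e.
  by apply: integrableS (hf b) => // z; rewrite /= !in_itv/= => /andP[].
rewrite !mulN1r opprK addrC.
have := @Rintegral_itvB _ f (BLeft a) +oo%O b; rewrite !bnd_simp => /(_ (hf a) ab isT) e.
rewrite (Rintegral_itv_obnd_cbnd (r := b)) in e; first by rewrite -e; ring.
by apply: integrableS (hf b) => // z; rewrite /= !in_itv/= => /andP[bz _]; rewrite ltW.
Qed.

(** The factor 2 comes from bounding real and imaginary parts separately; any
    constant is good enough for what follows. *)
Lemma cmod_cintegral (D : set R) f : measurable D -> cmeas f ->
  integ D (fun x => cmod (f x)) ->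
  cmod (cintegral D f) <= 2 * Rintegral mu D (fun x => cmod (f x)).
Proof.
move=> mD [m1 m2] hf; apply: le_trans (cmod_le _) _; rewrite /= mulr_natl mulr2n.
have i1 : integ D (fun x => Re (f x)).
  by apply: le_integ hf => // x _; exact: Re_le_cmod.
have i2 : integ D (fun x => Im (f x)).
  by apply: le_integ hf => // x _; exact: Im_le_cmod.
apply: lerD; apply: le_trans (le_normr_Rintegral _ _) _ => //.
  by apply: le_Rintegral => // [|x _]; [exact: integ_norm|exact: Re_le_cmod].
by apply: le_Rintegral => // [|x _]; [exact: integ_norm|exact: Im_le_cmod].
Qed.

Lemma cintegralB (D : set R) f g : measurable D -> cmeas f -> cmeas g ->
  integ D (fun x => cmod (f x)) -> integ D (fun x => cmod (g x)) ->
  cintegral D (fun x => f x - g x) = cintegral D f - cintegral D g.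
Proof.
move=> mD [m1 m2] [n1 n2] hf hg.
have i1 : integ D (fun x => Re (f x)) by apply: le_integ hf => // x _; exact: Re_le_cmod.
have i2 : integ D (fun x => Im (f x)) by apply: le_integ hf => // x _; exact: Im_le_cmod.
have j1 : integ D (fun x => Re (g x)) by apply: le_integ hg => // x _; exact: Re_le_cmod.
have j2 : integ D (fun x => Im (g x)) by apply: le_integ hg => // x _; exact: Im_le_cmod.
apply: eq_ReIm; rewrite /cintegral /=.
  by under eq_Rintegral do rewrite cReD cReN; rewrite RintegralB.
by under eq_Rintegral do rewrite cImD cImN; rewrite RintegralB.
Qed.

Lemma half_cprim s f : cmeas f ->
  (forall x, integ (half s x) (fun t => cmod (f t))) ->
  cprim (fun x => (sgn s)%:C%C * cintegral (half s x) f) f.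
Proof.
move=> [m1 m2] hf; have mh := measurable_half s.
split.
  have := @half_prim s _ m1 (fun x => le_integ (mh x) m1 (fun t _ => Re_le_cmod (f t)) (hf x)).
  by congr prim; apply/funext => x; rewrite /= mul0r subr0.
have := @half_prim s _ m2 (fun x => le_integ (mh x) m2 (fun t _ => Im_le_cmod (f t)) (hf x)).
by congr prim; apply/funext => x; rewrite /= mul0r addr0.
Qed.

(** The convolution of |g| with exp (- kap |.|); it controls Duhamel's formula
    both for integrable and for square integrable g. *)
Definition kint (kap : R) g x : \bar R :=
  \int[mu]_t (expR (- kap * `|x - t|) * cmod (g t))%:E.

Lemma measurable_kern kap x : measurable_fun setT (fun t => expR (- kap * `|x - t|)).
Proof.
apply: continuous_measurable_fun => t; apply: continuous_comp; last exact: continuous_expR.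
apply: cvgM; first exact: cvg_cst.
by apply: cvg_norm; apply: cvgB; [exact: cvg_cst|exact: cvg_id].
Qed.

Lemma measurable_kint kap g x : cmeas g ->
  measurable_fun setT (fun t => expR (- kap * `|x - t|) * cmod (g t)).
Proof.
by move=> mg; apply: measurable_funM; [exact: measurable_kern|exact: measurable_cmod].
Qed.

Lemma kintD kap g h x : cmeas g -> cmeas h ->
  (kint kap (fun t => (g t + h t)%R) x <= kint kap g x + kint kap h x)%E.
Proof.
move=> mg mh; rewrite /kint -ge0_integralD//.
- apply: ge0_le_integral => //.
  + by move=> t _; rewrite lee_fin mulr_ge0 ?expR_ge0 ?cmod_ge0.
  + by apply/measurable_EFinP; apply: measurable_kint; exact: cmeasD.
  + apply: emeasurable_funD; apply/measurable_EFinP; exact: measurable_kint.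
  + by move=> t _; rewrite -EFinD lee_fin -mulrDr ler_wpM2l ?expR_ge0// cmodD.
- by move=> t _; rewrite lee_fin mulr_ge0 ?expR_ge0 ?cmod_ge0.
- by apply/measurable_EFinP; exact: measurable_kint.
- by move=> t _; rewrite lee_fin mulr_ge0 ?expR_ge0 ?cmod_ge0.
- by apply/measurable_EFinP; exact: measurable_kint.
Qed.

Lemma le_kint kap g (u : R -> R) (c : R) x : 0 < kap -> cmeas g -> 0 <= c ->
  measurable_fun setT u -> (forall t, cmod (g t) <= c * u t) ->
  (kint kap g x <= c%:E * \int[mu]_t (u t)%:E)%E.
Proof.
move=> kap0 mg c0 mu_ gu; have u0 t : 0 <= c * u t by exact: le_trans (cmod_ge0 (g t)) (gu t).
have [c00|cn0] := eqVneq c 0.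
  rewrite c00 mul0e /kint integral0_eq// => t _; congr EFin.
  have g0 : cmod (g t) <= 0 by rewrite (le_trans (gu t))// c00 mul0r.
  by have -> : cmod (g t) = 0; [apply/le_anti; rewrite g0 cmod_ge0|rewrite mulr0].
have cp : 0 < c by rewrite lt0r cn0.
rewrite -ge0_integralZl//; last 2 first.
  by apply/measurable_EFinP.
  by move=> t _; rewrite lee_fin -(pmulr_rge0 _ cp).
apply: ge0_le_integral => //.
- by move=> t _; rewrite lee_fin mulr_ge0 ?expR_ge0 ?cmod_ge0.
- by apply/measurable_EFinP; exact: measurable_kint.
- by apply/measurable_EFinP; exact: measurable_funM.
- move=> t _; rewrite -EFinM lee_fin; apply: le_trans (gu t).
  by rewrite ler_piMl ?cmod_ge0// -expR0 ler_expR mulNr oppr_le0 mulr_ge0// ltW.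
Qed.

Section Solution.
Variables (s : bool) (E Ei a : R -> R[i]) (K kap : R).
Hypothesis (hE : cprim E (fun x => a x * E x)).
Hypothesis (hEi : cprim Ei (fun x => - a x * Ei x)).
Hypothesis (EEi : forall x, E x * Ei x = 1).
Hypothesis (K0 : 0 <= K) (kap0 : 0 < kap).
Hypothesis (hK : forall x t, half s x t ->
  cmod (E x * Ei t) <= K * expR (- kap * `|x - t|)).

(** Variation of constants for the fundamental solution [E], whose inverse is
    [Ei]: the integral is over the side where E x * Ei t decays. *)
Definition duhamel g x : R[i] :=
  E x * ((sgn s)%:C%C * cintegral (half s x) (fun t => Ei t * g t)).

Let mEi : cmeas Ei. Proof. exact: ccont_cmeas (cprim_ccont hEi). Qed.

Let source_integ g x : cmeas g -> (kint kap g x < +oo)%E ->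
  integ (half s x) (fun t => cmod (Ei t * g t)).
Proof.
move=> mg gfin; have mh := measurable_half s x.
have : integ setT (fun t => (K * cmod (Ei x)) * (expR (- kap * `|x - t|) * cmod (g t))).
  apply: integZ => //; apply/integrableP; split.
    by apply/measurable_EFinP; exact: measurable_kint.
  apply: le_lt_trans gfin; rewrite le_eqVlt; apply/orP; left; apply/eqP.
  by apply: eq_integral => t _ /=; rewrite ger0_norm// mulr_ge0 ?expR_ge0 ?cmod_ge0.
move=> hi; have {}hi : integ (half s x)
    (fun t => (K * cmod (Ei x)) * (expR (- kap * `|x - t|) * cmod (g t))).
  by apply: integrableS hi.
apply: le_integ hi => //.
  by apply: measurable_cmod; exact: cmeasM.
move=> t ht; rewrite ger0_norm ?cmod_ge0// cmodM mulrA ler_wpM2r ?cmod_ge0//.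
have -> : Ei t = (E x * Ei t) * Ei x by rewrite mulrAC EEi mul1r.
by rewrite cmodM mulrAC ler_wpM2r ?cmod_ge0// hK.
Qed.

Lemma duhamel_prim g : cmeas g -> (forall x, kint kap g x < +oo)%E ->
  cprim (duhamel g) (fun x => a x * duhamel g x + g x).
Proof.
move=> mg gfin.
have p1 : cprim (fun x => (sgn s)%:C%C * cintegral (half s x) (fun t => Ei t * g t))
    (fun t => Ei t * g t).
  by apply: half_cprim => [|x]; [exact: cmeasM|exact: source_integ].
have := cprimM hE p1; congr cprim; apply/funext => x.
by rewrite /duhamel [E x * (Ei x * _)]mulrA EEi mul1r -mulrA.
Qed.

Lemma duhamel_le g x (M : R) : cmeas g -> (kint kap g x <= M%:E)%E ->
  cmod (duhamel g x) <= 2 * K * M.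
Proof.
move=> mg gM; have gfin : (kint kap g x < +oo)%E by exact: le_lt_trans gM (ltry _).
have mh := measurable_half s x; have ig := source_integ mg gfin.
rewrite /duhamel !cmodM cmod_real.
have -> : `|sgn s| = 1 by rewrite /sgn; case: (s); rewrite ?normrN normr1.
rewrite mul1r; apply: le_trans.
  apply: ler_wpM2l (cmod_cintegral mh _ ig); [exact: cmod_ge0|exact: cmeasM].
rewrite mulrCA -mulrA ler_pM2l// -RintegralZl// -lee_fin.
have gn t : 0 <= expR (- kap * `|x - t|) * cmod (g t) by rewrite mulr_ge0 ?expR_ge0 ?cmod_ge0.
have i2 : integ (half s x) (fun t => cmod (E x) * cmod (Ei t * g t)) by exact: integZ.
rewrite /Rintegral fineK; last exact: integrable_fin_num.
apply: (@le_trans _ _ (K%:E * kint kap g x)%E); last first.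
  by rewrite EFinM lee_wpmul2l// lee_fin.
rewrite /kint -ge0_integralZl//; last 2 first.
  by apply/measurable_EFinP; exact: measurable_kint.
  by move=> t _; rewrite lee_fin.
apply: (@le_trans _ _ (\int[mu]_(t in half s x) (K%:E * (expR (- kap * `|x - t|) * cmod (g t))%:E))%E).
  apply: ge0_le_integral => //.
  - by move=> t _; rewrite lee_fin mulr_ge0 ?cmod_ge0.
  - apply/measurable_EFinP; apply: measurable_funTS; apply: measurable_funM => //.
    by apply: measurable_cmod; exact: cmeasM.
  - apply: measurable_funTS; apply/measurable_EFinP; apply: measurable_funM => //.
    exact: measurable_kint.
  - move=> t ht; rewrite -EFinM lee_fin !cmodM mulrA mulrA ler_wpM2r ?cmod_ge0//.
    by rewrite -cmodM hK.
apply: ge0_subset_integral => //.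
- apply/measurable_EFinP; apply: measurable_funM => //; exact: measurable_kint.
- by move=> t _; rewrite -EFinM lee_fin mulr_ge0.
Qed.

Lemma duhamelB g h x : cmeas g -> cmeas h ->
  (kint kap g x < +oo)%E -> (kint kap h x < +oo)%E ->
  duhamel (fun t => g t - h t) x = duhamel g x - duhamel h x.
Proof.
move=> mg mh gfin hfin; rewrite /duhamel.
have -> : (fun t => Ei t * (g t - h t)) = (fun t => Ei t * g t - Ei t * h t).
  by apply/funext => t; rewrite mulrBr.
rewrite cintegralB; first by rewrite !mulrBr.
- exact: measurable_half.
- exact: cmeasM.
- exact: cmeasM.
- exact: source_integ.
- exact: source_integ.
Qed.

End Solution.
End ScalarEquation.

Section DuhamelUnique.
Context {R : realType}.
Local Notation cmod := (@ComplexField.Normc.normc R).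

Lemma le0_expR (kap B d : R) : 0 < kap ->
  (forall r, 0 <= r -> d <= B * expR (- kap * r)) -> d <= 0.
Proof.
move=> k0 h; apply/ler_addgt0Pl => e e0; rewrite addr0.
have B0 := h 0 (lexx _).
pose r := `|B| / e / kap.
have r0 : 0 <= r by rewrite !divr_ge0// ltW.
apply: le_trans (h r r0) _.
have e1 : B * expR (- kap * r) <= `|B| * expR (- kap * r).
  by rewrite ler_wpM2r ?expR_ge0 ?ler_norm.
apply: le_trans e1 _; rewrite mulNr expRN ler_pdivrMr ?expR_gt0//.
have := expR_ge1Dx (kap * r); have -> : kap * r = `|B| / e.
  by rewrite /r mulrC divfK// gt_eqF.
move=> h1; apply: (@le_trans _ _ (e * (1 + `|B| / e))).
  by rewrite mulrDr mulrCA divff ?gt_eqF// !mulr1 lerDr ltW.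
by rewrite ler_wpM2l// ltW.
Qed.

Variables (s : bool) (E Ei a : R -> R[i]) (K kap : R).
Hypothesis (hE : cprim E (fun x => a x * E x)).
Hypothesis (hEi : cprim Ei (fun x => - a x * Ei x)).
Hypothesis (EEi : forall x, E x * Ei x = 1).
Hypothesis (K0 : 0 <= K) (kap0 : 0 < kap).
Hypothesis (hK : forall x t, half s x t ->
  cmod (E x * Ei t) <= K * expR (- kap * `|x - t|)).

(** D x = (E x * Ei t) * D t for every t; as t tends to infinity on the side
    where the propagator decays, the right-hand side tends to 0. *)
Lemma bounded_homogeneous_eq0 (D : R -> R[i]) (B : R) :
  cprim D (fun x => a x * D x) -> (forall x, cmod (D x) <= B) -> forall x, D x = 0.
Proof.
move=> pD DB x.
have pc : cprim (fun x => Ei x * D x) (fun=> 0).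
  have := cprimM hEi pD; congr cprim; apply/funext => t; ring.
have key t : D x = (E x * Ei t) * D t.
  have := cprim0_cst pc; move=> h; rewrite -mulrA h -(h x) mulrA EEi mul1r//.
have B0 : 0 <= B by exact: le_trans (cmod_ge0 (D 0)) (DB 0).
apply: cmod_eq0; apply/le_anti; rewrite cmod_ge0 andbT.
apply: (@le0_expR kap (K * B)) => // r r0.
have tP : half s x (if s then x - r else x + r) /\
    `|x - (if s then x - r else x + r)| = r.
  rewrite /half; case: (s) => /=; rewrite in_itv /=.
    by split; [rewrite gerBl|rewrite opprB addrC subrK ger0_norm].
  by split; [rewrite lerDl r0|rewrite opprD addrA subrr add0r normrN ger0_norm].
case: tP => ht tr; rewrite (key (if s then x - r else x + r)) cmodM.
apply: (le_trans (ler_pM (cmod_ge0 _) (cmod_ge0 _) (hK ht) (DB _))).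
by rewrite tr mulrAC.
Qed.

Lemma duhamel_unique (g y : R -> R[i]) (M Y : R) : cmeas g ->
  (forall x, kint kap g x <= M%:E)%E -> cprim y (fun x => a x * y x + g x) ->
  (forall x, cmod (y x) <= Y) -> forall x, y x = duhamel s E Ei g x.
Proof.
move=> mg gM py yY x.
have gfin x' : (kint kap g x' < +oo)%E by exact: le_lt_trans (gM x') (ltry _).
have pd := duhamel_prim hE hEi EEi hK mg gfin.
apply/eqP; rewrite -subr_eq0; apply/eqP.
apply: (@bounded_homogeneous_eq0 (fun x => y x - duhamel s E Ei g x) (Y + 2 * K * M)).
  by have := cprimB py pd; congr cprim; apply/funext => t; ring.
move=> t; apply: le_trans (cmodB _ _) _; apply: lerD => //.
exact: (duhamel_le hEi EEi K0 hK).
Qed.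
End DuhamelUnique.

(** * Fixed points of contractions in the sup norm *)

Section Contraction.
Context {R : realType}.
Local Notation cmod := (@ComplexField.Normc.normc R).

(** v_n + 2 B / 2^n is nonincreasing and v_n - 2 B / 2^n is nondecreasing. *)
Lemma geometric_cvg (v : nat -> R) (B : R) :
  (forall n, `|v n.+1 - v n| <= B / 2 ^+ n) ->
  exists2 l, v @ \oo --> l & forall n, `|l - v n| <= 2 * B / 2 ^+ n.
Proof.
move=> hv; pose e n : R := 2 * B / 2 ^+ n.
have B0 : 0 <= B by have := hv 0%N; rewrite expr0 divr1; apply: le_trans.
have eS n : e n.+1 = B / 2 ^+ n.
  by rewrite /e exprS; field; rewrite expf_neq0// pnatr_eq0.
have e2 n : e n = 2 * (B / 2 ^+ n) by rewrite /e mulrA.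
have up : {homo (fun n => v n + e n) : n m / (n <= m)%N >-> m <= n}.
  apply/nonincreasing_seqP => n; rewrite eS e2.
  by have := hv n; rewrite ler_norml => /andP[_]; lra.
have dn : {homo (fun n => v n - e n) : n m / (n <= m)%N >-> n <= m}.
  apply/nondecreasing_seqP => n; rewrite eS e2.
  by have := hv n; rewrite ler_norml => /andP[+ _]; lra.
have e0 n : 0 <= e n by rewrite /e divr_ge0 ?mulr_ge0 ?exprn_ge0.
have ecvg : e @ \oo --> (0 : R).
  have -> : e = geometric (2 * B) (2^-1).
    by apply/funext => n; rewrite /e /geometric /= exprVn.
  by apply: cvg_geometric; rewrite ger0_norm ?invr_ge0// invf_lt1// ltr1n.
have ucvg : cvgn (fun n => v n + e n).
  apply: nonincreasing_is_cvgn => //; exists (v 0%N - e 0%N) => _ [n _ <-] /=.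
  by have := dn 0%N n isT; have := e0 n; lra.
pose l := limn (fun n => v n + e n).
have vl : v @ \oo --> l.
  have -> : v = (fun n => (v n + e n) - e n) by apply/funext => n; rewrite addrK.
  by rewrite -[l]subr0; apply: cvgB.
exists l => // n; rewrite ler_norml; apply/andP; split.
  have : v n - e n <= l.
    have c : (fun n => v n - e n) @ \oo --> l by rewrite -[l]subr0; apply: cvgB.
    by rewrite -(cvg_lim _ c)//; apply: nondecreasing_cvgn_le => //; apply/cvg_ex; exists l.
  by rewrite /e; lra.
have := nonincreasing_cvgn_ge up ucvg n; rewrite -/l /e; lra.
Qed.

Definition bounded_measurable (I : Type) (u : I -> R -> R[i]) :=
  (forall i, cmeas (u i)) /\ exists B, forall i x, cmod (u i x) <= B.

(** The Banach iteration started at 0.  The limit is built pointwise, so that it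
    is measurable, and the geometric error bound makes the convergence
    uniform. *)
Lemma contraction_fixpoint (I : Type) (Phi : (I -> R -> R[i]) -> I -> R -> R[i]) :
  (forall u, bounded_measurable u -> bounded_measurable (Phi u)) ->
  (forall u v d, bounded_measurable u -> bounded_measurable v ->
     (forall i x, cmod (u i x - v i x) <= d) ->
     forall i x, cmod (Phi u i x - Phi v i x) <= d / 2) ->
  exists2 u, bounded_measurable u & forall i x, u i x = Phi u i x.
Proof.
move=> hP hC; pose u n := iter n Phi (fun _ _ => 0).
have b0 : bounded_measurable (u 0%N).
  by split=> [i|]; [exact: cmeas_cst|exists 0 => i x; rewrite (_ : u 0%N i x = 0) ?cmod0].
have bu n : bounded_measurable (u n) by elim: n => [//|n IH]; exact: hP.
have [B hB] := (bu 1%N).2.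
have step n i x : cmod (u n.+1 i x - u n i x) <= B / 2 ^+ n.
  elim: n i x => [i x|n IH i x]; first by rewrite expr0 divr1 subr0 hB.
  have := hC _ _ _ (bu n.+1) (bu n) IH i x; rewrite exprS.
  by rewrite invfM mulrA [B / 2 / _]mulrAC.
have stepRe i x n : `|complex.Re (u n.+1 i x) - complex.Re (u n i x)| <= B / 2 ^+ n.
  by rewrite -cReN -cReD; exact: le_trans (Re_le_cmod _) (step n i x).
have stepIm i x n : `|complex.Im (u n.+1 i x) - complex.Im (u n i x)| <= B / 2 ^+ n.
  by rewrite -cImN -cImD; exact: le_trans (Im_le_cmod _) (step n i x).
have hr i x := geometric_cvg (stepRe i x); have hi i x := geometric_cvg (stepIm i x).
pose v i x := Complex (projT1 (cid2 (hr i x))) (projT1 (cid2 (hi i x))).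
have vu n i x : cmod (v i x - u n i x) <= 4 * B / 2 ^+ n.
  apply: le_trans (cmod_le _) _; rewrite cReD cReN cImD cImN /v /=.
  case: (cid2 (hr i x)) => l1 /= _ /(_ n) h1.
  case: (cid2 (hi i x)) => l2 /= _ /(_ n) h2.
  by have -> : 4 * B / 2 ^+ n = 2 * B / 2 ^+ n + 2 * B / 2 ^+ n; [ring|exact: lerD].
have bv : bounded_measurable v.
  split=> [i|].
    split.
      apply: (measurable_fun_cvg (h := fun n x => complex.Re (u n i x))) => [n|x _].
        exact: ((bu n).1 i).1.
      by rewrite /v /=; case: (cid2 (hr i x)).
    apply: (measurable_fun_cvg (h := fun n x => complex.Im (u n i x))) => [n|x _].
      exact: ((bu n).1 i).2.
    by rewrite /v /=; case: (cid2 (hi i x)).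
  exists (4 * B + 0) => i x; have := vu 0%N i x.
  by rewrite expr0 divr1 subr0 addr0.
exists v => // i x; apply/eqP; rewrite -subr_eq0; apply/eqP/cmod_eq0.
apply/le_anti; rewrite cmod_ge0 andbT.
have B0 : 0 <= B by exact: le_trans (cmod_ge0 _) (hB i x).
apply: (le0_geometric (B := 8 * B)) => n.
have -> : v i x - Phi v i x = (v i x - u n.+1 i x) + (u n.+1 i x - Phi v i x) by ring.
apply: le_trans (cmodD _ _) _.
have uv j y : cmod (u n j y - v j y) <= 4 * B / 2 ^+ n by rewrite -opprB cmodN.
apply: le_trans (lerD (vu n.+1 i x) (hC _ _ _ (bu n) bv uv i x)) _; rewrite exprS.
have : 0 <= B / 2 ^+ n by rewrite divr_ge0// exprn_ge0.
rewrite invfM; have -> : 4 * B * (2^-1 / 2 ^+ n) = 2 * (B / 2 ^+ n).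
  by field; rewrite expf_neq0// pnatr_eq0.
lra.
Qed.
End Contraction.

(** * Weakly coupled pairs of equations *)

Section System.
Context {R : realType}.
Local Notation mu := (@lebesgue_measure R).
Local Notation cmod := (@ComplexField.Normc.normc R).

Variables (s : bool -> bool) (E Ei a : bool -> R -> R[i]) (K kap : R).
Hypothesis (hE : forall j, cprim (E j) (fun x => a j x * E j x)).
Hypothesis (hEi : forall j, cprim (Ei j) (fun x => - a j x * Ei j x)).
Hypothesis (EEi : forall j x, E j x * Ei j x = 1).
Hypothesis (K0 : 0 <= K) (kap0 : 0 < kap).
Hypothesis (hK : forall j x t, half (s j) x t ->
  cmod (E j x * Ei j t) <= K * expR (- kap * `|x - t|)).
Variables (e : bool -> bool -> R -> R[i]) (eps : R).
Hypothesis (me : forall j k, cmeas (e j k)).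
Hypothesis (int_e : forall j k, (\int[mu]_t (cmod (e j k t))%:E <= eps%:E)%E).
Hypothesis (Keps : 8 * K * eps <= 1).
Variables (F : bool -> R -> R[i]) (M : R).
Hypothesis (mF : forall j, cmeas (F j)).
Hypothesis (FM : forall j x, (kint kap (F j) x <= M%:E)%E).

Definition coupled (y : bool -> R -> R[i]) j x :=
  e j true x * y true x + e j false x * y false x.

Definition source y j x := coupled y j x + F j x.

(** By [duhamel_le] the coupling contributes to the integral map at most
    2 K * 2 eps times the bound on y; the condition 8 K eps <= 1 makes this a
    contraction of ratio 1/2. *)
Definition integral_map y j := duhamel (s j) (E j) (Ei j) (source y j).

Let coupled_meas y j : (forall k, cmeas (y k)) -> cmeas (coupled y j).
Proof. by move=> my; apply: cmeasD; exact: cmeasM. Qed.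

Let coupled_kint y j x (c : R) : (forall k, cmeas (y k)) -> 0 <= c ->
  (forall k t, cmod (y k t) <= c) ->
  (kint kap (coupled y j) x <= (2 * eps * c)%:E)%E.
Proof.
move=> my c0 yc.
have h k : (kint kap (fun t => (e j k t * y k t)%R) x <= (c * eps)%:E)%E.
  apply: (@le_trans _ _ (c%:E * \int[mu]_t (cmod (e j k t))%:E)%E).
    apply: le_kint => //; [exact: cmeasM|exact: measurable_cmod|].
    by move=> t; rewrite cmodM mulrC ler_wpM2r ?cmod_ge0.
  by rewrite EFinM lee_wpmul2l// lee_fin.
apply: le_trans (kintD _ _ _ _) _; [exact: cmeasM|exact: cmeasM|].
apply: le_trans (leeD (h true) (h false)) _.
by rewrite -EFinD lee_fin le_eqVlt; apply/orP; left; apply/eqP; ring.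
Qed.

Let source_meas y j : (forall k, cmeas (y k)) -> cmeas (source y j).
Proof. by move=> my; apply: cmeasD => //; exact: coupled_meas. Qed.

Let source_kint y j x (c : R) : (forall k, cmeas (y k)) -> 0 <= c ->
  (forall k t, cmod (y k t) <= c) ->
  (kint kap (source y j) x <= (2 * eps * c + M)%:E)%E.
Proof.
move=> my c0 yc; apply: le_trans (kintD _ _ _ _) _ => //; first exact: coupled_meas.
by rewrite EFinD; apply: leeD => //; exact: coupled_kint.
Qed.

Let integral_map_le y j x (c : R) : (forall k, cmeas (y k)) -> 0 <= c ->
  (forall k t, cmod (y k t) <= c) ->
  cmod (integral_map y j x) <= c / 2 + 2 * K * M.
Proof.
move=> my c0 yc.
apply: le_trans (duhamel_le (hEi j) (EEi j) K0 (hK (j := j)) (source_meas j my) (source_kint j x my c0 yc)) _.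
have := ler_wpM2r c0 Keps; lra.
Qed.

(** Each application of the integral map halves the part of the bound on y that
    does not come from F. *)
Lemma system_bound y : (forall j, cmeas (y j)) ->
  (exists Y, forall j x, cmod (y j x) <= Y) ->
  (forall j x, y j x = integral_map y j x) ->
  forall j x, cmod (y j x) <= 4 * K * M.
Proof.
move=> my [Y yY] hy.
have M0 : 0 <= M.
  rewrite -lee_fin; apply: le_trans (FM true 0); apply: integral_ge0 => t _.
  by rewrite lee_fin mulr_ge0 ?expR_ge0 ?cmod_ge0.
have Y0 : 0 <= Y by exact: le_trans (cmod_ge0 _) (yY true 0).
have KM0 : 0 <= K * M by rewrite mulr_ge0.
have key n : forall j x, cmod (y j x) <= Y / 2 ^+ n + 4 * K * M.
  elim: n => [j x|n IH j x]; first by rewrite expr0 divr1 (le_trans (yY j x))// lerDl -mulrA mulr_ge0.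
  have c0 : 0 <= Y / 2 ^+ n + 4 * K * M by rewrite addr_ge0 ?divr_ge0 ?exprn_ge0// -mulrA mulr_ge0.
  rewrite hy; apply: le_trans (integral_map_le j x my c0 IH) _.
  have -> : Y / 2 ^+ n.+1 = (Y / 2 ^+ n) / 2.
    by rewrite exprS; field; rewrite expf_neq0// pnatr_eq0.
  lra.
move=> j x; rewrite -subr_le0; apply: (le0_geometric (B := Y)) => n.
by rewrite lerBlDr.
Qed.

Lemma system_solution : exists y : bool -> R -> R[i],
  (forall j, cprim (y j) (fun x => a j x * y j x + source y j x)) /\
  forall j x, cmod (y j x) <= 4 * K * M.
Proof.
have [y [my [Y yY]] hy] : exists2 y, bounded_measurable y &
    forall j x, y j x = integral_map y j x.
  apply: contraction_fixpoint => [u [mu_ [B uB]]|u v d [mu_ [B uB]] [mv [B' vB]] uv j x].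
    have B0 : 0 <= B by exact: le_trans (cmod_ge0 _) (uB true 0).
    split=> [j|]; last by exists (B / 2 + 2 * K * M) => j x; exact: integral_map_le.
    apply: ccont_cmeas; apply: cprim_ccont; apply: (duhamel_prim (hE j) (hEi j) (EEi j) (hK (j := j))).
      exact: source_meas.
    by move=> x; apply: le_lt_trans (source_kint j x mu_ B0 uB) (ltry _).
  have B0 : 0 <= B by exact: le_trans (cmod_ge0 _) (uB true 0).
  have B'0 : 0 <= B' by exact: le_trans (cmod_ge0 _) (vB true 0).
  have d0 : 0 <= d by exact: le_trans (cmod_ge0 _) (uv true 0).
  rewrite /integral_map -(duhamelB (hEi j) (EEi j) (hK (j := j)))//; last 4 first.
  - exact: source_meas.
  - exact: source_meas.
  - by apply: le_lt_trans (source_kint j x mu_ B0 uB) (ltry _).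
  - by apply: le_lt_trans (source_kint j x mv B'0 vB) (ltry _).
  have -> : (fun t => source u j t - source v j t) = coupled (fun k t => u k t - v k t) j.
    by apply/funext => t; rewrite /source /coupled; ring.
  have md k : cmeas (fun t => u k t - v k t) by exact: cmeasB.
  apply: le_trans (duhamel_le (hEi j) (EEi j) K0 (hK (j := j)) (coupled_meas j md) (coupled_kint j x md d0 uv)) _.
  have := ler_wpM2r d0 Keps; lra.
have Y0 : 0 <= Y by exact: le_trans (cmod_ge0 _) (yY true 0).
exists y; split; last by apply: system_bound => //; exists Y.
move=> j; have := duhamel_prim (hE j) (hEi j) (EEi j) (hK (j := j)) (source_meas j my)
  (fun x => le_lt_trans (source_kint j x my Y0 yY) (ltry _)).
congr cprim; apply/funext => x; first by rewrite hy.
by rewrite [in RHS]hy.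
Qed.

(** By [duhamel_unique], bounded solutions are fixed points of the integral
    map. *)
Lemma system_apriori y : (exists Y, forall j x, cmod (y j x) <= Y) ->
  (forall j, cprim (y j) (fun x => a j x * y j x + source y j x)) ->
  forall j x, cmod (y j x) <= 4 * K * M.
Proof.
move=> [Y yY] py; have my j : cmeas (y j) by exact: ccont_cmeas (cprim_ccont (py j)).
have Y0 : 0 <= Y by exact: le_trans (cmod_ge0 _) (yY true 0).
apply: system_bound => //; first by exists Y.
move=> j x; exact: (duhamel_unique (hE j) (hEi j) (EEi j) K0 kap0 (hK (j := j)) (source_meas j my)
  (fun x => source_kint j x my Y0 yY) (py j) (yY j)).
Qed.
End System.

(** * Propagators *)

Section Propagator.
Context {R : realType}.
Local Notation mu := (@lebesgue_measure R).
Local Notation Re := (@complex.Re R).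
Local Notation Im := (@complex.Im R).
Local Notation cmod := (@ComplexField.Normc.normc R).
Local Notation integ D f := (mu.-integrable D (EFin \o f)).

Lemma is_derive_continuous (F : R -> R) (x l : R) : is_derive x 1 F l -> {for x, continuous F}.
Proof.
move=> dF; apply: differentiable_continuous; apply/derivable1_diffP.
exact: (@ex_derive _ _ _ _ _ _ _ dF).
Qed.

Lemma is_derive_primitiveNy (f : R -> R) : continuous f -> integ setT f ->
  forall x : R, is_derive x 1 (fun y => Rintegral mu `]-oo, y] f) (f x).
Proof.
move=> cf intf x.
have i1 : integ `]-oo, x + 1] f by apply: integrableS intf.
have [||h1 h2] := @continuous_FTC1 _ f -oo%O x (x + 1) _ i1 _ (cf x).
- by rewrite ltrDl.
- by rewrite ltNyr.
by apply: DeriveDef => //; rewrite -derive1E.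
Qed.

(** Differentiable everywhere; unlike [cprim], this can be composed with the
    exponential. *)
Definition cdiff (F f : R -> R[i]) := (forall x : R, is_derive x 1 (Re \o F) (Re (f x))) /\
  (forall x : R, is_derive x 1 (Im \o F) (Im (f x))).

Lemma cdiff_cprim F f : cdiff F f -> ccont f -> cprim F f.
Proof. by move=> [d1 d2] [c1 c2]; split; exact: prim_C1. Qed.

Lemma cdiff_ccont F f : cdiff F f -> ccont F.
Proof. by move=> [d1 d2]; split=> x; [exact: is_derive_continuous (d1 x)|exact: is_derive_continuous (d2 x)]. Qed.

Lemma integrable_cmod (f : R -> R[i]) (I : R) : cmeas f ->
  (\int[mu]_t (cmod (f t))%:E <= I%:E)%E -> integ setT (fun t => cmod (f t)).
Proof.
by move=> mf; apply: integ_ge0 => [|x]; [exact: measurable_cmod|exact: cmod_ge0].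
Qed.

Lemma cdiff_primitive (f : R -> R[i]) (I : R) : ccont f ->
  (\int[mu]_t (cmod (f t))%:E <= I%:E)%E ->
  exists F, [/\ cdiff F f, forall x, `|Re (F x)| <= I & forall x, `|Im (F x)| <= I].
Proof.
move=> cf hI; have mf := ccont_cmeas cf.
have hf := integrable_cmod mf hI.
have i1 : integ setT (fun x => Re (f x)).
  by apply: le_integ hf => // [|x _]; [exact: mf.1|exact: Re_le_cmod].
have i2 : integ setT (fun x => Im (f x)).
  by apply: le_integ hf => // [|x _]; [exact: mf.2|exact: Im_le_cmod].
have bnd (u : R -> R) x : integ setT u -> (forall t, `|u t| <= cmod (f t)) ->
    `|Rintegral mu `]-oo, x] u| <= I.
  move=> iu hu.
  have iu' : integ `]-oo, x] u by apply: integrableS iu.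
  have if' : integ `]-oo, x] (fun t => cmod (f t)) by apply: integrableS hf.
  apply: le_trans (le_normr_Rintegral _ _) _ => //.
  apply: (@le_trans _ _ (Rintegral mu `]-oo, x] (fun t => cmod (f t)))).
    by apply: le_Rintegral => //; exact: integ_norm.
  rewrite -lee_fin /Rintegral fineK; last exact: integrable_fin_num.
  apply: le_trans hI; apply: ge0_subset_integral => //.
    by apply/measurable_EFinP; exact: measurable_cmod.
  by move=> t _; rewrite lee_fin cmod_ge0.
exists (fun x => Complex (Rintegral mu `]-oo, x] (fun t => Re (f t)))
  (Rintegral mu `]-oo, x] (fun t => Im (f t)))); split=> [|x|x].
- by split=> x; apply: is_derive_primitiveNy => //; [exact: cf.1|exact: cf.2].
- by apply: bnd => // t; exact: Re_le_cmod.
- by apply: bnd => // t; exact: Im_le_cmod.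
Qed.

Definition cexp (z : R[i]) : R[i] :=
  Complex (expR (Re z) * cos (Im z)) (expR (Re z) * sin (Im z)).

Lemma cmod_cexp z : cmod (cexp z) = expR (Re z).
Proof.
rewrite cmodE /= !exprMn -mulrDr cos2Dsin2 mulr1 sqrtr_sqr.
by rewrite ger0_norm// expR_ge0.
Qed.

Lemma cexpD z w : cexp (z + w) = cexp z * cexp w.
Proof.
apply: eq_ReIm; rewrite ?cReM ?cImM /= cReD cImD expRD ?cosD ?sinD; ring.
Qed.

Lemma cexp0 : cexp 0 = 1.
Proof. by apply: eq_ReIm; rewrite /= expR0 ?cos0 ?sin0 ?mul1r. Qed.

Lemma cdiff_cexp F f : cdiff F f -> cdiff (fun x => cexp (F x)) (fun x => f x * cexp (F x)).
Proof.
move=> [d1 d2].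
have dE (x : R) : is_derive x 1 (fun y => expR (Re (F y))) (Re (f x) * expR (Re (F x))).
  have := @is_derive1_comp R expR (Re \o F) x _ _ (is_derive_expR _) (d1 x).
  by move=> h; apply: is_derive_eq h _; rewrite mulrC.
have dC (x : R) : is_derive x 1 (fun y => cos (Im (F y))) (- (Im (f x) * sin (Im (F x)))).
  have := @is_derive1_comp R cos (Im \o F) x _ _ (is_derive_cos _) (d2 x).
  by move=> h; apply: is_derive_eq h _; rewrite mulNr mulrC.
have dS (x : R) : is_derive x 1 (fun y => sin (Im (F y))) (Im (f x) * cos (Im (F x))).
  have := @is_derive1_comp R sin (Im \o F) x _ _ (is_derive_sin _) (d2 x).
  by move=> h; apply: is_derive_eq h _; rewrite mulrC.
split=> x.
  have h := is_deriveM (dE x) (dC x); apply: is_derive_eq h _.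
  by cbv beta; rewrite cReM /cexp /GRing.scale /=; ring.
have h := is_deriveM (dE x) (dS x); apply: is_derive_eq h _.
by cbv beta; rewrite cImM /cexp /GRing.scale /=; ring.
Qed.

Lemma cdiff_line c : cdiff (fun x : R => c * x%:C%C) (fun=> c).
Proof.
split=> x.
  have h : is_derive x 1 (fun y : R => Re c * y) (Re c).
    by apply: is_derive_eq; rewrite /GRing.scale /= mulr1.
  by move: h; congr is_derive; apply/funext => y; rewrite /comp cReM cReC cImC mulr0 subr0.
have h : is_derive x 1 (fun y : R => Im c * y) (Im c).
  by apply: is_derive_eq; rewrite /GRing.scale /= mulr1.
by move: h; congr is_derive; apply/funext => y; rewrite /comp cImM cReC cImC mulr0 add0r.
Qed.

Lemma cdiffD F G f g : cdiff F f -> cdiff G g ->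
  cdiff (fun x => F x + G x) (fun x => f x + g x).
Proof.
move=> [d1 d2] [e1 e2]; split=> x.
  have h := is_deriveD (d1 x) (e1 x); rewrite cReD.
  by move: h; congr is_derive; apply/funext => y /=; rewrite cReD.
have h := is_deriveD (d2 x) (e2 x); rewrite cImD.
by move: h; congr is_derive; apply/funext => y /=; rewrite cImD.
Qed.

Lemma cdiffN F f : cdiff F f -> cdiff (fun x => - F x) (fun x => - f x).
Proof.
move=> [d1 d2]; split=> x.
  have h := is_deriveN (d1 x); rewrite cReN.
  by move: h; congr is_derive; apply/funext => y /=; rewrite cReN.
have h := is_deriveN (d2 x); rewrite cImN.
by move: h; congr is_derive; apply/funext => y /=; rewrite cImN.
Qed.

(** The propagator of y' = (c + d x) y.  It decays like that of y' = c y, from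
    the side given by the sign of Re c; the integrable part d only costs the
    factor expR (2 I), whatever the size of c. *)
Lemma propagator (c : R[i]) (d : R -> R[i]) (I : R) : ccont d ->
  (\int[mu]_t (cmod (d t))%:E <= I%:E)%E ->
  exists E Ei : R -> R[i],
    [/\ cprim E (fun x => (c + d x) * E x), cprim Ei (fun x => - (c + d x) * Ei x),
      forall x, E x * Ei x = 1 &
      forall x t, half (Re c < 0) x t ->
        cmod (E x * Ei t) <= expR (2 * I) * expR (- `|Re c| * `|x - t|)].
Proof.
move=> cd hI; have [D [dD D1 D2]] := cdiff_primitive cd hI.
have dA := cdiffD (cdiff_line c) dD.
have cA := cdiff_ccont dA.
have cc : ccont (fun x => c + d x) by apply: ccontD => //; exact: ccont_cst.
exists (fun x => cexp (c * x%:C%C + D x)), (fun x => cexp (- (c * x%:C%C + D x))).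
have dE := cdiff_cexp dA; have dEi := cdiff_cexp (cdiffN dA).
split.
- by apply: cdiff_cprim => //; apply: ccontM => //; exact: cdiff_ccont dE.
- apply: cdiff_cprim => //; apply: ccontM; last exact: cdiff_ccont dEi.
  have := ccontM (ccont_cst (-1)) cc; congr ccont; apply/funext => x.
  by rewrite mulN1r.
- by move=> x; rewrite -cexpD subrr cexp0.
- move=> x t xt; rewrite -cexpD cmod_cexp -expRD ler_expR.
  have -> : Re (c * x%:C%C + D x - (c * t%:C%C + D t)) =
      Re c * (x - t) + (Re (D x) - Re (D t)).
    by rewrite !(cReD, cReN, cReM, cReC, cImC); ring.
  have h1 := D1 x; have h2 := D1 t.
  have h3 : Re c * (x - t) = - `|Re c| * `|x - t|.
    move: xt; rewrite /half; case: (ltP (Re c) 0) => c0 /=; rewrite in_itv /= => xt.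
      by rewrite (ltr0_norm c0) ger0_norm ?subr_ge0// opprK.
    move: xt; rewrite andbT => xt.
    by rewrite (ger0_norm c0) ler0_norm ?subr_le0// mulrNN.
  rewrite -h3; move: h1 h2; rewrite !ler_norml => /andP[h1 h1'] /andP[h2 h2'].
  lra.
Qed.

End Propagator.

(** * The weights <x>^-s, convolution bounds and mollification *)

Section Weights.
Context {R : realType}.
Implicit Types (x y t c s : R).
Local Notation mu := (@lebesgue_measure R).
Local Notation cmod := (@ComplexField.Normc.normc R).
Local Notation integ D f := (mu.-integrable D (EFin \o f)).

Lemma japanese_ge1 x : 1 <= japanese x.
Proof.
rewrite /japanese -[leLHS]sqrtr1; apply: ler_wsqrtr.
by rewrite lerDl sqr_ge0.
Qed.

Lemma japanese_gt0 x : 0 < japanese x.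
Proof. exact: lt_le_trans ltr01 (japanese_ge1 x). Qed.

Lemma sqr_japanese x : japanese x ^+ 2 = 1 + x ^+ 2.
Proof. by rewrite /japanese sqr_sqrtr ?real_normK ?num_real// addr_ge0// sqr_ge0. Qed.

Lemma le_japanese x y : 0 <= y -> y ^+ 2 <= 1 + x ^+ 2 -> y <= japanese x.
Proof.
move=> y0 h; rewrite -(@ler_pXn2r _ 2)// ?nnegrE ?(ltW (japanese_gt0 _))//.
by rewrite sqr_japanese.
Qed.

Lemma japanese_shift x y : `|x - y| <= 1 -> japanese x <= 2 * japanese y.
Proof.
move=> xy; rewrite -(@ler_pXn2r _ 2)// ?nnegrE ?mulr_ge0 ?(ltW (japanese_gt0 _))//.
rewrite exprMn !sqr_japanese; move: xy; rewrite ler_norml => /andP[h1 h2].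
have : 0 <= (1 - (x - y)) * (1 + (x - y)) by apply: mulr_ge0; lra.
have := sqr_ge0 (x - 2 * y); nra.
Qed.

Lemma japanese_even : japanese =1 (@japanese R) \o -%R.
Proof. by move=> x; rewrite /japanese /= normrN. Qed.

Lemma continuous_japanese : continuous (@japanese R).
Proof.
move=> x; apply: continuous_comp; last exact: sqrt_continuous.
apply: cvgD; first exact: cvg_cst.
apply: (@continuous_comp _ _ _ (fun x : R => `|x|) (fun x => x ^+ 2)).
  exact: norm_continuous.
exact: exprn_continuous.
Qed.

Definition rho s x : R := japanese x `^ (- s).

Lemma rho_gt0 s x : 0 < rho s x.
Proof. by rewrite powR_gt0// japanese_gt0. Qed.

Lemma rho_le1 s x : 0 <= s -> rho s x <= 1.
Proof.
move=> s0; rewrite /rho powRN invf_le1 ?powR_gt0 ?japanese_gt0//.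
rewrite -(powRr0 (japanese x)); apply: ler_powR => //; exact: japanese_ge1.
Qed.

Lemma continuous_rho s : continuous (rho s).
Proof.
move=> x; apply: (@continuous_comp R R R (@japanese R) (fun a : R => a `^ (- s))).
  exact: continuous_japanese.
exact: is_derive_continuous (is_derive1_powR _ (japanese_gt0 x)).
Qed.

Lemma measurable_rho s : measurable_fun setT (rho s).
Proof. by apply: continuous_measurable_fun; exact: continuous_rho. Qed.

Lemma rho_shift s x y : 0 <= s -> `|x - y| <= 1 -> rho s y <= 2 `^ s * rho s x.
Proof.
move=> s0 xy; rewrite /rho !powRN ler_pdivlMr ?powR_gt0 ?japanese_gt0//.
rewrite mulrC ler_pdivrMr ?powR_gt0 ?japanese_gt0// -powRM ?(ltW (japanese_gt0 _))//.
apply: ge0_ler_powR; rewrite ?nnegrE ?mulr_ge0 ?(ltW (japanese_gt0 _))//.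
exact: japanese_shift.
Qed.

Lemma sqr_rho s x : rho s x ^+ 2 = rho (2 * s) x.
Proof.
rewrite /rho -powR_mulrn ?powR_ge0// -powRrM; congr (_ `^ _); ring.
Qed.

Lemma cvg_powRNy r : 0 < r -> (1 + x) `^ (- r) @[x --> +oo] --> (0 : R).
Proof.
move=> r0; apply/cvgrPdist_lt => e e0.
pose M := e `^ (- r^-1).
near=> x.
have M0 : 0 < M by rewrite powR_gt0.
have xM : M < x by near: x; apply: nbhs_pinfty_gt; exact: num_real.
rewrite sub0r normrN ger0_norm ?powR_ge0// powRN.
have -> : e = (M `^ r)^-1 by rewrite /M -powRrM mulNr mulVf ?gt_eqF// powR_inv1 ?invrK// ltW.
rewrite ltf_pV2 ?posrE ?powR_gt0//; last by rewrite (lt_trans M0)// (lt_trans xM)// ltrDr.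
apply: gt0_ltr_powR => //; rewrite ?nnegrE ?(ltW M0)//; last by rewrite (lt_trans xM)// ltrDr.
by rewrite (le_trans (ltW M0))// (le_trans (ltW xM))// lerDr.
Unshelve. all: by end_near. Qed.

Lemma integral_powR_half r : 0 < r ->
  (\int[mu]_(x in `[0%R, +oo[) ((1 + x) `^ (- (1 + r)))%:E = (r^-1)%:E)%E.
Proof.
move=> r0; pose F x : R := - (1 + x) `^ (- r) / r.
have dF x : 0 <= x -> is_derive x 1 F ((1 + x) `^ (- (1 + r))).
  move=> x0; have x1 : 0 < 1 + x by rewrite ltr_pwDl.
  have h1 : is_derive x 1 (fun y : R => 1 + y) 1.
    by have := is_deriveD (is_derive_cst (1 : R) x 1) (is_derive_id x (1 : R)); rewrite add0r.
  have h2 := @is_derive1_comp R (fun a : R => a `^ (- r)) (fun y : R => 1 + y) x _ _ (is_derive1_powR _ x1) h1.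
  have h3 := is_deriveZ (- r^-1) h2.
  have h4 : is_derive x 1 F (- r^-1 *: (- r * (1 + x) `^ (- r - 1) * 1)).
    move: h3; congr is_derive; apply/funext => y; rewrite /F /= /GRing.scale /=; ring.
  apply: is_derive_eq h4 _; rewrite /GRing.scale /= mulr1 mulrA mulrNN mulVf ?gt_eqF// mul1r.
  congr (_ `^ _); ring.
have c1 : continuous (fun x : R => 1 + x).
  by move=> x; apply: cvgD; [exact: cvg_cst|exact: cvg_id].
rewrite (@ge0_continuous_FTC2y _ _ F 0 0).
- by rewrite /F addr0 powR1 mulN1r sub0e EFinN oppeK.
- by move=> x _; exact: powR_ge0.
- apply: continuous_in_subspaceT => x; rewrite inE /= in_itv /= andbT => x0.
  apply: (@continuous_comp R R R (fun x : R => 1 + x) (fun a : R => a `^ (- (1 + r)))); first exact: c1.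
  by apply: is_derive_continuous (is_derive1_powR _ _); rewrite ltr_pwDl.
- rewrite -[X in _ --> X](mul0r (r^-1)); apply: cvgMl.
  by rewrite -[X in _ --> X]oppr0; apply: cvgN; exact: cvg_powRNy.
- by move=> x x0; exact: (@ex_derive _ _ _ _ _ _ _ (dF x (ltW x0))).
- apply: cvg_at_right_filter; exact: is_derive_continuous (dF 0 (lexx _)).
- move=> x; rewrite in_itv /= andbT => x0; rewrite derive1E.
  exact: (@derive_val _ _ _ _ _ _ _ (dF x (ltW x0))).
Qed.

Lemma integral_rho_fin s : 1 < s -> (\int[mu]_x (rho s x)%:E < +oo)%E.
Proof.
move=> s1; pose r := s - 1; have r0 : 0 < r by rewrite subr_gt0.
rewrite ge0_symfun_integralT; first last.
- by move=> x; rewrite /rho /= japanese_even.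
- exact: continuous_rho.
- by move=> x; rewrite ltW ?rho_gt0.
apply: (@le_lt_trans _ _ (2%:E * ((2 `^ s)%:E * (r^-1)%:E))%E); last by rewrite -!EFinM ltry.
(* <x> >= (1 + x) / 2 on the half-line *)
rewrite lee_wpmul2l ?lee_fin// -set_itvcy -integral_powR_half// -ge0_integralZl//; last 2 first.
- apply/measurable_EFinP; apply: measurable_funTS.
  apply: (measurableT_comp (measurable_powR _)); exact: measurable_funD.
- by move=> x _; rewrite lee_fin powR_ge0.
apply: ge0_le_integral => //.
- by move=> x _; rewrite lee_fin ltW ?rho_gt0.
- apply/measurable_EFinP; apply: measurable_funTS.
  by apply: continuous_measurable_fun; exact: continuous_rho.
- apply/measurable_EFinP; apply: measurable_funTS; apply: measurable_funM => //.
  apply: (measurableT_comp (measurable_powR _)); exact: measurable_funD.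
- move=> x; rewrite /= in_itv /= andbT => x0; rewrite -EFinM lee_fin.
  have x1 : 0 < 1 + x by rewrite ltr_pwDl.
  have -> : - (1 + r) = - s by rewrite /r; ring.
  rewrite /rho !powRN ler_pdivlMr ?powR_gt0// mulrC ler_pdivrMr ?powR_gt0 ?japanese_gt0//.
  rewrite -powRM ?(ltW (japanese_gt0 _))//.
  apply: ge0_ler_powR; rewrite ?nnegrE ?mulr_ge0 ?(ltW (japanese_gt0 _)) ?(ltW x1)//.
    by rewrite (le_trans _ (ltW s1)).
  rewrite mulrC -ler_pdivrMr//; apply: le_japanese; first by rewrite divr_ge0// ltW.
  have := sqr_ge0 (x - 1); rewrite exprMn exprVn; nra.
Qed.

Lemma integral_rho s : 1 < s ->
  exists2 I : R, 0 <= I & (\int[mu]_x (rho s x)%:E = I%:E)%E.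
Proof.
move=> s1; have I0 : (0 <= \int[mu]_x (rho s x)%:E)%E.
  by apply: integral_ge0 => x _; rewrite lee_fin ltW ?rho_gt0.
exists (fine (\int[mu]_x (rho s x)%:E)%E); first exact: fine_ge0.
by rewrite fineK// ge0_fin_numE ?integral_rho_fin.
Qed.

End Weights.

Section KernelBounds.
Context {R : realType}.
Implicit Types (x y t c s : R).
Local Notation mu := (@lebesgue_measure R).
Local Notation cmod := (@ComplexField.Normc.normc R).
Local Notation Re := (@complex.Re R).
Local Notation Im := (@complex.Im R).
Local Notation integ D f := (mu.-integrable D (EFin \o f)).

Lemma continuous_expabs c : continuous (fun t : R => expR (- c * `|t|)).
Proof.
move=> t; apply: (@continuous_comp R R R (fun t : R => - c * `|t|) expR); last exact: continuous_expR.
apply: cvgM; first exact: cvg_cst.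
exact: norm_continuous.
Qed.

Lemma integral_exp_half c : 0 < c ->
  (\int[mu]_(x in `[0%R, +oo[) (expR (- c * x))%:E = (c^-1)%:E)%E.
Proof.
move=> c0; pose F x : R := - expR (- c * x) / c.
have dlin x : is_derive x 1 (fun y : R => - c * y) (- c).
  have h := is_deriveZ (- c) (is_derive_id x (1 : R)).
  by apply: is_derive_eq h _; rewrite /GRing.scale /= mulr1.
have dF x : is_derive x 1 F (expR (- c * x)).
  have h2 := @is_derive1_comp R expR (fun y : R => - c * y) x _ _ (is_derive_expR _) (dlin x).
  have h3 := is_deriveZ (- c^-1) h2.
  have h4 : is_derive x 1 F (- c^-1 *: (expR (- c * x) * - c)).
    by move: h3; congr is_derive; apply/funext => y; rewrite /F /= /GRing.scale /=; ring.
  by apply: is_derive_eq h4 _; rewrite /GRing.scale /=; field; rewrite gt_eqF.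
have cE : continuous (fun x : R => expR (- c * x)).
  move=> x; apply: (@continuous_comp R R R (fun t : R => - c * t) expR); last exact: continuous_expR.
  exact: is_derive_continuous (dlin x).
rewrite (@ge0_continuous_FTC2y _ _ F 0 0).
- by rewrite /F mulr0 expR0 mulN1r sub0e EFinN oppeK.
- by move=> x _; exact: expR_ge0.
- exact: continuous_subspaceT.
- rewrite -[X in _ --> X](mul0r (c^-1)); apply: cvgMl.
  rewrite -[X in _ --> X]oppr0; apply: cvgN.
  have -> : (fun x => expR (- c * x)) = (fun x => expR (- x)) \o (fun x => c * x).
    by apply/funext => x; rewrite /= mulNr.
  apply: (@cvg_comp _ _ _ (fun x => c * x) (fun x : R => expR (- x)) _ +oo%R); last exact: cvgr_expR.
  by apply: gt0_cvgMry => //; exact: cvg_id.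
- by move=> x x0; exact: (@ex_derive _ _ _ _ _ _ _ (dF x)).
- apply: cvg_at_right_filter; exact: is_derive_continuous (dF 0).
- move=> x _; rewrite derive1E; exact: (@derive_val _ _ _ _ _ _ _ (dF x)).
Qed.

Lemma integral_expabs c x : 0 < c ->
  (\int[mu]_t (expR (- c * `|x - t|))%:E = (2 / c)%:E)%E.
Proof.
move=> c0; transitivity (\int[mu]_t (expR (- c * `|t|))%:E)%E.
  have dS (t : R) : is_derive t 1 (fun y : R => y - x) 1.
    by have := is_deriveB (is_derive_id t (1 : R)) (is_derive_cst x t 1); rewrite subr0.
  have dE : derive1 (fun y : R => y - x) = cst 1.
    by apply/funext => t; rewrite derive1E (@derive_val _ _ _ _ _ _ _ (dS t)).
  rewrite [RHS](@increasing_ge0_integration_by_substitutionT _ (fun y : R => y - x)).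
  - by apply: eq_integral => t _; rewrite dE /= !fctE mulr1 distrC.
  - by move=> a b ab; rewrite ltrD2r.
  - by rewrite dE; exact: cst_continuous.
  - by rewrite dE; exact: is_cvg_cst.
  - by rewrite dE; exact: is_cvg_cst.
  - by move=> t; exact: (@ex_derive _ _ _ _ _ _ _ (dS t)).
  - by apply: cvg_addrr_Ny.
  - by apply: cvg_addrr.
  - exact: continuous_expabs.
  - by move=> t; exact: expR_ge0.
rewrite ge0_symfun_integralT; first last.
- by move=> t /=; rewrite normrN.
- exact: continuous_expabs.
- by move=> t; exact: expR_ge0.
rewrite -set_itvcy EFinM -integral_exp_half//; congr (_ * _)%E.
by apply: eq_integral => t; rewrite inE /= in_itv /= andbT => t0; rewrite ger0_norm.
Qed.

Lemma kint_le_L1 kap (g : R -> R[i]) x : 0 < kap -> cmeas g ->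
  (kint kap g x <= \int[mu]_t (cmod (g t))%:E)%E.
Proof.
move=> k0 mg; rewrite -[leRHS]mul1e; apply: le_kint => //; first exact: measurable_cmod.
by move=> t; rewrite mul1r.
Qed.

(** Hoelder's inequality; 1/kap is the integral of exp (- 2 kap |x - t|). *)
Lemma kint_le_L2 kap (g : R -> R[i]) x : 0 < kap -> cmeas g ->
  (kint kap g x <= (kap^-1 `^ 2^-1)%:E * Lnorm mu 2%:E (fun t => (cmod (g t))%:E))%E.
Proof.
move=> k0 mg.
have := @hoelder _ _ _ mu (fun t => expR (- kap * `|x - t|)) (fun t => cmod (g t)) 2 2
  (measurable_kern kap x) (measurable_cmod mg) (ltr0Sn R 1) (ltr0Sn R 1).
have -> : (2^-1 + 2^-1 = 1 :> R) by lra.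
move=> /(_ erefl); rewrite Lnorm1.
have -> : (\int[mu]_t `|(EFin \o ((fun t => expR (- kap * `|x - t|)) \* (fun t => cmod (g t)))%R) t| = kint kap g x)%E.
  by apply: eq_integral => t _ /=; rewrite ger0_norm// mulr_ge0 ?expR_ge0 ?cmod_ge0.
move=> h; apply: (le_trans h); rewrite le_eqVlt; apply/orP; left; apply/eqP; congr (_ * _)%E.
rewrite unlock; have -> : (\int[mu]_t (`|(EFin \o (fun t => expR (- kap * `|x - t|)%R)) t| `^ 2 ) = (kap^-1)%:E)%E.
  have -> : kap^-1 = 2 / (2 * kap) by field; rewrite gt_eqF.
  rewrite -(@integral_expabs (2 * kap) x) ?mulr_gt0//; apply: eq_integral => t _ /=.
  rewrite ger0_norm ?expR_ge0// powR_mulrn ?expR_ge0// expr2 -expRD; congr (expR _)%:E; ring.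
by rewrite poweR_EFin.
Qed.

(** p x is the mean of q over [x, x + h], that is a difference quotient of a
    primitive of q.  By the mean value theorem p is bounded by the values of q
    near x, hence by the weight, and p' by those values divided by h.  As h tends
    to 0, q - p tends to 0 pointwise, and in L^1 by dominated convergence. *)
Lemma mollify (q : R -> R[i]) (C s : R) : ccont q -> 1 < s ->
  (forall x, cmod (q x) <= C * rho s x) -> forall delta : R, 0 < delta ->
  exists p p' : R -> R[i], exists C' : R,
    [/\ cprim p p', ccont p', forall x, cmod (p x) <= C' * rho s x,
        forall x, cmod (p' x) <= C' * rho s x &
        (\int[mu]_t (cmod (q t - p t))%:E <= delta%:E)%E].
Proof.
move=> cq s1 qC delta d0.
have s0 : 0 <= s by exact: le_trans (ltW s1).
have C0 : 0 <= C.
  have := le_trans (cmod_ge0 _) (qC 0); rewrite pmulr_lge0//; exact: rho_gt0.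
have rho0 t : 0 <= rho s t by rewrite ltW ?rho_gt0.
have [Ir Ir0 hIr] := integral_rho s1.
have mr := measurable_rho s.
have hI : (\int[mu]_t (cmod (q t))%:E <= (C * Ir)%:E)%E.
  rewrite EFinM -hIr -ge0_integralZl ?lee_fin//; last 2 first.
  - exact/measurable_EFinP.
  - by move=> x _; rewrite lee_fin.
  apply: ge0_le_integral => //.
  - by move=> t _; rewrite lee_fin cmod_ge0.
  - by apply/measurable_EFinP; apply: measurable_cmod; exact: ccont_cmeas.
  - by apply/measurable_EFinP; exact: measurable_funM.
  - by move=> t _; rewrite -EFinM lee_fin.
have [Q [dQ _ _]] := cdiff_primitive cq hI.
pose h n : R := n.+1%:R^-1.
have h0 n : 0 < h n by rewrite invr_gt0.
have h1 n : h n <= 1 by rewrite invf_le1// ler1n.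
pose p n x := (n.+1%:R : R)%:C%C * (Q (x + h n) - Q x).
pose p' n x := (n.+1%:R : R)%:C%C * (q (x + h n) - q x).
have cshift n (f : R -> R) : continuous f -> continuous (fun x => f (x + h n)).
  move=> cf x; apply: (@continuous_comp R R R (fun x : R => x + h n) f); last exact: cf.
  by apply: cvgD; [exact: cvg_id|exact: cvg_cst].
have cp' n : ccont (p' n).
  apply: ccontM; first exact: ccont_cst.
  apply: ccontD; first by split; [exact: (cshift n _ cq.1)|exact: (cshift n _ cq.2)].
  have := ccontM (ccont_cst (-1)) cq; congr ccont; apply/funext => x; exact: mulN1r.
have pp n : cprim (p n) (p' n).
  apply: cprimZ; apply: cprimB; last exact: cdiff_cprim.
  apply: cdiff_cprim; last by split; [exact: (cshift n _ cq.1)|exact: (cshift n _ cq.2)].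
  have dS (t : R) : is_derive t 1 (fun y : R => y + h n) 1.
    by have := is_deriveD (is_derive_id t (1 : R)) (is_derive_cst (h n) t 1); rewrite addr0.
  split=> x.
    have := @is_derive1_comp R (Re \o Q) (fun y : R => y + h n) x _ _ (dQ.1 _) (dS x).
    by rewrite mulr1.
  have := @is_derive1_comp R (Im \o Q) (fun y : R => y + h n) x _ _ (dQ.2 _) (dS x).
  by rewrite mulr1.
have mvt n x (F f : R -> R) : (forall t : R, is_derive t 1 F (f t)) ->
    exists2 t, x <= t <= x + h n & n.+1%:R * (F (x + h n) - F x) = f t.
  move=> dF; have xh : x <= x + h n by rewrite lerDl ltW.
  have [|t tP ->] := @MVT_segment _ F f x (x + h n) xh (fun t _ => dF t).
    by apply: continuous_subspaceT => t; exact: is_derive_continuous (dF t).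
  exists t; first by move: tP; rewrite in_itv.
  by rewrite addrAC subrr add0r mulrCA divff ?mulr1.
have Rep n x : exists2 t, x <= t <= x + h n & Re (p n x) = Re (q t).
  have [t tP e] := mvt n x _ _ dQ.1; exists t => //.
  by rewrite -e /p cReM cReC cImC mul0r subr0 cReD cReN.
have Imp n x : exists2 t, x <= t <= x + h n & Im (p n x) = Im (q t).
  have [t tP e] := mvt n x _ _ dQ.2; exists t => //.
  by rewrite -e /p cImM cReC cImC mul0r addr0 cImD cImN.
have qt n x t : x <= t <= x + h n -> cmod (q t) <= C * (2 `^ s * rho s x).
  move=> /andP[t1 t2]; apply: le_trans (qC t) _; rewrite ler_wpM2l// rho_shift//.
  by have := h1 n; rewrite ler_norml => ?; apply/andP; split; lra.
have pC n x : cmod (p n x) <= 2 * C * 2 `^ s * rho s x.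
  apply: le_trans (cmod_le _) _.
  have [t tP ->] := Rep n x; have [u uP ->] := Imp n x.
  have := le_trans (Re_le_cmod _) (qt _ _ _ tP).
  have := le_trans (Im_le_cmod _) (qt _ _ _ uP).
  lra.
have p'C n x : cmod (p' n x) <= n.+1%:R * (C * 2 `^ s + C) * rho s x.
  rewrite /p' cmodM cmod_real ger0_norm// -mulrA ler_wpM2l//.
  apply: le_trans (cmodB _ _) _; rewrite mulrDl lerD// -mulrA; apply: (@qt n).
  by rewrite lexx lerDl ltW.
have cvgp x : (fun n => cmod (q x - p n x)) @ \oo --> (0 : R).
  have cv (f : R -> R) (u : nat -> R) : continuous f ->
      (forall n, exists2 t, x <= t <= x + h n & u n = f t) -> u @ \oo --> f x.
    move=> cf hu; apply/cvgrPdist_lt => e e0.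
    have /cvgrPdist_lt /(_ e e0) := cf x.
    move=> /nbhs_ballP[d /= dp dH].
    near=> n; have [t /andP[t1 t2] ->] := hu n.
    apply: dH; rewrite /ball /= ler0_norm ?subr_le0// opprB.
    apply: (@le_lt_trans _ _ (h n)); first by rewrite lerBlDl.
    near: n; have /cvgrPdist_lt /(_ d dp) := @cvg_harmonic R.
    by apply: filterS => n /=; rewrite sub0r normrN ger0_norm// ltW.
  have c1 := cv _ _ cq.1 (fun n => Rep n x).
  have c2 := cv _ _ cq.2 (fun n => Imp n x).
  have c3 : (fun n => `|Re (q x) - Re (p n x)| + `|Im (q x) - Im (p n x)|) @ \oo --> (0 : R).
    rewrite -[X in _ --> X]addr0; apply: cvgD.
      rewrite -(@normr0 R R) -[X in `|X|](subrr (Re (q x))).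
      by apply: cvg_norm; apply: cvgB => //; exact: cvg_cst.
    rewrite -(@normr0 R R) -[X in `|X|](subrr (Im (q x))).
    by apply: cvg_norm; apply: cvgB => //; exact: cvg_cst.
  apply: squeeze_cvgr (cvg_cst 0) c3; apply: nearW => n.
  by rewrite cmod_ge0 /= (le_trans (cmod_le _))// cReD cReN cImD cImN.
have mp n : cmeas (p n) by exact: ccont_cmeas (cprim_ccont (pp n)).
have cv : (\int[mu]_x (cmod (q x - p n x))%:E @[n --> \oo] --> \int[mu]_x (0%:E : \bar R))%E.
  apply: (@dominated_cvg _ _ _ mu setT measurableT (fun n x => (cmod (q x - p n x))%:E) (fun=> 0%E)
    (fun x => ((C + 2 * C * 2 `^ s) * rho s x)%:E)) => //.
  - move=> n; apply/measurable_EFinP; apply: measurable_cmod; apply: cmeasB => //.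
    exact: ccont_cmeas.
  - by move=> x _; apply: cvg_EFin; [exact: nearW|exact: cvgp].
  - have : integ setT (fun x => (C + 2 * C * 2 `^ s) * rho s x).
      by apply: integZ => //; apply: (integ_ge0 mr rho0 (G := Ir)); rewrite hIr.
    by [].
  - move=> n x _; rewrite /= ger0_norm ?cmod_ge0// lee_fin mulrDl.
    by apply: le_trans (cmodB _ _) _; apply: lerD.
rewrite integral0 in cv.
have [n hn] : exists n, (\int[mu]_x (cmod (q x - p n x))%:E <= delta%:E)%E.
  have /fine_cvgP[fn /cvgrPdist_lt /(_ _ d0) cvd] := cv.
  near \oo => n; exists n.
  have fnn : (\int[mu]_x (cmod (q x - p n x))%:E)%E \is a fin_num by near: n.
  have : `|0 - fine (\int[mu]_x (cmod (q x - p n x))%:E)%E| < delta by near: n.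
  rewrite sub0r normrN ger0_norm; last first.
    by apply: fine_ge0; apply: integral_ge0 => x _; rewrite lee_fin cmod_ge0.
  by move=> hlt; rewrite -(fineK fnn) lee_fin ltW.
have rC (a b : R) x : 0 <= b -> a * rho s x <= (a + b) * rho s x.
  by move=> b0; rewrite ler_wpM2r// lerDl.
exists (p n), (p' n), (2 * C * 2 `^ s + n.+1%:R * (C * 2 `^ s + C)); split => //.
- move=> x; apply: le_trans (pC n x) _; apply: rC.
  by rewrite mulr_ge0// addr_ge0// mulr_ge0// powR_ge0.
- move=> x; apply: le_trans (p'C n x) _; rewrite [X in _ <= X * _]addrC; apply: rC.
  by rewrite !mulr_ge0// powR_ge0.
Unshelve. all: by end_near. Qed.

End KernelBounds.

(** * Conjugation of the Dirac system *)

Section Gauge.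
Context {R : realType}.
Local Notation mu := (@lebesgue_measure R).
Local Notation cmod := (@ComplexField.Normc.normc R).
Local Notation Re := (@complex.Re R).
Local Notation Im := (@complex.Im R).

(** The right-hand sides of the system u' = ... equivalent to (H - z) u = f;
    [true] is the index of the first component and [false] that of the second. *)
Definition dirac_rhs (m z : R[i]) (v : bool -> bool -> R -> R[i])
    (f u : bool -> R -> R[i]) (j : bool) (x : R) : R[i] :=
  if j then 'i%C * (f true x + z * u true x - m * u false x
                    - v true true x * u true x - v true false x * u false x)
  else - 'i%C * (f false x + z * u false x - m * u true x
                 - v false true x * u true x - v false false x * u false x).

Variables (m z tau k eta : R[i]) (v : bool -> bool -> R -> R[i]) (n n' : R -> R[i]).
Hypotheses (tau0 : tau != 0) (D0 : 1 - tau ^+ 2 != 0) (eta0 : eta != 0).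
Hypothesis (zE : z = m * (1 + tau ^+ 2) / (2 * tau)).
Hypothesis (kE : k = m * (1 - tau ^+ 2) / (2 * tau)).
Hypothesis (pn : cprim n n').

Let iD : R[i] := (1 - tau ^+ 2)^-1.

(** The new unknowns: first the inverse of the matrix with rows (1, tau) and
    (tau, 1), then that of the shear with rows (1, n) and (0, 1), then the factor
    eta on the second component. *)
Definition gauge (u : bool -> R -> R[i]) (j : bool) (x : R) : R[i] :=
  if j then iD * (u true x - tau * u false x) - n x * (iD * (u false x - tau * u true x))
  else eta * (iD * (u false x - tau * u true x)).

Definition ungauge (y : bool -> R -> R[i]) (j : bool) (x : R) : R[i] :=
  let w1 := y true x + n x * (eta^-1 * y false x) in
  let w2 := eta^-1 * y false x in
  if j then w1 + tau * w2 else tau * w1 + w2.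

Definition gauge_source (f : bool -> R -> R[i]) (j : bool) (x : R) : R[i] :=
  let w1 := iD * ('i%C * (f true x + tau * f false x)) in
  let w2 := iD * (- 'i%C * (f false x + tau * f true x)) in
  if j then w1 - n x * w2 else eta * w2.

(** What the constant conjugation adds to the potential: [rem1] on the diagonal,
    [rem2] off the diagonal.  Both contain a factor tau. *)
Definition rem1 x : R[i] := 'i%C * tau * iD *
  (v true false x + v false true x + tau * (v true true x + v false false x)).
Definition rem2 x : R[i] := 'i%C * tau * iD *
  (v true true x + v false false x + tau * (v true false x + v false true x)).
Definition lower x : R[i] := 'i%C * v false true x + rem2 x.

(** In the upper right entry, - 2 i k n is the function p which n was chosen to
    remove: only its difference with - i V12 remains. *)
Definition gauge_coef (j l : bool) (x : R) : R[i] :=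
  match j, l with
  | true, true => - rem1 x - n x * lower x
  | true, false => eta^-1 * (- 'i%C * v true false x - (- 2 * 'i%C * k * n x) - rem2 x - n' x
      - n x * ('i%C * v true true x + 'i%C * v false false x + 2 * rem1 x)
      - n x ^+ 2 * lower x)
  | false, true => eta * lower x
  | false, false => rem1 x + n x * lower x
  end.

Definition diag_coef (j : bool) : R[i] := if j then 'i%C * k else - 'i%C * k.
Definition diag_pot (j : bool) (x : R) : R[i] :=
  if j then - 'i%C * v true true x else 'i%C * v false false x.

Lemma ungaugeK u j x : ungauge (gauge u) j x = u j x.
Proof.
by rewrite /ungauge /gauge /iD; case: j; field; rewrite D0 eta0.
Qed.

(** With z and k expressed through tau this is an identity of rational functions
    of the values at x, of degree one in the imaginary unit. *)
Lemma gauge_cprim (f u : bool -> R -> R[i]) :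
  (forall j, cprim (u j) (dirac_rhs m z v f u j)) ->
  forall j, cprim (gauge u j)
    (fun x => (diag_coef j + diag_pot j x) * gauge u j x +
              source gauge_coef (gauge_source f) (gauge u) j x).
Proof.
move=> pu.
have pw1 := cprimZ iD (cprimB (pu true) (cprimZ tau (pu false))).
have pw2 := cprimZ iD (cprimB (pu false) (cprimZ tau (pu true))).
case.
  have := cprimB pw1 (cprimM pn pw2); congr cprim; apply/funext => x.
  rewrite /dirac_rhs /source /coupled /gauge /gauge_coef /gauge_source /diag_coef /diag_pot.
  rewrite /lower /rem1 /rem2 /iD zE kE.
  by field; rewrite eta0 D0 tau0.
have := cprimZ eta pw2; congr cprim; apply/funext => x.
rewrite /dirac_rhs /source /coupled /gauge /gauge_coef /gauge_source /diag_coef /diag_pot.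
rewrite /lower /rem1 /rem2 /iD zE kE.
by field; rewrite D0 tau0.
Qed.

Lemma ungauge_cprim (f y : bool -> R -> R[i]) :
  (forall j, cprim (y j) (fun x => (diag_coef j + diag_pot j x) * y j x +
              source gauge_coef (gauge_source f) y j x)) ->
  forall j, cprim (ungauge y j) (dirac_rhs m z v f (ungauge y) j).
Proof.
move=> py.
have pw2 := cprimZ eta^-1 (py false).
have pw1 := cprimD (py true) (cprimM pn pw2).
case.
  have := cprimD pw1 (cprimZ tau pw2); congr cprim; apply/funext => x.
  rewrite /dirac_rhs /source /coupled /ungauge /gauge_coef /gauge_source /diag_coef /diag_pot.
  rewrite /lower /rem1 /rem2 /iD zE kE.
  by field; rewrite eta0 D0 tau0.
have := cprimD (cprimZ tau pw1) pw2; congr cprim; apply/funext => x.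
rewrite /dirac_rhs /source /coupled /ungauge /gauge_coef /gauge_source /diag_coef /diag_pot.
rewrite /lower /rem1 /rem2 /iD zE kE.
by field; rewrite eta0 D0 tau0.
Qed.
End Gauge.

Section HighEnergy.
Context {R : realType}.
Local Notation mu := (@lebesgue_measure R).
Local Notation cmod := (@ComplexField.Normc.normc R).
Local Notation Re := (@complex.Re R).
Local Notation Im := (@complex.Im R).

(** tau is the root of m T^2 - 2 z T + m in the unit disc, the product of the two
    roots being 1.  A real k would make z^2 = k^2 + m^2 positive, and z real. *)
Lemma joukowski (m : R) (z : R[i]) : 0 < m -> Im z != 0 ->
  exists tau k : R[i], [/\ tau != 0, cmod tau <= 1, Im k != 0,
    [/\ z = m%:C%C * (1 + tau ^+ 2) / (2 * tau),
    k = m%:C%C * (1 - tau ^+ 2) / (2 * tau) & k = z - m%:C%C * tau] &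
    cmod tau * cmod z <= m].
Proof.
move=> m0 z0.
have mC : m%:C%C != 0 :> R[i] by apply/eqP => /(congr1 Re) /= /eqP; rewrite gt_eqF.
pose w := sqrtc (z ^+ 2 - m%:C%C ^+ 2).
have w2 : w ^+ 2 = z ^+ 2 - m%:C%C ^+ 2 by rewrite sqr_sqrtc.
have [k [k2 t1]] : exists k, k ^+ 2 = z ^+ 2 - m%:C%C ^+ 2 /\ cmod ((z - k) / m%:C%C) <= 1.
  have [h|h] := leP (cmod ((z - w) / m%:C%C)) 1; first by exists w.
  exists (- w); split; first by rewrite sqrrN.
  have e : (z - w) / m%:C%C * ((z - - w) / m%:C%C) = 1.
    have -> : (z - w) / m%:C%C * ((z - - w) / m%:C%C) = (z ^+ 2 - w ^+ 2) / m%:C%C ^+ 2.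
      by field.
    by rewrite w2 opprB addrC subrK divff// expf_neq0.
  move/(congr1 cmod): e; rewrite cmodM cmod1 => e.
  rewrite leNgt; apply/negP => h'.
  by have := mulr_egt1 h h'; rewrite e ltxx.
set tau := (z - k) / m%:C%C in t1.
have kE : k = z - m%:C%C * tau by rewrite /tau; field.
have tE : tau * ((z + k) / m%:C%C) = 1.
  have -> : tau * ((z + k) / m%:C%C) = (z ^+ 2 - k ^+ 2) / m%:C%C ^+ 2.
    by rewrite /tau; field.
  by rewrite k2 opprB addrC subrK divff// expf_neq0.
have tau0 : tau != 0 by apply/eqP => t0; move: tE; rewrite t0 mul0r => /eqP; rewrite eq_sym oner_eq0.
have qE : m%:C%C * (1 + tau ^+ 2) = 2 * tau * z.
  have : k ^+ 2 = z ^+ 2 - m%:C%C ^+ 2 by [].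
  rewrite kE => h; apply: (mulfI mC); apply/eqP; rewrite -subr_eq0.
  have -> : m%:C%C * (m%:C%C * (1 + tau ^+ 2)) - m%:C%C * (2 * tau * z) =
    (z - m%:C%C * tau) ^+ 2 - (z ^+ 2 - m%:C%C ^+ 2) by ring.
  by rewrite h subrr.
exists tau, k; split => //.
- apply/eqP => k0; have := congr1 Im k2; have := congr1 Re k2.
  rewrite !expr2 !(cReD, cReN, cReM, cImD, cImN, cImM, cReC, cImC) k0.
  rewrite !mulr0 !mul0r !addr0 !subr0 => e1 e2.
  have rz : Re z = 0.
    apply/eqP; rewrite -(mulIr_eq0 _ (mulIf z0)).
    by apply/eqP; lra.
  move: e1; rewrite rz mul0r => e1.
  have := sqr_ge0 (Re k); have := sqr_ge0 (Im z); rewrite !expr2; nra.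
- split => //; first by rewrite qE; field; rewrite tau0.
  rewrite kE; have -> : z = m%:C%C * (1 + tau ^+ 2) / (2 * tau) by rewrite qE; field; rewrite tau0.
  by field; rewrite tau0.
- have := congr1 cmod qE; rewrite !cmodM cmod_real gtr0_norm// => e.
  have c2 : cmod (2 : R[i]) = 2.
    by have := cmod_real (2 : R); rewrite rmorph_nat ger0_norm.
  have : cmod (1 + tau ^+ 2) <= 2.
    apply: le_trans (cmodD _ _) _; rewrite cmod1 expr2 cmodM.
    have := ler_pM (cmod_ge0 tau) (cmod_ge0 tau) t1 t1; lra.
  rewrite c2 in e; have := cmod_ge0 (1 + tau ^+ 2).
  move: e; set a := cmod (1 + _); set b := cmod tau; set c := cmod z => e a0 a2.
  have : m * a <= m * 2 by rewrite ler_pM2l.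
  rewrite e; lra.
Qed.

Lemma kint_pair (kap c : R) (g f1 f2 : R -> R[i]) (M x : R) : 0 <= c ->
  cmeas g -> cmeas f1 -> cmeas f2 ->
  (forall t, cmod (g t) <= c * (cmod (f1 t) + cmod (f2 t))) ->
  (kint kap f1 x <= M%:E)%E -> (kint kap f2 x <= M%:E)%E ->
  (kint kap g x <= (2 * c * M)%:E)%E.
Proof.
move=> c0 mg m1 m2 h h1 h2.
have p (f : R -> R[i]) t : (0 <= (expR (- kap * `|x - t|) * cmod (f t))%:E)%E.
  by rewrite lee_fin mulr_ge0 ?expR_ge0 ?cmod_ge0.
have mE (f : R -> R[i]) : cmeas f ->
    measurable_fun setT (fun t : R => (expR (- kap * `|x - t|) * cmod (f t))%:E).
  by move=> mf; apply/measurable_EFinP; exact: measurable_kint.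
have e : (c%:E * (kint kap f1 x + kint kap f2 x) <= (2 * c * M)%:E)%E.
  have -> : ((2 * c * M)%:E = c%:E * (M%:E + M%:E))%E.
    by rewrite -EFinD -EFinM; congr EFin; ring.
  by rewrite lee_wpmul2l ?lee_fin// leeD.
apply: le_trans e.
rewrite /kint -ge0_integralD//; try exact: mE.
rewrite -ge0_integralZl//; last 2 first.
- by apply: emeasurable_funD; exact: mE.
- by move=> t _; rewrite adde_ge0.
apply: ge0_le_integral => //.
- exact: mE.
- by apply: emeasurable_funM => //; apply: emeasurable_funD; exact: mE.
- move=> t _; rewrite -EFinD -EFinM lee_fin -mulrDr mulrCA ler_wpM2l ?expR_ge0//.
Qed.

Lemma integral_rho_le (g : R -> R) (s c I : R) : 0 <= c ->
  measurable_fun setT g -> (\int[mu]_t (rho s t)%:E = I%:E)%E ->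
  (forall t, 0 <= g t) ->
  (forall t, g t <= c * rho s t) -> (\int[mu]_t (g t)%:E <= (c * I)%:E)%E.
Proof.
move=> c0 mg hI g0 h.
have mr : measurable_fun setT (fun t => (rho s t)%:E).
  by apply/measurable_EFinP; exact: measurable_rho.
have r0 t : (0 <= (rho s t)%:E)%E by rewrite lee_fin ltW ?rho_gt0.
rewrite EFinM -hI -ge0_integralZl//.
apply: ge0_le_integral => //.
- by move=> t _; rewrite lee_fin.
- exact/measurable_EFinP.
- exact: emeasurable_funM.
- by move=> t _; rewrite -EFinM lee_fin.
Qed.

End HighEnergy.

Section HighEnergyThm.
Context {R : realType}.
Local Notation mu := (@lebesgue_measure R).
Local Notation cmod := (@ComplexField.Normc.normc R).
Local Notation Re := (@complex.Re R).
Local Notation Im := (@complex.Im R).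

Lemma cmod_leD (z w : R[i]) (a b : R) : cmod z <= a -> cmod w <= b -> cmod (z + w) <= a + b.
Proof. by move=> h1 h2; apply: le_trans (cmodD _ _) (lerD h1 h2). Qed.

Lemma cmod_leB (z w : R[i]) (a b : R) : cmod z <= a -> cmod w <= b -> cmod (z - w) <= a + b.
Proof. by move=> h1 h2; apply: le_trans (cmodB _ _) (lerD h1 h2). Qed.

Lemma cmod_leM (z w : R[i]) (a b : R) : cmod z <= a -> cmod w <= b -> cmod (z * w) <= a * b.
Proof. by move=> h1 h2; rewrite cmodM ler_pM ?cmod_ge0. Qed.

Section Coefficients.
Variables (tau k : R[i]) (eta : R) (v : bool -> bool -> R -> R[i]) (n n' : R -> R[i]).
Variables (X w : R) (x : R).
Hypothesis vX : forall j l, cmod (v j l x) <= X.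
Hypothesis (tw : cmod tau <= w) (w2 : w <= 1 / 2) (nw : cmod (n x) <= w).

Let X0 : 0 <= X. Proof. exact: le_trans (cmod_ge0 _) (vX true true). Qed.
Let w0 : 0 <= w. Proof. exact: le_trans (cmod_ge0 _) tw. Qed.
Let wX : 0 <= w * X. Proof. exact: mulr_ge0. Qed.
Let wwX : w * (w * X) <= 1 / 2 * (w * X). Proof. by rewrite ler_wpM2r. Qed.

Let tau2 : cmod (tau ^+ 2) = cmod tau * cmod tau.
Proof. by rewrite expr2 cmodM. Qed.

Lemma cmod_det : cmod (1 - tau ^+ 2)^-1 <= 2.
Proof.
rewrite cmodV.
have h : 1 / 2 <= cmod (1 - tau ^+ 2).
  have := cmodD (1 - tau ^+ 2) (tau ^+ 2); rewrite subrK cmod1 tau2.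
  have := ler_pM (cmod_ge0 _) (cmod_ge0 _) (le_trans tw w2) (le_trans tw w2); lra.
rewrite -[leRHS]invrK lef_pV2 ?posrE ?invr_gt0//; lra.
Qed.

Lemma det_neq0 : 1 - tau ^+ 2 != 0.
Proof.
apply/eqP => /(congr1 cmod); rewrite cmod0 => h.
have := cmodD (1 - tau ^+ 2) (tau ^+ 2); rewrite subrK cmod1 tau2 h.
have := ler_pM (cmod_ge0 _) (cmod_ge0 _) (le_trans tw w2) (le_trans tw w2); lra.
Qed.

Let cross (a b c d : R[i]) : cmod a <= X -> cmod b <= X -> cmod c <= X -> cmod d <= X ->
  cmod ('i%C * tau * (1 - tau ^+ 2)^-1 * (a + b + tau * (c + d))) <= 6 * w * X.
Proof.
move=> ha hb hc hd.
have := cmod_leM (cmod_leM (cmod_leM (lexx (cmod 'i%C)) tw) cmod_det)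
  (cmod_leD (cmod_leD ha hb) (cmod_leM tw (cmod_leD hc hd))).
rewrite cmod_i => h; apply: le_trans h _.
have -> : 1 * w * 2 * (X + X + w * (X + X)) = 4 * (w * X) + 4 * (w * (w * X)) by ring.
have := wwX; lra.
Qed.

Lemma cmod_rem1 : cmod (rem1 tau v x) <= 6 * w * X.
Proof. exact: cross. Qed.

Lemma cmod_rem2 : cmod (rem2 tau v x) <= 6 * w * X.
Proof. exact: cross. Qed.

Lemma cmod_lower : cmod (lower tau v x) <= 4 * X.
Proof.
have := cmod_leD (cmod_leM (lexx (cmod 'i%C)) (vX false true)) cmod_rem2.
rewrite cmod_i => h; apply: le_trans h _; have := ler_wpM2r X0 w2; lra.
Qed.

Lemma cmod_coef_diag j : cmod (gauge_coef tau k eta%:C%C v n n' j j x) <= 10 * w * X.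
Proof.
have h : cmod (rem1 tau v x + n x * lower tau v x) <= 10 * w * X.
  apply: le_trans (cmod_leD cmod_rem1 (cmod_leM nw cmod_lower)) _; lra.
by case: j => //; rewrite /gauge_coef -opprD cmodN.
Qed.

Lemma cmod_coef_lower : cmod (gauge_coef tau k eta%:C%C v n n' false true x) <= `|eta| * (4 * X).
Proof. by apply: cmod_leM cmod_lower; rewrite cmod_real. Qed.

Lemma cmod_coef_upper (p : R -> R[i]) (A : R) : 0 < eta -> p x = - 2 * 'i%C * k * n x ->
  cmod (n' x) <= A ->
  cmod (gauge_coef tau k eta%:C%C v n n' true false x) <=
    eta^-1 * (cmod (- 'i%C * v true false x - p x) + (A + 16 * w * X)).
Proof.
move=> e0 pE nA.
have iX j : cmod ('i%C * v j j x) <= X by rewrite cmodM cmod_i mul1r.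
have c2 : cmod (2 : R[i]) = 2 by have := cmod_real (2 : R); rewrite rmorph_nat ger0_norm.
have hn2 : cmod (n x ^+ 2) <= w * w by rewrite expr2; exact: cmod_leM.
have h2r : cmod (2 * rem1 tau v x) <= 2 * (6 * w * X).
  by apply: cmod_leM cmod_rem1; rewrite c2.
rewrite /gauge_coef -pE; apply: cmod_leM; first by rewrite cmodV cmod_real gtr0_norm.
apply: le_trans (cmod_leB (cmod_leB (cmod_leB (cmod_leB (lexx _) cmod_rem2) nA)
  (cmod_leM nw (cmod_leD (cmod_leD (iX true) (iX false)) h2r))) (cmod_leM hn2 cmod_lower)) _.
(* 16 = 6 + 2 + 12 / 2 + 4 / 2, using w <= 1 / 2 *)
have -> : w * (X + X + 2 * (6 * w * X)) = 2 * (w * X) + 12 * (w * (w * X)) by ring.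
have -> : w * w * (4 * X) = 4 * (w * (w * X)) by ring.
have := wwX; lra.
Qed.

Lemma cmod_gauge_source (f : bool -> R -> R[i]) j : 0 < eta <= 1 ->
  cmod (gauge_source tau eta%:C%C n f j x) <= 4 * (cmod (f true x) + cmod (f false x)).
Proof.
move=> /andP[e0 e1]; pose S := cmod (f true x) + cmod (f false x).
have S0 : 0 <= S by rewrite addr_ge0 ?cmod_ge0.
have t1 : cmod tau <= 1 by apply: le_trans tw (le_trans w2 _); lra.
have h1 : cmod ((1 - tau ^+ 2)^-1 * ('i%C * (f true x + tau * f false x))) <= 2 * (1 * (cmod (f true x) + 1 * cmod (f false x))).
  apply: cmod_leM cmod_det _; apply: cmod_leM; first by rewrite cmod_i.
  by apply: cmod_leD => //; exact: cmod_leM.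
have h2 : cmod ((1 - tau ^+ 2)^-1 * (- 'i%C * (f false x + tau * f true x))) <= 2 * (1 * (cmod (f false x) + 1 * cmod (f true x))).
  apply: cmod_leM cmod_det _; apply: cmod_leM; first by rewrite cmodN cmod_i.
  by apply: cmod_leD => //; exact: cmod_leM.
rewrite !mul1r -/S in h1; rewrite !mul1r [cmod (f false x) + _]addrC -/S in h2.
rewrite /gauge_source -/S; case: j.
  apply: le_trans (cmod_leB h1 (cmod_leM nw h2)) _.
  have := ler_wpM2r S0 w2; lra.
apply: le_trans (cmod_leM (a := 1) _ h2) _; last lra.
by rewrite cmod_real gtr0_norm.
Qed.

Lemma cmod_ungauge (y : bool -> R -> R[i]) (Y : R) j : 0 < eta ->
  (forall j, cmod (y j x) <= Y) ->
  cmod (ungauge tau eta%:C%C n y j x) <= (1 + 2 / eta) * Y.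
Proof.
move=> e0 yY; have Y0 : 0 <= Y by exact: le_trans (cmod_ge0 _) (yY true).
have eV : cmod (eta%:C%C^-1) <= eta^-1 by rewrite cmodV cmod_real gtr0_norm.
have h2 := cmod_leM eV (yY false).
have h1 := cmod_leD (yY true) (cmod_leM (le_trans nw w2) h2).
have Z0 : 0 <= eta^-1 * Y by rewrite mulr_ge0// invr_ge0 ltW.
have -> : (1 + 2 / eta) * Y = Y + 2 * (eta^-1 * Y) by ring.
rewrite /ungauge; case: j.
  by apply: le_trans (cmod_leD h1 (cmod_leM (le_trans tw w2) h2)) _; lra.
by apply: le_trans (cmod_leD (cmod_leM (le_trans tw w2) h1) h2) _; lra.
Qed.

Lemma cmod_gauge (u : bool -> R -> R[i]) (U : R) j : 0 < eta <= 1 ->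
  (forall j, cmod (u j x) <= U) -> cmod (gauge tau eta%:C%C n u j x) <= 8 * U.
Proof.
move=> /andP[e0 e1] uU; have U0 : 0 <= U by exact: le_trans (cmod_ge0 _) (uU true).
have t1 : cmod tau <= 1 by apply: le_trans tw (le_trans w2 _); lra.
have h1 := cmod_leM cmod_det (cmod_leB (uU true) (cmod_leM t1 (uU false))).
have h2 := cmod_leM cmod_det (cmod_leB (uU false) (cmod_leM t1 (uU true))).
rewrite /gauge; case: j.
  by apply: le_trans (cmod_leB h1 (cmod_leM (le_trans nw w2) h2)) _; lra.
apply: le_trans (cmod_leM (a := 1) _ h2) _; last lra.
by rewrite cmod_real gtr0_norm.
Qed.

End Coefficients.

Lemma integral_pair_le (g g1 g2 : R -> R) (c A B : R) : 0 <= c ->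
  measurable_fun setT g -> measurable_fun setT g1 -> measurable_fun setT g2 ->
  (forall t, 0 <= g t) -> (forall t, 0 <= g1 t) -> (forall t, 0 <= g2 t) ->
  (forall t, g t <= c * (g1 t + g2 t)) ->
  (\int[mu]_t (g1 t)%:E <= A%:E)%E -> (\int[mu]_t (g2 t)%:E <= B%:E)%E ->
  (\int[mu]_t (g t)%:E <= (c * (A + B))%:E)%E.
Proof.
move=> c0 mg m1 m2 p p1 p2 h h1 h2.
apply: (@le_trans _ _ (c%:E * (\int[mu]_t (g1 t)%:E + \int[mu]_t (g2 t)%:E))%E); last first.
  by rewrite EFinM EFinD lee_wpmul2l ?lee_fin// leeD.
have n1 : measurable_fun setT (fun t => (g1 t)%:E) by exact/measurable_EFinP.
have n2 : measurable_fun setT (fun t => (g2 t)%:E) by exact/measurable_EFinP.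
have q1 t : setT t -> (0 <= (g1 t)%:E)%E by rewrite lee_fin.
have q2 t : setT t -> (0 <= (g2 t)%:E)%E by rewrite lee_fin.
rewrite -ge0_integralD// -ge0_integralZl//; last 2 first.
- exact: emeasurable_funD.
- by move=> t _; rewrite adde_ge0// lee_fin.
apply: ge0_le_integral => //.
- by move=> t _; rewrite lee_fin.
- exact/measurable_EFinP.
- by apply: emeasurable_funM => //; exact: emeasurable_funD.
- by move=> t _; rewrite -EFinD -EFinM lee_fin.
Qed.
End HighEnergyThm.

(** * The uniform estimate at high energy *)

Section HighEnergyThm.
Context {R : realType}.
Local Notation mu := (@lebesgue_measure R).
Local Notation cmod := (@ComplexField.Normc.normc R).
Local Notation Re := (@complex.Re R).
Local Notation Im := (@complex.Im R).

(** Both the disc and the constant depend on V and m only.  The decay rate kap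
    is |Im k| and depends on z, but the sizes of the propagators and of the
    coupling terms do not. *)
Theorem high_energy (m s C0 : R) (v : bool -> bool -> R -> R[i]) :
  0 < m -> 1 < s -> (forall j l, ccont (v j l)) ->
  (forall j l x, cmod (v j l x) <= C0 * rho s x) ->
  exists Lam Cst : R, 0 <= Cst /\ forall z : R[i], Im z != 0 -> Lam <= cmod z ->
    exists2 kap : R, 0 < kap & forall (f : bool -> R -> R[i]) (M : R),
      (forall j, cmeas (f j)) -> (forall j x, kint kap (f j) x <= M%:E)%E ->
      (exists u, (forall j, cprim (u j) (dirac_rhs m%:C%C z v f u j)) /\
         forall j x, cmod (u j x) <= Cst * M) /\
      (forall u, (exists U, forall j x, cmod (u j x) <= U) ->
         (forall j, cprim (u j) (dirac_rhs m%:C%C z v f u j)) ->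
         forall j x, cmod (u j x) <= Cst * M).
Proof.
move=> m0 s1 cv vC.
have s0 : 0 <= s by exact: le_trans (ltW s1).
have C00 : 0 <= C0.
  have := le_trans (cmod_ge0 _) (vC true true 0); rewrite pmulr_lge0//; exact: rho_gt0.
have r0 x : 0 <= rho s x by rewrite ltW ?rho_gt0.
have r1 x : rho s x <= 1 by exact: rho_le1.
have mr := measurable_rho s.
have [I I0 hI] := integral_rho s1.
have CI0 : 0 <= C0 * I by exact: mulr_ge0.
have mv j l : cmeas (v j l) by exact: ccont_cmeas.
pose K := expR (2 * (C0 * I)).
have K0 : 0 < K by exact: expR_gt0.
(* the largest size of the coupling allowed by the contraction argument *)
pose eps := (8 * K)^-1.
have eps0 : 0 < eps by rewrite invr_gt0 mulr_gt0.
have Keps : 8 * K * eps <= 1 by rewrite /eps divff// gt_eqF// mulr_gt0.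
(* eta makes the lower entry, bounded by 4 C0 rho, smaller than eps; it is also
   at most 1 *)
pose eta := eps / (4 * (C0 * I) + 1 + eps).
have den0 : 0 < 4 * (C0 * I) + 1 + eps by lra.
have eta0 : 0 < eta by rewrite divr_gt0.
have etaE : eta * (4 * (C0 * I) + 1 + eps) = eps by rewrite /eta divfK// gt_eqF.
have eta1 : eta <= 1 by rewrite ler_pdivrMr// mul1r; lra.
have etaC : eta * (4 * (C0 * I)) <= eps.
  by rewrite -[leRHS]etaE ler_wpM2l ?ltW//; lra.
have ee0 : 0 < eps * eta by exact: mulr_gt0.
(* the upper entry is divided by eta: its non-smooth part may take eps eta / 2,
   and w B below is at most eps eta / 4 *)
pose q x := - 'i%C * v true false x.
have cq : ccont q by exact: ccontZ.
have qC x : cmod (q x) <= C0 * rho s x by rewrite /q cmodM cmodN cmod_i mul1r.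
have [p [p' [C' [pp cp' pC' p'C' qp]]]] := mollify cq s1 qC (divr_gt0 ee0 (ltr0Sn R 1)).
have C'0 : 0 <= C'.
  have := le_trans (cmod_ge0 _) (pC' 0); rewrite pmulr_lge0//; exact: rho_gt0.
pose B := (16 * C0 + 1) * I + 1.
have B1 : 1 <= B by rewrite /B lerDr mulr_ge0// addr_ge0// mulr_ge0.
have B0 : 0 < B by exact: lt_le_trans B1.
(* w bounds both tau and n once z is large *)
pose w := Num.min (1 / 2) (eps * eta / (4 * B)).
have w0 : 0 < w.
  rewrite lt_min; apply/andP; split; first by lra.
  by rewrite divr_gt0// mulr_gt0.
have w2 : w <= 1 / 2 by rewrite ge_min lexx.
have wB : w * B <= eps * eta / 4.
  have : w <= eps * eta / (4 * B) by rewrite ge_min lexx orbT.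
  move=> /(ler_wpM2r (ltW B0)) h; apply: le_trans h _.
  by rewrite le_eqVlt; apply/orP; left; apply/eqP; field; rewrite gt_eqF.
have wCI0 : 0 <= w * (C0 * I) by rewrite mulr_ge0// ltW.
have wI0 : 0 <= w * I by rewrite mulr_ge0// ltW.
have wCI : 10 * w * C0 * I <= eps.
  have h1 : eps * eta <= eps by rewrite ler_piMr// ltW.
  move: wB; rewrite /B => wB; lra.
(* m / w gives |tau| <= w; as |k| >= |z| - m, C' / w gives |n| <= w *)
exists (m / w + m + C' / w), ((1 + 2 / eta) * (32 * K)); split.
  by rewrite !mulr_ge0 ?addr_ge0 ?divr_ge0 ?ltW.
move=> z z0 zL.
have [tau [k [tau0 tau1 k0 [zE kE kz] tz]]] := joukowski m0 z0.
have tw : cmod tau <= w.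
  have : cmod tau * (m / w) <= m.
    apply: le_trans tz; rewrite ler_wpM2l ?cmod_ge0//; apply: le_trans zL.
    by rewrite -addrA lerDl addr_ge0 ?divr_ge0// ltW.
  by rewrite mulrCA ger_pMr// ler_pdivrMr// mul1r.
have kL : C' <= cmod k * w.
  rewrite -ler_pdivrMr//.
  have h : cmod z <= cmod k + m.
    have -> : z = k + m%:C%C * tau by rewrite kz subrK.
    apply: le_trans (cmodD _ _) _; rewrite lerD2l cmodM cmod_real gtr0_norm//.
    by rewrite ger_pMr.
  have : 0 <= m / w by rewrite divr_ge0 ?ltW.
  lra.
have kn0 : k != 0 by apply/eqP => e; move: k0; rewrite e eqxx.
have kc0 : 0 < cmod k by exact: cmod_gt0.
exists `|Im k|; first by rewrite normr_gt0.
pose cn : R[i] := - (2 * 'i%C * k)^-1.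
have i0 : ('i%C : R[i]) != 0 by apply/eqP => /(congr1 cmod); rewrite cmod_i cmod0 => /eqP; rewrite oner_eq0.
have two0 : (2 : R[i]) != 0 by rewrite pnatr_eq0.
have c2 : cmod (2 : R[i]) = 2 by have := cmod_real (2 : R); rewrite rmorph_nat ger0_norm.
have cnE : cmod cn * C' <= w.
  rewrite /cn cmodN cmodV !cmodM cmod_i mulr1 c2 mulrC ler_pdivrMr ?mulr_gt0//.
  apply: le_trans kL _; rewrite mulrC ler_wpM2l ?(ltW w0)//; lra.
pose n x := cn * p x.
pose n' x := cn * p' x.
have pn : cprim n n' by exact: cprimZ.
have bound_cn (g : R -> R[i]) : (forall x, cmod (g x) <= C' * rho s x) ->
    forall x, cmod (cn * g x) <= w * rho s x.
  move=> gC x; rewrite cmodM; apply: le_trans (ler_wpM2l (cmod_ge0 _) (gC x)) _.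
  by rewrite mulrA ler_wpM2r.
have nr x : cmod (n x) <= w * rho s x by exact: bound_cn.
have n'r x : cmod (n' x) <= w * rho s x by exact: bound_cn.
have nw x : cmod (n x) <= w by apply: le_trans (nr x) _; rewrite ler_piMr// ltW.
have pE x : p x = - 2 * 'i%C * k * n x.
  by rewrite /n /cn; field; rewrite kn0 i0.
have D0 := det_neq0 tw w2.
have etaC0 : (eta%:C%C : R[i]) != 0 by apply/eqP => /(congr1 Re) /= /eqP; rewrite gt_eqF.
have cn_ : ccont n := cprim_ccont pn.
have cn' : ccont n' by exact: ccontZ.
have crem1 : ccont (rem1 tau v).
  by apply: ccontZ; apply: ccontD; [exact: ccontD|apply: ccontZ; exact: ccontD].
have crem2 : ccont (rem2 tau v).
  by apply: ccontZ; apply: ccontD; [exact: ccontD|apply: ccontZ; exact: ccontD].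
have clow : ccont (lower tau v) by apply: ccontD => //; exact: ccontZ.
have mn := ccont_cmeas cn_; have mn' := ccont_cmeas cn'.
have mrem1 := ccont_cmeas crem1; have mrem2 := ccont_cmeas crem2.
have mlow := ccont_cmeas clow.
pose e := gauge_coef tau k eta%:C%C v n n'.
have me j l : cmeas (e j l).
  case: j; case: l; rewrite /e /gauge_coef.
  - apply: cmeasB; [exact: cmeasN|exact: cmeasM].
  - apply: cmeasZ; apply: cmeasB; last first.
      apply: cmeasM => //; rewrite (_ : (fun x => n x ^+ 2) = fun x => n x * n x); first exact: cmeasM.
      by apply/funext => x; rewrite expr2.
    apply: cmeasB; last first.
      apply: cmeasM => //; apply: cmeasD; last exact: cmeasZ.
      by apply: cmeasD; exact: cmeasZ.
    apply: cmeasB => //; apply: cmeasB => //; apply: cmeasB; exact: cmeasZ.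
  - exact: cmeasZ.
  - apply: cmeasD => //; exact: cmeasM.
have vX x j l : cmod (v j l x) <= C0 * rho s x by exact: vC.
have int_e j l : (\int[mu]_t (cmod (e j l t))%:E <= eps%:E)%E.
  have [jl|jl] := eqVneq j l.
    subst l; apply: (@le_trans _ _ ((10 * w * C0) * I)%:E); last by rewrite lee_fin.
    apply: (integral_rho_le (s := s)) => //.
    - by rewrite !mulr_ge0// ltW.
    - exact: measurable_cmod.
    - by move=> t; exact: cmod_ge0.
    - by move=> t; have := cmod_coef_diag k eta n' (vX t) tw w2 (nw t) j; rewrite mulrA.
  case: j jl; case: l => // _.
    apply: (@le_trans _ _ (eta^-1 * (eps * eta / 2 + (w * (16 * C0 + 1)) * I))%:E).
      apply: (@integral_pair_le R _ (fun t => cmod (q t - p t)) (fun t => (w * (16 * C0 + 1)) * rho s t)) => //.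
      - by rewrite invr_ge0 ltW.
      - exact: measurable_cmod.
      - apply: measurable_cmod; apply: cmeasB; apply: ccont_cmeas => //; exact: cprim_ccont pp.
      - exact: measurable_funM.
      - by move=> t; exact: cmod_ge0.
      - by move=> t; exact: cmod_ge0.
      - by move=> t; apply: mulr_ge0 => //; apply: mulr_ge0; [exact: ltW|rewrite addr_ge0// mulr_ge0].
      - move=> t; apply: le_trans (cmod_coef_upper (vX t) tw w2 (nw t) eta0 (pE t) (n'r t)) _.
        rewrite ler_wpM2l ?invr_ge0 ?(ltW eta0)// lerD2l le_eqVlt; apply/orP; left; apply/eqP; ring.
      - apply: (integral_rho_le (s := s)) => //.
        + by rewrite mulr_ge0 ?(ltW w0)// addr_ge0// mulr_ge0.
        + exact: measurable_funM.
        + by move=> t; rewrite !mulr_ge0// ?addr_ge0 ?mulr_ge0// ltW.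
    rewrite lee_fin mulrC ler_pdivrMr//.
    move: wB; rewrite /B => wB; have := ltW w0; lra.
  apply: (@le_trans _ _ ((eta * (4 * C0)) * I)%:E); last first.
    rewrite lee_fin; apply: le_trans etaC; rewrite le_eqVlt; apply/orP; left; apply/eqP; ring.
  apply: (integral_rho_le (s := s)) => //.
  - by apply: mulr_ge0; [exact: ltW|exact: mulr_ge0].
  - exact: measurable_cmod.
  - by move=> t; exact: cmod_ge0.
  - move=> t; have h := cmod_coef_lower k eta n n' (vX t) tw w2.
    by rewrite (gtr0_norm eta0) in h; apply: le_trans h _; rewrite !mulrA.
(* Re (+- i k) has modulus |Im k|, and the two signs are opposite: one component
   is integrated from the left and the other from the right *)
have prop j : exists E Ei : R -> R[i],
    [/\ cprim E (fun x => (diag_coef k j + diag_pot v j x) * E x),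
        cprim Ei (fun x => - (diag_coef k j + diag_pot v j x) * Ei x),
        forall x, E x * Ei x = 1 &
        forall x t, half (Re (diag_coef k j) < 0) x t ->
          cmod (E x * Ei t) <= K * expR (- `|Im k| * `|x - t|)].
  have cd : ccont (diag_pot v j) by case: j; exact: ccontZ.
  have hd : (\int[mu]_t (cmod (diag_pot v j t))%:E <= (C0 * I)%:E)%E.
    apply: (integral_rho_le (s := s)) => //.
    - by apply: measurable_cmod; exact: ccont_cmeas.
    - by move=> t; exact: cmod_ge0.
    - by move=> t; case: j {cd} => /=; rewrite cmodM ?cmodN cmod_i mul1r.
  have [E [Ei [h1 h2 h3 h4]]] := propagator (diag_coef k j) cd hd.
  exists E, Ei; split => // x t /h4.
  have -> // : `|Re (diag_coef k j)| = `|Im k|.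
  by case: (j) => /=; rewrite cReM /= ?mul0r ?mul1r ?oppr0 ?mulN1r ?mul0r ?sub0r ?opprK ?normrN.
have [E /choice[Ei hEEi]] := choice prop.
have hE j := let: And4 h _ _ _ := hEEi j in h.
have hEi j := let: And4 _ h _ _ := hEEi j in h.
have EEi j := let: And4 _ _ h _ := hEEi j in h.
have hK j := let: And4 _ _ _ h := hEEi j in h.
move=> f M mf fM.
have kap0 : 0 < `|Im k| by rewrite normr_gt0.
pose F := gauge_source tau eta%:C%C n f.
have mF j : cmeas (F j).
  have a1 : cmeas (fun x => (1 - tau ^+ 2)^-1 * ('i%C * (f true x + tau * f false x))).
    by apply: cmeasZ; apply: cmeasZ; apply: cmeasD => //; exact: cmeasZ.
  have a2 : cmeas (fun x => (1 - tau ^+ 2)^-1 * (- 'i%C * (f false x + tau * f true x))).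
    by apply: cmeasZ; apply: cmeasZ; apply: cmeasD => //; exact: cmeasZ.
  case: j; first by apply: cmeasB => //; exact: cmeasM.
  exact: cmeasZ.
have etaP : 0 < eta <= 1 by rewrite eta0.
have FM j x : (kint `|Im k| (F j) x <= (8 * M)%:E)%E.
  have -> : 8 * M = 2 * 4 * M by ring.
  apply: (kint_pair _ (mF j) (mf true) (mf false)) => //.
  by move=> t; exact: (cmod_gauge_source tw w2 (nw t) f j etaP).
have CE : (1 + 2 / eta) * (32 * K) * M = (1 + 2 / eta) * (4 * K * (8 * M)) by ring.
rewrite CE; split.
  have [y [py yM]] := system_solution hE hEi EEi (ltW K0) kap0 hK me int_e Keps mF FM.
  exists (ungauge tau eta%:C%C n y); split.
    exact: (ungauge_cprim tau0 D0 etaC0 zE kE pn py).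
  by move=> j x; apply: (cmod_ungauge tw w2 (nw x)) => // l; exact: yM.
move=> u [U uU] pu j x.
have py := gauge_cprim tau0 D0 etaC0 zE kE pn pu.
have yM := system_apriori hE hEi EEi (ltW K0) kap0 hK me int_e Keps mF FM _ py.
rewrite -(ungaugeK n D0 etaC0 u); apply: (cmod_ungauge tw w2 (nw x)) => // l; apply: yM.
by exists (8 * U) => j' x'; apply: (cmod_gauge tw w2 (nw x')).
Qed.
End HighEnergyThm.

(** * The energy identity *)

Section Energy.
Context {R : realType}.
Local Notation mu := (@lebesgue_measure R).
Local Notation cmod := (@ComplexField.Normc.normc R).
Local Notation Re := (@complex.Re R).
Local Notation Im := (@complex.Im R).
Local Notation integ D f := (mu.-integrable D (EFin \o f)).

Lemma Lnorm2_le (h : R -> R) (A : R) : 0 <= A ->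
  (Lnorm mu 2%:E (fun x => (h x)%:E) <= A%:E)%E <->
  (\int[mu]_x (h x ^+ 2)%:E <= (A ^+ 2)%:E)%E.
Proof.
move=> A0.
have e : (\int[mu]_x (h x ^+ 2)%:E = Lnorm mu 2%:E (fun x => (h x)%:E) `^ 2)%E.
  rewrite poweR_Lnorm ?pnatr_eq0//; apply: eq_integral => x _.
  by rewrite /= powR_mulrn// real_normK// num_real.
have A2 : ((A ^+ 2)%:E = (A%:E) `^ 2)%E by rewrite poweR_EFin powR_mulrn.
rewrite e A2; split=> h1.
  by apply: gt0_ler_poweR => //; rewrite ?in_itv /= ?leey ?andbT ?Lnorm_ge0 ?lee_fin.
have pos (y : \bar R) : (0 <= y)%E -> ((y `^ 2) `^ 2^-1 = y)%E.
  by move=> y0; rewrite -poweRrM divff ?pnatr_eq0// poweRe1.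
rewrite -(pos _ (Lnorm_ge0 _ _ _)) -(pos A%:E) ?lee_fin//.
by apply: gt0_ler_poweR => //; rewrite ?invr_ge0// in_itv /= leey andbT; [exact: poweR_ge0|rewrite lee_fin; exact: powR_ge0].
Qed.

Lemma integral_le_segments (P : R -> R) (B : R) : measurable_fun setT P ->
  (forall x, 0 <= P x) -> (forall a : R, (0 <= a)%R -> (\int[mu]_(x in `[(- a)%R, a]) (P x)%:E <= B%:E)%E) ->
  (\int[mu]_x (P x)%:E <= B%:E)%E.
Proof.
move=> mP P0 hB.
have mPE : measurable_fun setT (fun x => (P x)%:E) by exact/measurable_EFinP.
pose F (n : nat) : set R := `[- n%:R, n%:R]%classic.
have Fs : \bigcup_n F n = setT by exact: bigcup_itvT.
have cv : (\int[mu]_(x in F i) (P x)%:E)%E @[i --> \oo] --> (\int[mu]_(x in \bigcup_n F n) (P x)%:E)%E.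
  apply: ge0_nondecreasing_set_cvg_integral.
  - move=> i j ij; rewrite subsetEset => x; rewrite /F /= !in_itv /= => /andP[h1 h2].
    have : (i%:R : R) <= j%:R by rewrite ler_nat.
    by move=> h3; apply/andP; split; lra.
  - by move=> i; exact: measurable_itv.
  - by move=> i; apply: measurable_funTS.
  - by move=> i x _; rewrite lee_fin.
rewrite -Fs -(cvg_lim _ cv)//.
by apply: lime_le; [apply/cvg_ex; eexists; exact: cv|apply: nearW => n; exact: hB].
Qed.

Lemma prim_cmod_sqr (u u' : R -> R[i]) : cprim u u' ->
  prim (fun x => cmod (u x) ^+ 2)
       (fun x => 2 * (Re (u x) * Re (u' x) + Im (u x) * Im (u' x))).
Proof.
move=> [p1 p2]; have := primD (primM p1 p1) (primM p2 p2); congr prim; apply/funext => x /=.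
  by rewrite cmod_sqr !expr2.
ring.
Qed.

Lemma Re_conjM_le (z w : R[i]) : `|Re z * Re w + Im z * Im w| <= cmod z * cmod w.
Proof.
have := Re_le_cmod (Complex (Re z) (- Im z) * w); rewrite cReM /= cmodM.
have -> : cmod (Complex (Re z) (- Im z)) = cmod z by rewrite !cmodE /= sqrrN.
by rewrite mulNr opprK.
Qed.

Lemma Im_conjM_le (z w : R[i]) : `|Re z * Im w - Im z * Re w| <= cmod z * cmod w.
Proof.
have := Im_le_cmod (Complex (Re z) (- Im z) * w); rewrite cImM /= cmodM.
have -> : cmod (Complex (Re z) (- Im z)) = cmod z by rewrite !cmodE /= sqrrN.
by rewrite mulNr.
Qed.

(** The derivative of |u|^2 is at most |u|^2 + |u'|^2, which is integrable. *)
Lemma H1_bounded (u u' : R -> R[i]) (A : R) : cprim u u' ->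
  (\int[mu]_x (cmod (u x) ^+ 2)%:E <= A%:E)%E ->
  (\int[mu]_x (cmod (u' x) ^+ 2)%:E <= A%:E)%E ->
  exists U, forall x, cmod (u x) <= U.
Proof.
move=> pu hA hA'.
have mu_ := ccont_cmeas (cprim_ccont pu); have mu' := cprim_cmeas pu.
have pq := prim_cmod_sqr pu.
pose P x := cmod (u x) ^+ 2 + cmod (u' x) ^+ 2.
have P0 x : 0 <= P x by rewrite addr_ge0 ?sqr_ge0.
have m1 : measurable_fun setT (fun x => cmod (u x) ^+ 2).
  by apply: measurable_funX; exact: measurable_cmod.
have m2 : measurable_fun setT (fun x => cmod (u' x) ^+ 2).
  by apply: measurable_funX; exact: measurable_cmod.
have mP : measurable_fun setT P by exact: measurable_funD.
have PA : (\int[mu]_x (P x)%:E <= (1 * (A + A))%:E)%E.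
  apply: (integral_pair_le _ mP m1 m2) => // t; rewrite ?sqr_ge0//.
  by rewrite mul1r.
have iP : integ setT P by exact: integ_ge0 PA.
have lP : locint P by split => // a b; apply: integrableS iP.
have step a b : a <= b -> `|cmod (u b) ^+ 2 - cmod (u a) ^+ 2| <= 1 * (A + A).
  move=> ab; apply: le_trans (prim_le pq ab) _.
  apply: (@le_trans _ _ (Rintegral mu `[a, b] P)).
    apply: le_locRintegral => //; first by apply: locint_norm; case: pq.
    move=> x _; rewrite normrM ger0_norm//.
    have := Re_conjM_le (u x) (u' x) => h; apply: le_trans (ler_wpM2l _ h) _ => //.
    by have := sqr_ge0 (cmod (u x) - cmod (u' x)); rewrite /P; nra.
  rewrite -lee_fin /Rintegral fineK; last exact: integrable_fin_num (lP.2 _ _).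
  apply: le_trans PA; apply: ge0_subset_integral => //; first exact/measurable_EFinP.
  by move=> x _; rewrite lee_fin.
exists (1 + cmod (u 0) ^+ 2 + 1 * (A + A)) => x.
have : cmod (u x) ^+ 2 <= cmod (u 0) ^+ 2 + 1 * (A + A).
  have [x0|x0] := leP 0 x.
    by have := step 0 x x0; rewrite ler_norml => /andP[_]; lra.
  by have := step x 0 (ltW x0); rewrite ler_norml => /andP[+ _]; lra.
have := sqr_ge0 (cmod (u x) - 1); have := cmod_ge0 (u x); nra.
Qed.

Definition density (u : bool -> R -> R[i]) x := cmod (u true x) ^+ 2 + cmod (u false x) ^+ 2.

(** d is the derivative of |u1|^2 - |u2|^2.  The mass and the real part of z drop
    out of it, and it equals - 2 Im z |u|^2 up to products of u with f and V u;
    the products with f are absorbed by Young's inequality. *)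
Lemma energy_pointwise (m : R) (z : R[i]) v (f u : bool -> R -> R[i]) (X U : R) x :
  (forall j l, cmod (v j l x) <= X) -> (forall j, cmod (u j x) <= U) -> Im z != 0 ->
  forall d, d = 2 * (Re (u true x) * Re (dirac_rhs m%:C%C z v f u true x) +
                Im (u true x) * Im (dirac_rhs m%:C%C z v f u true x)) -
           2 * (Re (u false x) * Re (dirac_rhs m%:C%C z v f u false x) +
                Im (u false x) * Im (dirac_rhs m%:C%C z v f u false x)) ->
  `|Im z| * density u x <= - Num.sg (Im z) * d + `|Im z|^-1 * density f x + 8 * U ^+ 2 * X.
Proof.
move=> vX uU z0 d dE0.
pose h1 := f true x - v true true x * u true x - v true false x * u false x.
pose h2 := f false x - v false true x * u true x - v false false x * u false x.
pose T := (Re (u true x) * Im h1 - Im (u true x) * Re h1) +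
          (Re (u false x) * Im h2 - Im (u false x) * Re h2).
have dE : d = - 2 * Im z * density u x - 2 * T.
  rewrite dE0 /T /h1 /h2 /density /dirac_rhs !cmod_sqr.
  case: (u true x) (u false x) (f true x) (f false x) (v true true x) (v true false x)
    (v false true x) (v false false x) (z) => [a1 a2] [b1 b2] [c1 c2] [d1 d2] [p1 p2] [q1 q2]
    [r1 r2] [s1 s2] [z1 z2] /=; ring.
have U0 : 0 <= U by exact: le_trans (cmod_ge0 _) (uU true).
have X0 : 0 <= X by exact: le_trans (cmod_ge0 _) (vX true true).
have vu j l : cmod (v j l x * u l x) <= X * U by exact: cmod_leM.
have hb1 : cmod h1 <= cmod (f true x) + X * U + X * U.
  by apply: cmod_leB => //; exact: cmod_leB.
have hb2 : cmod h2 <= cmod (f false x) + X * U + X * U.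
  by apply: cmod_leB => //; exact: cmod_leB.
have TB : `|T| <= cmod (u true x) * cmod (f true x) + cmod (u false x) * cmod (f false x) + 4 * (U ^+ 2 * X).
  apply: le_trans (ler_normD _ _) _.
  apply: le_trans (lerD (Im_conjM_le _ _) (Im_conjM_le _ _)) _.
  have k1 := ler_wpM2l (cmod_ge0 (u true x)) hb1.
  have k2 := ler_wpM2l (cmod_ge0 (u false x)) hb2.
  have XU : 0 <= X * U by exact: mulr_ge0.
  have k3 := ler_wpM2r XU (uU true); have k4 := ler_wpM2r XU (uU false).
  have -> : U ^+ 2 * X = U * (X * U) by ring.
  lra.
have g0 : 0 < `|Im z| by rewrite normr_gt0.
have young (a b : R) : 2 * (a * b) <= `|Im z| * a ^+ 2 + `|Im z|^-1 * b ^+ 2.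
  have gi : 0 < `|Im z|^-1 by rewrite invr_gt0.
  have := sqr_ge0 (`|Im z| * a - b) => /(ler_wpM2l (ltW gi)); rewrite mulr0.
  have -> : `|Im z|^-1 * (`|Im z| * a - b) ^+ 2 = `|Im z| * a ^+ 2 - 2 * (a * b) + `|Im z|^-1 * b ^+ 2.
    by field; rewrite gt_eqF.
  lra.
have y1 := young (cmod (u true x)) (cmod (f true x)).
have y2 := young (cmod (u false x)) (cmod (f false x)).
have sT : - Num.sg (Im z) * d = 2 * (`|Im z| * density u x) + 2 * (Num.sg (Im z) * T).
  rewrite dE [`|Im z|]normrEsg; ring.
have sgT : `|Num.sg (Im z) * T| <= `|T|.
  by rewrite normrM; have := normr_sg (Im z) => ->; rewrite z0 mul1r.
rewrite sT; move: sgT; rewrite ler_norml => /andP[+ _].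
move: TB y1 y2; rewrite /density; have : 8 * U ^+ 2 * X = 2 * (4 * (U ^+ 2 * X)) by ring.
move=> ->; lra.
Qed.

(** The integral of d over a segment is at most 2 U^2, so the bound does not
    depend on the segment. *)
Theorem energy_estimate (m s C0 I : R) (z : R[i]) v (f u : bool -> R -> R[i]) (U A : R) :
  (forall j l x, cmod (v j l x) <= C0 * rho s x) -> 0 <= C0 ->
  (\int[mu]_x (rho s x)%:E = I%:E)%E -> Im z != 0 ->
  (forall j, cmeas (f j)) -> (\int[mu]_x (density f x)%:E <= A%:E)%E ->
  (forall j x, cmod (u j x) <= U) ->
  (forall j, cprim (u j) (dirac_rhs m%:C%C z v f u j)) ->
  (\int[mu]_x (density u x)%:E <=
     (`|Im z|^-1 * (2 * U ^+ 2 + `|Im z|^-1 * A + 8 * U ^+ 2 * C0 * I))%:E)%E.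
Proof.
move=> vC C00 hI z0 mf fA uU pu.
have g0 : 0 < `|Im z| by rewrite normr_gt0.
have U0 : 0 <= U by exact: le_trans (cmod_ge0 _) (uU true 0).
have r0 x : 0 <= rho s x by rewrite ltW ?rho_gt0.
have mD (g : bool -> R -> R[i]) : (forall j, cmeas (g j)) -> measurable_fun setT (density g).
  by move=> mg; apply: measurable_funD; apply: measurable_funX; exact: measurable_cmod.
have D0 g x : 0 <= density g x by rewrite addr_ge0 ?sqr_ge0.
have mu_ j : cmeas (u j) by exact: ccont_cmeas (cprim_ccont (pu j)).
apply: integral_le_segments; [exact: mD|exact: D0|].
move=> a a0; have aa : - a <= a by lra.
have pq := primB (prim_cmod_sqr (pu true)) (prim_cmod_sqr (pu false)).
set q := (fun x => _ - _) in pq; set d := (fun x => _ - _) in pq.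
have lu : locint (density u).
  apply: cont_locint; apply: (@prim_continuous R _ _ (primD (prim_cmod_sqr (pu true)) (prim_cmod_sqr (pu false)))).
have to_integ (g : R -> R) (G : R) : measurable_fun setT g -> (forall x, 0 <= g x) ->
    (\int[mu]_x (g x)%:E <= G%:E)%E -> locint g /\ Rintegral mu `[- a, a] g <= G.
  move=> mg gp gG; have ig := integ_ge0 mg gp gG.
  have lg : locint g by split => // b c; apply: integrableS ig.
  split => //; rewrite -lee_fin /Rintegral fineK; last exact: integrable_fin_num (lg.2 _ _).
  apply: le_trans gG; apply: ge0_subset_integral => //; first exact/measurable_EFinP.
  by move=> x _; rewrite lee_fin.
have [lf fa] := to_integ _ _ (mD f mf) (D0 f) fA.
have hI' : (\int[mu]_x (rho s x)%:E <= I%:E)%E by rewrite hI.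
have [lr ra] := to_integ _ _ (measurable_rho s) r0 hI'.
have ld : locint d by case: pq.
have lsum := locintD (locintD (locintZ (- Num.sg (Im z)) ld) (locintZ (`|Im z|^-1) lf))
   (locintZ (8 * U ^+ 2 * C0) lr).
have main : `|Im z| * Rintegral mu `[- a, a] (density u) <=
    2 * U ^+ 2 + `|Im z|^-1 * A + 8 * U ^+ 2 * C0 * I.
  rewrite -locRintegralZ//.
  apply: (le_trans (le_locRintegral (locintZ _ lu) lsum _)).
    move=> x _; have := @energy_pointwise m z v f u (C0 * rho s x) U x (fun j l => vC j l x) (fun j => uU j x) z0.
    by move=> /(_ (d x) erefl); rewrite !mulrA.
  rewrite (locRintegralD _ _ (locintD (locintZ (- Num.sg (Im z)) ld) (locintZ (`|Im z|^-1) lf)) (locintZ (8 * U ^+ 2 * C0) lr)).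
  rewrite (locRintegralD _ _ (locintZ (- Num.sg (Im z)) ld) (locintZ (`|Im z|^-1) lf)).
  rewrite (locRintegralZ (- Num.sg (Im z)) _ _ ld) (locRintegralZ (`|Im z|^-1) _ _ lf) (locRintegralZ (8 * U ^+ 2 * C0) _ _ lr).
  rewrite -(pq.2 _ _ aa); apply: lerD; last by rewrite ler_wpM2l// !mulr_ge0// sqr_ge0.
  apply: lerD; last by rewrite ler_wpM2l// invr_ge0 ltW.
  have qU x : `|q x| <= U ^+ 2.
    have sq j : 0 <= cmod (u j x) ^+ 2 <= U ^+ 2.
      by rewrite sqr_ge0 ler_pXn2r ?nnegrE ?cmod_ge0//= uU.
    have /andP[s1 s2] := sq true; have /andP[s3 s4] := sq false.
    rewrite /q ler_norml; apply/andP; split; lra.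
  apply: le_trans (ler_norm _) _; rewrite normrM normrN normr_sg z0 mul1r.
  by apply: le_trans (ler_normB _ _) _; have := qU a; have := qU (- a); lra.
have : (\int[mu]_(x in `[(- a)%R, a]) (density u x)%:E)%E = (Rintegral mu `[- a, a] (density u))%:E.
  by rewrite /Rintegral fineK//; exact: integrable_fin_num (lu.2 _ _).
move=> ->; rewrite lee_fin; move: main; rewrite -ler_pdivlMl//.
Qed.
End Energy.

(** * From the operator to the system *)

Section Bridge.
Context {R : realType}.
Local Notation mu := (@lebesgue_measure R).
Local Notation cmod := (@ComplexField.Normc.normc R).
Local Notation Re := (@complex.Re R).
Local Notation Im := (@complex.Im R).
Local Notation integ D f := (mu.-integrable D (EFin \o f)).
Local Notation spinor := (@spinor R).

(** Components are indexed by booleans, so that the two cases of the system are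
    told apart by computation. *)
Definition idx (j : bool) : 'I_2 := if j then ord0 else lift ord0 ord0.
Definition comp (u : spinor) (j : bool) (x : R) : R[i] := u x (idx j) 0.
Definition mk_spinor (c : bool -> R -> R[i]) : spinor :=
  fun x => \col_i (if i == ord0 then c true x else c false x).

Lemma idxP (i : 'I_2) : exists j, i = idx j.
Proof.
case: (unliftP ord0 i) => [k ->|->]; last by exists true.
by exists false; rewrite /idx (ord1 k).
Qed.

Lemma comp_mk c j x : comp (mk_spinor c) j x = c j x.
Proof. by rewrite /comp /mk_spinor mxE; case: j. Qed.

Lemma eq_comp (a b : 'cV[R[i]]_2) : (forall j, a (idx j) 0 = b (idx j) 0) -> a = b.
Proof.
move=> h; apply/matrixP => i l; rewrite (ord1 l).
by have [j ->] := idxP i; exact: h.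
Qed.

Lemma sum_idx (V : zmodType) (F : 'I_2 -> V) :
  \sum_(i < 2) F i = F (idx true) + F (idx false).
Proof. by rewrite !big_ord_recl big_ord0 addr0. Qed.

Lemma vnorm_sqr (u : spinor) x : vnorm (u x) ^+ 2 = density (comp u) x.
Proof.
rewrite /vnorm sqr_sqrtr; last by apply: sumr_ge0 => i _; exact: sqr_ge0.
by rewrite sum_idx.
Qed.

Lemma vnorm_ge0 (a : 'cV[R[i]]_2) : 0 <= vnorm a.
Proof. exact: sqrtr_ge0. Qed.

Lemma cmod_le_vnorm (u : spinor) j x : cmod (comp u j x) <= vnorm (u x).
Proof.
rewrite -(@ler_pXn2r _ 2)// ?nnegrE ?cmod_ge0 ?vnorm_ge0// vnorm_sqr /density.
by case: j; [rewrite lerDl|rewrite lerDr]; exact: sqr_ge0.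
Qed.

Lemma measurable_spinorP (u : spinor) : measurable_spinor u <-> forall j, cmeas (comp u j).
Proof. by split=> [h j|h i]; [exact: h|have [j ->] := idxP i; exact: h]. Qed.

Lemma measurable_density (c : bool -> R -> R[i]) : (forall j, cmeas (c j)) ->
  measurable_fun setT (density c).
Proof. by move=> mc; apply: measurable_funD; apply: measurable_funX; exact: measurable_cmod. Qed.

Lemma density_ge0 (c : bool -> R -> R[i]) x : 0 <= density c x.
Proof. by rewrite addr_ge0 ?sqr_ge0. Qed.

Lemma L2norm_le (u : spinor) A : 0 <= A ->
  (L2norm u <= A%:E)%E <-> (\int[mu]_x (density (comp u) x)%:E <= (A ^+ 2)%:E)%E.
Proof.
move=> A0; rewrite /L2norm; have := @Lnorm2_le R (fun x => vnorm (u x)) A A0.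
by under eq_integral do rewrite vnorm_sqr.
Qed.

Lemma L2_real (u : spinor) : L2 u -> exists2 A : R, 0 <= A & L2norm u = A%:E.
Proof.
move=> [_ fin]; have n0 : (0 <= L2norm u)%E by exact: Lnorm_ge0.
exists (fine (L2norm u)); first exact: fine_ge0.
by rewrite fineK// ge0_fin_numE.
Qed.

Lemma L2_cmeas (u : spinor) j : L2 u -> cmeas (comp u j).
Proof. by case=> /measurable_spinorP. Qed.

Lemma L2_intro (u : spinor) A : (forall j, cmeas (comp u j)) -> 0 <= A ->
  (\int[mu]_x (density (comp u) x)%:E <= (A ^+ 2)%:E)%E -> L2 u.
Proof.
move=> mu_ A0 h; split; first exact/measurable_spinorP.
by apply: le_lt_trans (ltry A); apply/L2norm_le.
Qed.

Lemma L2_dom (g f w : spinor) (c : R) : L2 f -> L2 w -> 0 <= c ->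
  (forall j, cmeas (comp g j)) ->
  (forall j x, cmod (comp g j x) <= c * (vnorm (f x) + vnorm (w x))) -> L2 g.
Proof.
move=> Lf Lw c0 mg h.
have [A A0 fA] := L2_real Lf; have [B B0 wB] := L2_real Lw.
have fA' : (\int[mu]_x (density (comp f) x)%:E <= (A ^+ 2)%:E)%E by apply/L2norm_le; rewrite ?fA.
have wB' : (\int[mu]_x (density (comp w) x)%:E <= (B ^+ 2)%:E)%E by apply/L2norm_le; rewrite ?wB.
pose G := 4 * c ^+ 2 * (A ^+ 2 + B ^+ 2).
have G0 : 0 <= G by rewrite /G !mulr_ge0 ?addr_ge0 ?sqr_ge0.
apply: (@L2_intro _ (Num.sqrt G)) => //; rewrite sqr_sqrtr//.
apply: (@integral_pair_le _ _ (density (comp f)) (density (comp w))) => //.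
- by rewrite mulr_ge0 ?sqr_ge0.
- exact: measurable_density.
- by apply: measurable_density => j; exact: L2_cmeas.
- by apply: measurable_density => j; exact: L2_cmeas.
- exact: density_ge0.
- exact: density_ge0.
- exact: density_ge0.
- move=> x; rewrite -!vnorm_sqr vnorm_sqr /density.
  have p0 : 0 <= vnorm (f x) + vnorm (w x) by rewrite addr_ge0 ?vnorm_ge0.
  have sq j : cmod (comp g j x) ^+ 2 <= c ^+ 2 * (vnorm (f x) + vnorm (w x)) ^+ 2.
    rewrite -exprMn ler_pXn2r ?nnegrE ?cmod_ge0 ?mulr_ge0//.
  apply: le_trans (lerD (sq true) (sq false)) _.
  have := sqr_ge0 (vnorm (f x) - vnorm (w x)) => /(ler_wpM2l (sqr_ge0 c)).
  rewrite mulr0; nra.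
Qed.

Lemma dirac_entry (m : R) (a b : 'cV[R[i]]_2) j :
  ('i%C *: (alpha *m a) + m%:C%C *: (beta *m b)) (idx j) 0 =
  if j then - 'i%C * a (idx true) 0 + m%:C%C * b (idx false) 0
  else 'i%C * a (idx false) 0 + m%:C%C * b (idx true) 0.
Proof.
rewrite !mxE !sum_idx /alpha /beta !mxE; case: j => /=; ring.
Qed.

Lemma mulmx_entry (V : 'M[R[i]]_2) (b : 'cV[R[i]]_2) i :
  (V *m b) i 0 = V i (idx true) * b (idx true) 0 + V i (idx false) * b (idx false) 0.
Proof. by rewrite mxE sum_idx. Qed.

(** Replaces a weak derivative by the expression which the equation gives for it
    almost everywhere. *)
Lemma prim_ae (F f g : R -> R) : prim F f -> measurable_fun setT g ->
  {ae mu, forall x, f x = g x} -> prim F g.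
Proof.
move=> [[mf lf] hF] mg fg.
have aeD (D : set R) (h k : R -> \bar R) : (forall x, f x = g x -> h x = k x) -> ae_eq mu D h k.
  by move=> hk; move: fg; apply: filterS; [exact: (ae_filter_ringOfSetsType mu)|move=> x /hk].
split; first split=> // a b.
  have /integrableP[m1 m2] := lf a b; apply/integrableP; split.
    by apply/measurable_EFinP; exact: measurable_funTS.
  suff e : (\int[mu]_(x in `[a, b]) `|(EFin \o f) x| = \int[mu]_(x in `[a, b]) `|(EFin \o g) x|)%E.
    by rewrite -e.
  apply: ae_eq_integral => //.
  - by apply/measurable_EFinP; apply: measurable_funTS; exact: measurableT_comp.
  - by apply/measurable_EFinP; apply: measurable_funTS; exact: measurableT_comp.
  - by apply: aeD => x /= ->.
move=> a b ab; rewrite (hF _ _ ab) /Rintegral; congr fine.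
apply: ae_eq_integral => //.
- by apply/measurable_EFinP; exact: measurable_funTS.
- by apply/measurable_EFinP; exact: measurable_funTS.
- by apply: aeD => x /= ->.
Qed.

Lemma cprim_ae (F f g : R -> R[i]) : cprim F f -> cmeas g ->
  {ae mu, forall x, f x = g x} -> cprim F g.
Proof.
move=> [p1 p2] [m1 m2] fg; split; [apply: prim_ae p1 m1 _|apply: prim_ae p2 m2 _];
  by move: fg; apply: filterS; [exact: (ae_filter_ringOfSetsType mu)|move=> x /= ->].
Qed.

End Bridge.

Section OperatorODE.
Context {R : realType}.
Local Notation mu := (@lebesgue_measure R).
Local Notation cmod := (@ComplexField.Normc.normc R).
Local Notation Re := (@complex.Re R).
Local Notation Im := (@complex.Im R).
Local Notation integ D f := (mu.-integrable D (EFin \o f)).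
Local Notation spinor := (@spinor R).

Variables (m : R) (V : R -> 'M[R[i]]_2) (C0 : R).
Let v j l x : R[i] := V x (idx j) (idx l).
Hypothesis (cv : forall j l, ccont (v j l)) (vC : forall j l x, cmod (v j l x) <= C0).
Let H := add_potential (dirac m) V.

Let C00 : 0 <= C0. Proof. exact: le_trans (cmod_ge0 _) (vC true true 0). Qed.

Lemma mulii : 'i%C * 'i%C = -1 :> R[i].
Proof. by rewrite -expr2 sqr_i. Qed.

Lemma L2_density_le (u : spinor) : L2 u ->
  exists A : R, (\int[mu]_x (density (comp u) x)%:E <= A%:E)%E.
Proof.
move=> Lu; have [A A0 e] := L2_real Lu; exists (A ^+ 2).
by apply/L2norm_le; rewrite ?e.
Qed.

Lemma L2_cmod_sqr_le (u : spinor) j A :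
  (\int[mu]_x (density (comp u) x)%:E <= A%:E)%E -> L2 u ->
  (\int[mu]_x (cmod (comp u j x) ^+ 2)%:E <= A%:E)%E.
Proof.
move=> h Lu; apply: le_trans h; apply: ge0_le_integral => //.
- by move=> x _; rewrite lee_fin sqr_ge0.
- apply/measurable_EFinP; apply: measurable_funX; apply: measurable_cmod; exact: L2_cmeas.
- by apply/measurable_EFinP; apply: measurable_density => l; exact: L2_cmeas.
- by move=> x _; rewrite lee_fin /density; case: j; [rewrite lerDl|rewrite lerDr]; exact: sqr_ge0.
Qed.

Lemma L2_loc_integ (u : spinor) j a b : L2 u -> integ `[a, b] (fun x => cmod (comp u j x)).
Proof.
move=> Lu; have [A hA] := L2_density_le Lu; have mu_ := L2_cmeas j Lu.
have md : measurable_fun setT (density (comp u)).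
  by apply: measurable_density => l; exact: L2_cmeas.
have id := integ_ge0 md (density_ge0 _) hA.
have i1 : integ `[a, b] (fun x => 1 + density (comp u) x).
  apply: integD => //; last by apply: integrableS id.
  by apply: (cont_locint (f := fun=> 1) _).2; exact: cst_continuous.
apply: le_integ i1 => // [|x _]; first exact: measurable_cmod.
rewrite ger0_norm ?cmod_ge0//.
have h : cmod (comp u j x) ^+ 2 <= density (comp u) x.
  by rewrite /density; case: j {mu_}; [rewrite lerDl|rewrite lerDr]; exact: sqr_ge0.
have := sqr_ge0 (cmod (comp u j x) - 1); nra.
Qed.

Lemma H1_derivP (w w' : spinor) : L2 w -> L2 w' ->
  H1_deriv w w' <-> forall j, cprim (comp w j) (comp w' j).
Proof.
move=> Lw Lw'; have key j := cprimP (comp w j) (L2_cmeas j Lw') (fun a b => L2_loc_integ j a b Lw').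
split=> [[_ _ h] j|h].
  by apply/key => a b ab; exact: h.
by split => // a b ab i; have [j ->] := idxP i; exact: ((key j).1 (h j) a b ab).
Qed.

Lemma cmeas_dirac_rhs z (f w : bool -> R -> R[i]) j : (forall j, cmeas (f j)) ->
  (forall j, cmeas (w j)) -> cmeas (dirac_rhs m%:C%C z v f w j).
Proof.
move=> mf mw; have mv j' l := ccont_cmeas (cv j' l).
case: j; apply: cmeasZ; do 2 (apply: cmeasB; last exact: cmeasM);
  (apply: cmeasB; last exact: cmeasZ); apply: cmeasD => //; exact: cmeasZ.
Qed.


(** Solutions of (H - z) u = f are represented by bounded solutions of the
    system: boundedness is that of H^1 functions. *)
Lemma subz_sound z (u f : spinor) : subz H z u f ->
  [/\ L2 f, L2 u & exists w : bool -> R -> R[i],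
   [/\ exists U, forall j x, cmod (w j x) <= U,
     forall j, cprim (w j) (dirac_rhs m%:C%C z v (comp f) w j) &
     {ae mu, forall x, u x = mk_spinor w x}]].
Proof.
have F_ae : Filter (nbhs (almost_everywhere mu)) by exact: ae_filter_ringOfSetsType.
move=> [Lf [g2 [Lg2 [g1 [Lu Lg1 [w [w' [hw uw g1E]]]] g2E]] fE]].
have [Lw Lw' _] := hw; have pw := (H1_derivP Lw Lw').1 hw.
split => //; exists (comp w); split.
- have [A hA] := L2_density_le Lw; have [A' hA'] := L2_density_le Lw'.
  have B j : exists U, forall x, cmod (comp w j x) <= U.
    apply: (H1_bounded (A := Num.max A A') (pw j)).
      by apply: le_trans (L2_cmod_sqr_le j hA Lw) _; rewrite lee_fin le_max lexx.
    by apply: le_trans (L2_cmod_sqr_le j hA' Lw') _; rewrite lee_fin le_max lexx orbT.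
  have [U1 h1] := B true; have [U2 h2] := B false.
  exists (Num.max U1 U2) => j x; case: j; rewrite le_max.
    by rewrite h1.
  by rewrite h2 orbT.
- move=> j; apply: (cprim_ae (pw j)).
    by apply: cmeas_dirac_rhs => l; exact: L2_cmeas.
  near=> x.
  have e1 : u x = w x by near: x.
  have e2 : g1 x = 'i%C *: (alpha *m w' x) + m%:C%C *: (beta *m w x) by near: x.
  have e3 : g2 x = g1 x + V x *m u x by near: x.
  have e4 : f x = g2 x + (- z)%:M *m u x by near: x.
  have e l : f x (idx l) 0 = ('i%C *: (alpha *m w' x) + m%:C%C *: (beta *m w x)) (idx l) 0 +
      (V x *m w x) (idx l) 0 - z * w x (idx l) 0.
    by rewrite e4 e3 e2 e1 mul_scalar_mx mxE [in LHS]mxE [X in _ + X]mxE mulNr.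
  have := e j; rewrite dirac_entry mulmx_entry /dirac_rhs /comp /v.
  have ii a : 'i%C * (- 'i%C * a) = a :> R[i] by rewrite mulrA mulrN mulii opprK mul1r.
  have ii' a : - 'i%C * ('i%C * a) = a :> R[i] by rewrite mulrA mulNr mulii opprK mul1r.
  case: j => ->; [rewrite -[LHS]ii|rewrite -[LHS]ii']; congr (_ * _); ring.
- near=> x.
  have e1 : u x = w x by near: x.
  by rewrite e1; apply: eq_comp => j; rewrite -/(comp _ _ _) -[RHS]/(comp _ _ _) comp_mk.
Unshelve. all: by end_near. Qed.

(** V being bounded, a square integrable solution of the system has a square
    integrable derivative, hence is in the domain of H. *)
Lemma subz_complete z (f : spinor) (w : bool -> R -> R[i]) : L2 f ->
  (forall j, cprim (w j) (dirac_rhs m%:C%C z v (comp f) w j)) ->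
  L2 (mk_spinor w) -> subz H z (mk_spinor w) f.
Proof.
move=> Lf pw Lw.
pose w' := mk_spinor (fun j x => dirac_rhs m%:C%C z v (comp f) w j x).
pose g2 : spinor := fun x => f x + z *: mk_spinor w x.
pose g1 : spinor := fun x => g2 x - V x *m mk_spinor w x.
have mf j : cmeas (comp f j) by exact: L2_cmeas.
have mw j : cmeas (w j) by exact: ccont_cmeas (cprim_ccont (pw j)).
have mv j l := ccont_cmeas (cv j l).
have g2E j x : comp g2 j x = comp f j x + z * w j x.
  by rewrite /comp /g2 mxE [X in _ + X]mxE -[mk_spinor w x _ _]/(comp _ _ _) comp_mk.
have g1E j x : comp g1 j x = comp f j x + z * w j x - (v j true x * w true x + v j false x * w false x).
  rewrite /comp /g1 mxE -/(comp g2 j x) g2E [X in _ + X]mxE mulmx_entry.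
  by rewrite -![mk_spinor w x _ _]/(comp _ _ _) !comp_mk.
have w'E j x : comp w' j x = dirac_rhs m%:C%C z v (comp f) w j x by exact: comp_mk.
have mg2 j : cmeas (comp g2 j).
  have := cmeasD (mf j) (cmeasZ z (mw j)).
  by congr cmeas; apply/funext => x; rewrite g2E.
have mg1 j : cmeas (comp g1 j).
  have := cmeasB (cmeasD (mf j) (cmeasZ z (mw j)))
    (cmeasD (cmeasM (mv j true) (mw true)) (cmeasM (mv j false) (mw false))).
  by congr cmeas; apply/funext => x; rewrite g1E.
have mw' j : cmeas (comp w' j).
  have := @cmeas_dirac_rhs z _ _ j mf mw.
  by congr cmeas; apply/funext => x; rewrite w'E.
have fb j x : cmod (comp f j x) <= vnorm (f x) by exact: cmod_le_vnorm.
have wb j x : cmod (w j x) <= vnorm (mk_spinor w x).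
  by rewrite -(comp_mk w); exact: cmod_le_vnorm.
have vb j l x : cmod (v j l x * w l x) <= C0 * vnorm (mk_spinor w x) by exact: cmod_leM.
have zb j x : cmod (z * w j x) <= cmod z * vnorm (mk_spinor w x) by exact: cmod_leM.
pose c := 1 + cmod z + `|m| + 2 * C0.
have c0 : 0 <= c by rewrite !addr_ge0 ?cmod_ge0 ?mulr_ge0.
have Lg (g : spinor) : (forall j, cmeas (comp g j)) ->
   (forall j x, cmod (comp g j x) <= vnorm (f x) + (cmod z + `|m| + 2 * C0) * vnorm (mk_spinor w x)) -> L2 g.
  move=> mg hg; apply: (L2_dom Lf Lw c0 mg) => j x; apply: le_trans (hg j x) _.
  have p1 := vnorm_ge0 (f x); have p2 := vnorm_ge0 (mk_spinor w x).
  rewrite /c mulrDr; apply: lerD.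
    by rewrite ler_peMl// -!addrA lerDl !addr_ge0 ?cmod_ge0 ?mulr_ge0.
  by rewrite ler_wpM2r// -!addrA lerDr.
have Lg2 : L2 g2.
  apply: Lg => // j x; rewrite g2E; apply: le_trans (cmod_leD (fb j x) (zb j x)) _.
  rewrite lerD2l ler_wpM2r ?vnorm_ge0// -addrA lerDl addr_ge0// mulr_ge0//.
have Lg1 : L2 g1.
  apply: Lg => // j x; rewrite g1E.
  apply: le_trans (cmod_leB (cmod_leD (fb j x) (zb j x)) (cmod_leD (vb j true x) (vb j false x))) _.
  have := mulr_ge0 (normr_ge0 m) (vnorm_ge0 (mk_spinor w x)); lra.
have mb j x : cmod (m%:C%C * w j x) <= `|m| * vnorm (mk_spinor w x).
  by apply: cmod_leM => //; rewrite cmod_real.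
have Lw' : L2 w'.
  apply: Lg => // j x; rewrite w'E /dirac_rhs.
  have P l : cmod (comp f l x + z * w l x - m%:C%C * w (~~ l) x - v l true x * w true x - v l false x * w false x) <=
      vnorm (f x) + (cmod z + `|m| + 2 * C0) * vnorm (mk_spinor w x).
    apply: le_trans (cmod_leB (cmod_leB (cmod_leB (cmod_leD (fb l x) (zb l x)) (mb (~~ l) x)) (vb l true x)) (vb l false x)) _.
    lra.
  by case: j; rewrite cmodM ?cmodN cmod_i mul1r; exact: P.
have hw : H1_deriv (mk_spinor w) w'.
  apply/H1_derivP => // j; have := pw j; congr cprim; apply/funext => x.
    by rewrite comp_mk.
  by rewrite w'E.
split => //; exists g2; last first.
  apply: aeW => x; rewrite /g2 mul_scalar_mx scaleNr addrK//.
split => //; exists g1; last by apply: aeW => x; rewrite /g1 subrK.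
split => //; exists (mk_spinor w), w'; split => //; first exact: aeW.
apply: aeW => x; apply: eq_comp => j; rewrite -/(comp g1 j x) g1E dirac_entry.
rewrite -![w' x _ _]/(comp _ _ _) -![mk_spinor w x _ _]/(comp _ _ _) !comp_mk /dirac_rhs.
case: j.
  rewrite mulrA mulNr mulii opprK mul1r; ring.
rewrite mulrA mulrN mulii opprK mul1r; ring.
Qed.

End OperatorODE.

(** * The resolvent at high energy *)

Section Resolvent.
Context {R : realType}.
Local Notation mu := (@lebesgue_measure R).
Local Notation cmod := (@ComplexField.Normc.normc R).
Local Notation Re := (@complex.Re R).
Local Notation Im := (@complex.Im R).
Local Notation spinor := (@spinor R).

Lemma normC_lt (z e : R[i]) : 0 < e -> cmod z < Re e -> `|z| < e.
Proof.
case: e => a b; rewrite ltcE /= => /andP[/eqP b0 _] h.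
by rewrite normc_def -cmodE ltcE /= b0 eqxx.
Qed.

Lemma lt_normC (z : R[i]) (e : R) : `|z| < e%:C%C -> cmod z < e.
Proof. by rewrite normc_def -cmodE ltcR. Qed.

Lemma continuous_ccont (f : R -> R[i]) : continuous (fun x => (f x : (R[i])^o)) -> ccont f.
Proof.
move=> cf; split=> x; apply/cvgrPdist_lt => e e0.
  have e0C : (0 : R[i]) < e%:C%C by rewrite ltcR.
  have /cvgrPdist_lt /(_ _ e0C) := cf x; apply: filterS => t /lt_normC.
  by apply: le_lt_trans; rewrite /= -cReN -cReD; exact: Re_le_cmod.
have e0C : (0 : R[i]) < e%:C%C by rewrite ltcR.
have /cvgrPdist_lt /(_ _ e0C) := cf x; apply: filterS => t /lt_normC.
by apply: le_lt_trans; rewrite /= -cImN -cImD; exact: Im_le_cmod.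
Qed.

Definition box (L : R) : set (R[i])^o :=
  (fun p : R * R => (Complex p.1 p.2 : (R[i])^o)) @` (`[- L, L] `*` `[- L, L]).

Lemma compact_box L : compact (box L).
Proof.
apply: continuous_compact; last by apply: compact_setX; exact: segment_compact.
apply: continuous_subspaceT => p; apply/cvgrPdist_lt => e e0.
have e1 : 0 < Re e by move: e0; rewrite ltcE => /andP[].
have e2 : 0 < Re e / 2 by rewrite divr_gt0.
have c1 : (fun q : R * R => q.1) @ p --> p.1 by exact: cvg_fst.
have c2 : (fun q : R * R => q.2) @ p --> p.2 by exact: cvg_snd.
have /cvgrPdist_lt /(_ _ e2) := c1; have /cvgrPdist_lt /(_ _ e2) := c2.
apply: filterS2 => q h2 h1; apply: normC_lt => //.
apply: le_lt_trans (cmod_le _) _; rewrite /= (splitr (Re e)); exact: ltrD.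
Qed.

Lemma notin_box (L : R) (z : R[i]) : ~ box L z -> L <= cmod z.
Proof.
move=> h; rewrite leNgt; apply/negP => zL; apply: h; exists (Re z, Im z); last by case: (z).
have := le_lt_trans (Re_le_cmod z) zL; have := le_lt_trans (Im_le_cmod z) zL.
by rewrite !ltr_norml => /andP[h1 h2] /andP[h3 h4]; split; rewrite /= in_itv /= !ltW.
Qed.

Lemma Lnorm2_cmod (f : spinor) j (A : R) : L2 f -> 0 <= A -> (L2norm f <= A%:E)%E ->
  (Lnorm mu 2%:E (fun x => (cmod (comp f j x))%:E) <= A%:E)%E.
Proof. by move=> Lf A0 /(L2norm_le _ A0) h; apply/Lnorm2_le => //; exact: L2_cmod_sqr_le. Qed.

Lemma eq_ae_density (u : spinor) (w : bool -> R -> R[i]) :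
  L2 u -> (forall j, cmeas (w j)) -> {ae mu, forall x, u x = mk_spinor w x} ->
  (\int[mu]_x (density (comp u) x)%:E = \int[mu]_x (density w x)%:E)%E.
Proof.
move=> Lu mw uw; apply: ae_eq_integral => //.
- by apply/measurable_EFinP; apply: measurable_density => j; exact: L2_cmeas.
- by apply/measurable_EFinP; exact: measurable_density.
- move: uw; apply: filterS; first exact: (ae_filter_ringOfSetsType mu).
  by move=> x ux _; rewrite /density /comp ux -!/(comp (mk_spinor w) _ _) !comp_mk.
Qed.

Section HighEnergyResolvent.
Variables (m s C0 : R) (V : R -> 'M[R[i]]_2).
Let v j l x : R[i] := V x (idx j) (idx l).
Let H := add_potential (dirac m) V.
Hypothesis (m0 : 0 < m) (s1 : 1 < s).
Hypothesis (cv : forall j l, ccont (v j l)).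
Hypothesis (vC : forall j l x, cmod (v j l x) <= C0 * rho s x).

(** Existence and the L^2 bound combine [high_energy], which yields a bounded
    solution, with the energy estimate, which puts it in L^2.  The difference of
    two solutions is a bounded solution for f = 0, hence vanishes.  The second
    conclusion keeps the bound that is uniform in z. *)
Theorem resolvent_high_energy : exists Lam Cst : R, 0 <= Cst /\
  forall z : R[i], Im z != 0 -> Lam <= cmod z -> resolvent_set H z /\
    forall (u f : spinor) (M : R), subz H z u f ->
      (forall j, \int[mu]_x (cmod (comp f j x))%:E <= M%:E)%E ->
      exists w : bool -> R -> R[i], [/\ (forall j, cmeas (w j)),
        {ae mu, forall x, u x = mk_spinor w x} & forall j x, cmod (w j x) <= Cst * M].
Proof.
have [Lam [Cst [Cst0 hE]]] := high_energy m0 s1 cv vC.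
exists Lam, Cst; split => // z z0 zL.
have [kap kap0 hz] := hE z z0 zL.
have C00 : 0 <= C0.
  have := le_trans (cmod_ge0 _) (vC true true 0); rewrite pmulr_lge0//; exact: rho_gt0.
have r0 x : 0 <= rho s x by rewrite ltW ?rho_gt0.
have s0 : 0 <= s by exact: le_trans (ltW s1).
have vC' j l x : cmod (v j l x) <= C0.
  by apply: le_trans (vC j l x) _; rewrite ler_piMr// rho_le1.
have [I I0 hI] := integral_rho s1.
have g0 : 0 < `|Im z| by rewrite normr_gt0.
pose c := kap^-1 `^ 2^-1.
have c0 : 0 <= c by exact: powR_ge0.
have kintA (f : spinor) (A : R) j x : L2 f -> 0 <= A -> L2norm f = A%:E ->
    (kint kap (comp f j) x <= (c * A)%:E)%E.
  move=> Lf A0 fA; apply: le_trans (kint_le_L2 x kap0 (L2_cmeas j Lf)) _.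
  rewrite EFinM lee_wpmul2l ?lee_fin//.
  by apply: Lnorm2_cmod => //; rewrite fA.
(* energy_estimate with sup |u| <= Cst c |f|_2 *)
pose Q := `|Im z|^-1 * (2 * (Cst * c) ^+ 2 + `|Im z|^-1 + 8 * (Cst * c) ^+ 2 * C0 * I).
have Q0 : 0 <= Q.
  have i0 : 0 <= `|Im z|^-1 by rewrite invr_ge0.
  have sq := sqr_ge0 (Cst * c).
  by apply: mulr_ge0 => //; rewrite !addr_ge0// !mulr_ge0.
have energy (f : spinor) (A : R) w : L2 f -> 0 <= A -> L2norm f = A%:E ->
    (forall j, cprim (w j) (dirac_rhs m%:C%C z v (comp f) w j)) ->
    (forall j x, cmod (w j x) <= Cst * (c * A)) ->
    (\int[mu]_x (density w x)%:E <= ((Num.sqrt Q * A) ^+ 2)%:E)%E.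
  move=> Lf A0 fA pw wU.
  have fA' : (\int[mu]_x (density (comp f) x)%:E <= (A ^+ 2)%:E)%E by apply/L2norm_le; rewrite ?fA.
  have := energy_estimate vC C00 hI z0 (fun j => L2_cmeas j Lf) fA' wU pw.
  move=> h; apply: le_trans h _.
  have -> : (Num.sqrt Q * A) ^+ 2 = Q * A ^+ 2 by rewrite exprMn sqr_sqrtr.
  rewrite lee_fin.
  by rewrite le_eqVlt; apply/orP; left; apply/eqP; rewrite /Q; ring.
have sound u f := @subz_sound R m V cv z u f.
have L2nf (u f : spinor) : subz H z u f -> exists2 A : R, 0 <= A & L2norm f = A%:E.
  by move=> /sound[Lf _ _]; exact: L2_real.
split; first split.
- move=> f Lf; have [A A0 fA] := L2_real Lf.
  have [[w [pw wU]] _] := hz (comp f) (c * A) (fun j => L2_cmeas j Lf) (fun j x => kintA f A j x Lf A0 fA).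
  exists (mk_spinor w); apply: (subz_complete cv vC') => //.
  have cw : comp (mk_spinor w) = w by apply/funext => j; apply/funext => x; exact: comp_mk.
  apply: (@L2_intro _ _ (Num.sqrt Q * A)); rewrite ?cw.
  + by move=> j; exact: ccont_cmeas (cprim_ccont (pw j)).
  + by rewrite mulr_ge0 ?sqrtr_ge0.
  + exact: energy fA pw wU.
- move=> u1 u2 f h1 h2.
  have [Lf _ [w1 [[U1 b1] p1 e1]]] := sound _ _ h1.
  have [_ _ [w2 [[U2 b2] p2 e2]]] := sound _ _ h2.
  have k0 (x : R) : (kint kap (fun=> 0%R) x <= 0%:E)%E.
    rewrite /kint integral0_eq// => t _.
    by rewrite cmod0 mulr0.
  have [_ hb] := hz (fun _ _ => 0) 0 (fun=> cmeas_cst 0) (fun=> k0).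
  have w12 j x : w1 j x = w2 j x.
    apply/eqP; rewrite -subr_eq0; apply/eqP/cmod_eq0/le_anti; rewrite cmod_ge0 andbT.
    rewrite -(mulr0 Cst); apply: (hb (fun j x => w1 j x - w2 j x)).
      by exists (U1 + U2) => l t; exact: cmod_leB.
    move=> l; have := cprimB (p1 l) (p2 l); congr cprim; apply/funext => t.
    by rewrite /dirac_rhs /v; case: l => /=; ring.
  have F_ae : Filter (nbhs (almost_everywhere mu)) by exact: ae_filter_ringOfSetsType.
  move: e1 e2; apply: filterS2 => x -> ->; apply: eq_comp => j.
  by rewrite -!/(comp (mk_spinor _) _ _) !comp_mk.
- exists (Num.sqrt Q) => u f h.
  have [Lf Lu [w [wB pw uw]]] := sound _ _ h.
  have [A A0 fA] := L2_real Lf.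
  have [_ hb] := hz (comp f) (c * A) (fun j => L2_cmeas j Lf) (fun j x => kintA f A j x Lf A0 fA).
  have wU := hb w wB pw.
  rewrite fA -EFinM; apply/L2norm_le; first by rewrite mulr_ge0 ?sqrtr_ge0.
  rewrite (eq_ae_density Lu _ uw); first exact: energy fA pw wU.
  by move=> j; exact: ccont_cmeas (cprim_ccont (pw j)).
- move=> u f M h fM.
  have [Lf Lu [w [wB pw uw]]] := sound _ _ h.
  have [_ hb] := hz (comp f) M (fun j => L2_cmeas j Lf)
    (fun j x => le_trans (kint_le_L1 x kap0 (L2_cmeas j Lf)) (fM j)).
  exists w; split => //; last exact: hb.
  by move=> j; exact: ccont_cmeas (cprim_ccont (pw j)).
Qed.

End HighEnergyResolvent.
End Resolvent.

Section WeightedResolvent.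
Context {R : realType}.
Local Notation mu := (@lebesgue_measure R).
Local Notation cmod := (@ComplexField.Normc.normc R).
Local Notation spinor := (@spinor R).

Lemma comp_weight sigma (g : spinor) j x :
  comp (weight (- sigma) g) j x = (rho sigma x)%:C%C * comp g j x.
Proof. by rewrite /comp /weight mxE. Qed.

Lemma L2_weight sigma (g : spinor) : 0 <= sigma -> L2 g -> L2 (weight (- sigma) g).
Proof.
move=> s0 Lg; apply: (L2_dom Lg Lg (c := 1)) => // [j|j x].
  have mr : cmeas (fun x => (rho sigma x)%:C%C).
    split; last exact: measurable_cst.
    exact: measurable_rho.
  have := cmeasM mr (L2_cmeas j Lg); congr cmeas; apply/funext => x.
  by rewrite comp_weight.
rewrite comp_weight cmodM cmod_real ger0_norm ?(ltW (rho_gt0 _ _))// mul1r.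
have h := cmod_le_vnorm g j x; have v0 := vnorm_ge0 (g x).
apply: le_trans (ler_pM _ (cmod_ge0 _) (rho_le1 x s0) h) _; first by rewrite ltW ?rho_gt0.
by rewrite mul1r lerDl.
Qed.

(** Hoelder's inequality; N is the L^2 norm of the weight. *)
Lemma L1_weight sigma (g : spinor) (N A : R) j : L2 g -> 0 <= N -> 0 <= A ->
  (\int[mu]_x (rho (2 * sigma) x)%:E = (N ^+ 2)%:E)%E ->
  (L2norm g <= A%:E)%E ->
  (\int[mu]_x (cmod (comp (weight (- sigma) g) j x))%:E <= (N * A)%:E)%E.
Proof.
move=> Lg N0 A0 hN gA.
have mr := @measurable_rho R sigma.
have := @hoelder _ _ _ mu (rho sigma) (fun t => cmod (comp g j t)) 2 2
  mr (measurable_cmod (L2_cmeas j Lg)) (ltr0Sn R 1) (ltr0Sn R 1).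
have -> : (2^-1 + 2^-1 = 1 :> R) by lra.
move=> /(_ erefl); rewrite Lnorm1 => h.
have -> : (\int[mu]_x (cmod (comp (weight (- sigma) g) j x))%:E =
    \int[mu]_x `|(EFin \o (rho sigma \* (fun t => cmod (comp g j t)))%R) x|)%E.
  apply: eq_integral => x _.
  by rewrite comp_weight cmodM cmod_real /= normrM [`|cmod _|]ger0_norm// cmod_ge0.
apply: le_trans h _; rewrite EFinM; apply: lee_pmul; rewrite ?Lnorm_ge0//.
  apply/Lnorm2_le => //; rewrite -hN.
  by rewrite le_eqVlt; apply/orP; left; apply/eqP; apply: eq_integral => x _; rewrite sqr_rho.
exact: Lnorm2_cmod.
Qed.

Lemma L2norm_weight sigma (u : spinor) (w : bool -> R -> R[i]) (N B : R) :
  0 <= sigma -> L2 u -> (forall j, cmeas (w j)) -> {ae mu, forall x, u x = mk_spinor w x} ->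
  0 <= N -> 0 <= B -> (forall j x, cmod (w j x) <= B) ->
  (\int[mu]_x (rho (2 * sigma) x)%:E = (N ^+ 2)%:E)%E ->
  (L2norm (weight (- sigma) u) <= (2 * B * N)%:E)%E.
Proof.
move=> s0 Lu mw uw N0 B0 wB hN; apply/L2norm_le; first by rewrite !mulr_ge0.
pose w' j x := (rho sigma x)%:C%C * w j x.
have mr : cmeas (fun x => (rho sigma x)%:C%C).
  split; last exact: measurable_cst.
  exact: measurable_rho.
have mw' j : cmeas (w' j) by exact: cmeasM.
have uw' : {ae mu, forall x, weight (- sigma) u x = mk_spinor w' x}.
  move: uw; apply: filterS; first exact: (ae_filter_ringOfSetsType mu).
  move=> x ux; apply: eq_comp => j.
  rewrite -/(comp (weight _ u) _ _) -/(comp (mk_spinor w') _ _) comp_mk comp_weight /comp ux.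
  by rewrite -/(comp (mk_spinor w) _ _) comp_mk.
rewrite (eq_ae_density (L2_weight s0 Lu) mw' uw').
have -> : (2 * B * N) ^+ 2 = 4 * B ^+ 2 * N ^+ 2 by ring.
apply: integral_rho_le hN _ _; first by rewrite mulr_ge0// sqr_ge0.
- exact: measurable_density.
- by move=> t; exact: density_ge0.
move=> x; rewrite /density /w' !cmodM !cmod_real ger0_norm ?(ltW (rho_gt0 _ _))//.
rewrite !exprMn sqr_rho -mulrDr mulrC ler_wpM2r ?(ltW (rho_gt0 _ _))//.
have sq j : cmod (w j x) ^+ 2 <= B ^+ 2 by rewrite ler_pXn2r ?nnegrE ?cmod_ge0.
have := sq true; have := sq false; have := sqr_ge0 B; lra.
Qed.

End WeightedResolvent.

Theorem corollary1p5 (R : realType) (m : R) (V : R -> 'M[R[i]]_2) (sigma : R)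
    (hm : 0 < m)
    (hVcont : forall i j : 'I_2, continuous (fun x : R => (V x i j : (R[i])^o)))
    (hVdecay : short_range V)
    (hsigma : 2^-1 < sigma) :
  let H := add_potential (dirac m) V in
  (exists lambda1 delta : R,
    [/\ m < lambda1, 0 < delta,
        (forall lambda gamma : R,
          lambda1 < `|lambda| -> 0 < `|gamma| < delta * `|lambda| ->
          resolvent_set H (Complex lambda gamma)) &
        (ereal_sup
          [set opnorm (fun g => weight (- sigma)%R
                 (resolvent H (Complex z.1 z.2) (weight (- sigma)%R g)))
          | z in [set z : R * R | (lambda1 < `|z.1|)%R /\
                                  (0 < `|z.2| < delta * `|z.1|)%R]] < +oo)%E]) /\
  (exists K : set (R[i])^o, compact K /\
    forall z : R[i], ~ K z -> spectrum H z -> complex.Im z = 0).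
Proof.
move=> H.
have [eps eps0 [C VC]] := hVdecay.
have s1 : 1 < 1 + eps by rewrite ltrDl.
have cv j l : ccont (fun x => V x (idx j) (idx l)) by exact: continuous_ccont.
have vC j l x : ComplexField.Normc.normc (V x (idx j) (idx l)) <= C * rho (1 + eps) x.
  by have := VC x (idx j) (idx l); rewrite /rho opprD.
have [Lam [Cst [Cst0 hres]]] := resolvent_high_energy hm s1 cv vC.
pose lambda1 := Num.max Lam m + 1.
have large (lambda gamma : R) : lambda1 < `|lambda| -> 0 < `|gamma| < 1 * `|lambda| ->
    complex.Im (Complex lambda gamma) != 0 /\ Lam <= ComplexField.Normc.normc (Complex lambda gamma).
  move=> l1 /andP[g0 _]; split; first by rewrite -normr_gt0.
  apply: le_trans (Re_le_cmod _); apply: ltW; apply: le_lt_trans l1.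
  by rewrite /lambda1 -[leLHS]addr0 lerD// le_max lexx.
split; last first.
  exists (box Lam); split; first exact: compact_box.
  move=> z zK zs; apply/eqP; apply/negPn/negP => z0; apply: zs.
  by have [] := hres z z0 (notin_box zK).
have sig0 : 0 <= sigma by apply: le_trans (ltW hsigma); rewrite invr_ge0.
have sig2 : 1 < 2 * sigma by rewrite -ltr_pdivrMl// mulr1.
have [I I0 hI] := integral_rho sig2.
pose N := Num.sqrt I.
have hN : (\int[lebesgue_measure]_x (rho (2 * sigma) x)%:E = (N ^+ 2)%:E)%E.
  by rewrite hI sqr_sqrtr.
have N0 : 0 <= N by exact: sqrtr_ge0.
exists lambda1, 1; split => //.
- by rewrite (@le_lt_trans _ _ (Num.max Lam m))// ?ltrDl// le_max lexx orbT.
- move=> lambda gamma l1 g1; have [z0 zL] := large _ _ l1 g1.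
  by have [] := hres _ z0 zL.
apply: (@le_lt_trans _ _ (2 * (Cst * (N * 1)) * N)%:E); last exact: ltry.
apply: ge_ereal_sup => _ [[lambda gamma] [/= l1 g1] <-].
apply: ge_ereal_sup => _ [g [Lg g_le1] <-].
have [z0 zL] := large _ _ l1 g1; have [[ex _ _] bnd] := hres _ z0 zL.
have Lh := L2_weight sig0 Lg.
have hu := xgetPex (fun=> 0) (ex _ Lh).
rewrite -/(resolvent H (Complex lambda gamma) (weight (- sigma) g)) in hu.
have [w [mw uw wB]] := bnd _ _ _ hu (fun j => L1_weight j Lg N0 ler01 hN g_le1).
have Lu : L2 (resolvent H (Complex lambda gamma) (weight (- sigma) g)).
  by case: hu => _ [g2 [_ [g1' [Lu _ _] _]] _].
have B0 : 0 <= Cst * (N * 1) by rewrite mulr1 mulr_ge0.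
exact: L2norm_weight sig0 Lu mw uw N0 B0 wB hN.
Qed.
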